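(* There exists a universal constant $c>0$ such that the following holds. Let $b=(b_1,b_2)\in\mathbb R^2$, let $B=b_1\,dx\wedge\omega+b_2\,dy\wedge\omega$ on $\mathbb H^1$, and set $|B|:=\sqrt{b_1^2+b_2^2}$. Then for any smooth $1$-form $A$ on $\mathbb H^1$ such that $dA=B$, the magnetic sub-Laplacian $-\Delta_A$, as a self-adjoint operator in $L^2(\mathbb H^1)$, satisfies $$\inf\sigma(-\Delta_A)=c\,|B|^{2/3}.$$
   Context: The Heisenberg group $\mathbb H^1$ is $\mathbb R^3$ with coordinates $(x,y,z)$ and left-invariant vector fields $X=\partial_x-\frac y2\partial_z$, $Y=\partial_y+\frac x2\partial_z$, $Z=\partial_z=[X,Y]$. The contact form is $\omega=dz-\frac12(x\,dy-y\,dx)$; $\{dx,dy,\omega\}$ is the dual basis of $\{X,Y,Z\}$. $L^2(\mathbb H^1)$ is taken with respect to Lebesgue measure $dq$. For a $1$-form $A=A_x\,dx+A_y\,dy+A_\omega\,\omega$ with smooth real coefficients, the magnetic sub-Laplacian $-\Delta_A$ is the non-negative self-adjoint operator in $L^2(\mathbb H^1)$ associated with the closure of the quadratic form $$Q_A(u)=\int_{\mathbb H^1}\left(|(X+iA_x)u|^2+|(Y+iA_y)u|^2\right)dq,\qquad u\in C^\infty_c(\mathbb H^1).$$ It does not depend on $A_\omega$. $\sigma(\cdot)$ denotes the spectrum. *)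

(* Defs.v *)
From HB Require Import structures.
From mathcomp Require Import all_boot all_order all_algebra.
From mathcomp Require Import all_classical all_reals all_analysis.
From mathcomp Require Import complex.
Import Order.TTheory GRing.Theory Num.Theory.
Import numFieldNormedType.Exports.

Set Implicit Arguments.
Unset Strict Implicit.
Unset Printing Implicit Defensive.

Local Open Scope classical_set_scope.
Local Open Scope ring_scope.
Local Open Scope complex_scope.

Notation heis R := (R * R * R)%type.
Notation heisM R := (measurableTypeR R * measurableTypeR R * measurableTypeR R)%type.

Section Calculus.
Context {R : realType}.
Implicit Types (f : heis R -> R) (u : heis R -> R[i]) (p : heis R).

Definition e_x : heis R := (1, 0, 0).
Definition e_y : heis R := (0, 1, 0).
Definition e_z : heis R := (0, 0, 1).

(* C^k: the partial derivatives of order at most k exist everywhere and are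
   continuous. *)
Fixpoint Ck (k : nat) f : Prop :=
  continuous f /\
  if k is j.+1 then
    {in [:: e_x; e_y; e_z], forall v,
      (forall p, derivable f p v) /\ Ck j (fun p => 'D_v f p)}
  else True.

Definition smooth f := forall k, Ck k f.

(* Points p are ((x, y), z): p.1.1 = x, p.1.2 = y, p.2 = z. *)
Definition vfX f p : R := 'D_e_x f p - p.1.2 / 2 * 'D_e_z f p.
Definition vfY f p : R := 'D_e_y f p + p.1.1 / 2 * 'D_e_z f p.

Definition vfXC u p : R[i] :=
  vfX (fun q => complex.Re (u q)) p +i* vfX (fun q => complex.Im (u q)) p.
Definition vfYC u p : R[i] :=
  vfY (fun q => complex.Re (u q)) p +i* vfY (fun q => complex.Im (u q)) p.

Definition test_function u :=
  [/\ smooth (fun p => complex.Re (u p)), smooth (fun p => complex.Im (u p)) &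
      compact (closure [set p | u p != 0])].

End Calculus.

Section Forms.
Context {R : realType}.

(* Coefficients in the coframe dx, dy, omega. *)
Record one_form := OneForm {
  c_dx : heis R -> R; c_dy : heis R -> R; c_om : heis R -> R }.

(* Coefficients of dx/\dy, dx/\omega, dy/\omega. *)
Record two_form := TwoForm {
  c_dxdy : heis R -> R; c_dxom : heis R -> R; c_dyom : heis R -> R }.

Definition smooth_form (A : one_form) :=
  [/\ smooth (c_dx A), smooth (c_dy A) & smooth (c_om A)].

(* Coefficients of dx, dy, dz, by omega = dz - (x dy - y dx) / 2. *)
Definition coord1 (A : one_form) (p : heis R) : R * R * R :=
  (c_dx A p + p.1.2 / 2 * c_om A p, c_dy A p - p.1.1 / 2 * c_om A p, c_om A p).

(* Coefficients of dx/\dy, dx/\dz, dy/\dz, by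
   dx/\omega = dx/\dz - x/2 dx/\dy and dy/\omega = dy/\dz - y/2 dx/\dy. *)
Definition coord2 (B : two_form) (p : heis R) : R * R * R :=
  (c_dxdy B p - p.1.1 / 2 * c_dxom B p - p.1.2 / 2 * c_dyom B p,
   c_dxom B p, c_dyom B p).

(* Exterior derivative of a1 dx + a2 dy + a3 dz, as the coefficients of
   dx/\dy, dx/\dz, dy/\dz. *)
Definition extd (a : heis R -> R * R * R) (p : heis R) : R * R * R :=
  let a1 q := (a q).1.1 in let a2 q := (a q).1.2 in let a3 q := (a q).2 in
  ('D_e_x a2 p - 'D_e_y a1 p, 'D_e_x a3 p - 'D_e_z a1 p, 'D_e_y a3 p - 'D_e_z a2 p).

Definition is_extd (A : one_form) (B : two_form) :=
  forall p, extd (coord1 A) p = coord2 B p.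

(* b1 dx/\omega + b2 dy/\omega *)
Definition const_field (b1 b2 : R) : two_form :=
  TwoForm (fun=> 0) (fun=> b1) (fun=> b2).

End Forms.
Arguments one_form R : clear implicits.
Arguments two_form R : clear implicits.

Section L2.
Context {R : realType}.
Implicit Types (u v f g : heis R -> R[i]).

Definition heis_measure : {measure set (heisM R) -> \bar R} :=
  ((@lebesgue_measure R \x @lebesgue_measure R) \x @lebesgue_measure R)%E.

Local Notation mu := heis_measure.

Definition cintegral (f : heis R -> R[i]) : R[i] :=
  (\int[mu]_p complex.Re (f p)) +i* (\int[mu]_p complex.Im (f p)).

Definition L2norm u : \bar R := 'N[mu]_(2%:E)[EFin \o @Normc.normc R \o u]%E.

(* Elements of L^2 are represented by functions, and two functions that are equal
   almost everywhere represent the same element. *)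
Definition L2 u :=
  [/\ measurable_fun [set: heisM R] (fun p => complex.Re (u p)),
      measurable_fun [set: heisM R] (fun p => complex.Im (u p)) & (L2norm u < +oo)%E].

Definition inner u v : R[i] := cintegral (fun p => u p * conjc (v p)).

(* A possibly unbounded operator in L^2 is given by its graph: T u f means that
   u is in the domain of T and T u = f.  The point z is in the resolvent set iff
   T - z maps the domain of T bijectively onto L^2 with a bounded inverse: the
   first clause is surjectivity, the second one gives injectivity and the bound
   on the inverse. *)
Definition resolvent_set (T : (heis R -> R[i]) -> (heis R -> R[i]) -> Prop)
    : set R[i] :=
  [set z |
    (forall g, L2 g -> exists u f, T u f /\
       {ae mu, forall p, f p - z * u p = g p}) /\
    (exists C : R, forall u f, T u f ->
       (L2norm u <= C%:E * L2norm (fun p => f p - z * u p)%R)%E)].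

Definition spectrum T : set R[i] := ~` resolvent_set T.

End L2.

Section MagneticLaplacian.
Context {R : realType} (A : one_form R).
Implicit Types (u v f : heis R -> R[i]).
Local Notation mu := (@heis_measure R).

(* X + i A_x and Y + i A_y. *)
Definition covX u p : R[i] := vfXC u p + (0 +i* c_dx A p) * u p.
Definition covY u p : R[i] := vfYC u p + (0 +i* c_dy A p) * u p.

Definition mag_quad u : R :=
  \int[mu]_p (Normc.normc (covX u p) ^+ 2 + Normc.normc (covY u p) ^+ 2).

(* The sesquilinear form of mag_quad. *)
Definition mag_sesq u v : R[i] :=
  cintegral (fun p => covX u p * conjc (covX v p) + covY u p * conjc (covY v p)).

(* u is in the domain of the closure of the form iff it is the L^2 limit of test
   functions that form a Cauchy sequence for the form; the closed form is then
   the limit along such sequences. *)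
Definition form_approx (u_ : nat -> heis R -> R[i]) u :=
  [/\ L2 u, forall n, test_function (u_ n),
      L2norm (u_ n \- u) @[n --> \oo] --> 0%E &
      mag_quad (u_ nm.1 \- u_ nm.2) @[nm --> (\oo, \oo)] --> (0 : R)].

Definition form_domain u := exists u_ : nat -> heis R -> R[i], form_approx u_ u.

Definition closed_form u v (l : R[i]) :=
  exists u_ v_ : nat -> heis R -> R[i], [/\ form_approx u_ u, form_approx v_ v,
    complex.Re (mag_sesq (u_ n) (v_ n)) @[n --> \oo] --> complex.Re l &
    complex.Im (mag_sesq (u_ n) (v_ n)) @[n --> \oo] --> complex.Im l].

(* The operator associated with the closed form q: u is in its domain and is
   mapped to f iff q(u, v) = <f, v> for all v in the form domain. *)
Definition magnetic_laplacian u f :=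
  [/\ form_domain u, L2 f &
      forall v, form_domain v -> closed_form u v (inner f v)].

End MagneticLaplacian.

(* Main.v *)
(* Let m(A) be the infimum of the Rayleigh quotients Q_A(w) / |w|^2 over test functions.
   Then inf sigma(-Delta_A) = m(A).  For t < m(A), a minimizing sequence of
   Q_A(w) - t |w|^2 - 2 Re <g, w> converges to a solution of (-Delta_A - t) u = g.  If
   -Delta_A - m(A) had an inverse of norm C, then for (-Delta_A - m(A)) u = w the
   Cauchy-Schwarz inequality for a = Q_A - m(A) |.|^2 would give
   |w|^4 = a(u, w)^2 <= a(u, u) a(w, w) <= C |w|^2 a(w, w), bounding the quotients away
   from m(A).

   By the Poincare lemma two potentials of the same B differ by some d phi, and the
   multiplication by e^{i phi} intertwines their forms.  Rotations and dilations carry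
   the field dx/\omega to any other constant field and multiply the form by |B|^(2/3),
   so that c is m(A) for dx/\omega.

   To see that c > 0, take A = x^2/2 dy + x omega.  Parallel transport along a closed
   loop of segments of the flows of X and Y, of X-length 4 and Y-length 4 pi, is the
   multiplication by e^{i pi} = -1, whatever the starting point.  Transport for a time t
   along X is unitary and moves u by at most |t| |(X + i A_x) u|, and likewise for Y;
   hence 2 |u| <= 4 |(X + i A_x) u| + 4 pi |(Y + i A_y) u|. *)

Require Import Defs.
From HB Require Import structures.
From mathcomp Require Import all_boot all_order all_algebra.
From mathcomp Require Import all_classical all_reals all_analysis.
From mathcomp Require Import measurable_realfun complex ring lra.
Import Order.TTheory GRing.Theory Num.Theory.
Import numFieldNormedType.Exports.
Set Implicit Arguments.
Unset Strict Implicit.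
Unset Printing Implicit Defensive.
Local Open Scope classical_set_scope.
Local Open Scope ring_scope.

(** The closed form is defined by limits along approximating sequences, so nothing can be computed
    for -Delta_A before these limits are known not to depend on the sequence. This is closability,
    and it rests on integration by parts for X and Y. The integral curves of X and Y are straight
    lines and their flows preserve Lebesgue measure; integration by parts and parallel transport
    thus reduce to one-variable calculus along p + t V(p).

    The exponent 2/3 arises because a dilation by r multiplies the form by r^2 but the field by r^3,
    so that r = |B|^(1/3).

    The loop must close up in the group, hence its projection to the (x, y)-plane encloses zero
    signed area. It is a figure eight made of two 1 x pi rectangles that touch at a corner and are
    run through in opposite senses. What survives is the difference in x between them: the phase is
    a second difference of x^2/2, which is constant. The side pi makes it -1, the point of the unit
    circle farthest from 1. *)

Section Lines.
Context {R : realType} {V : normedModType R}.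
Implicit Types (f : V -> R) (p v : V).

Lemma is_derive_line f p v (s : R) l :
  is_derive (p + s *: v) v f l -> is_derive s 1 (fun t => f (p + t *: v)) l.
Proof.
move=> [dfl <-].
have E : (fun h : R => h^-1 *: (((fun t => f (p + t *: v)) \o shift s) (h *: 1) - f (p + s *: v))) =
   (fun h : R => h^-1 *: ((f \o shift (p + s *: v)) (h *: v) - f (p + s *: v))).
  apply/funext => h /=; congr (_ *: (f _ - _)).
  by rewrite scalerDl addrCA [h%:A]mulr1.
apply: DeriveDef; first by rewrite /derivable E.
by rewrite /derive E.
Qed.

(** The bound |s| <= |t|, for both signs of t, is what lets the intermediate point be sent to 0 or
    kept inside a fixed box. *)
Lemma mvt_line f p v (df : V -> R) (t : R) :
  (forall s : R, is_derive (p + s *: v) v f (df (p + s *: v))) ->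
  exists2 s : R, `|s| <= `|t| & f (p + t *: v) - f p = t * df (p + s *: v).
Proof.
move=> dfv.
pose g := fun t : R => f (p + t *: v).
have dg (s : R) : is_derive s 1 g (df (p + s *: v)) by apply: is_derive_line.
have cg (a b : R) : {within `[a, b], continuous g}.
  by apply: derivable_within_continuous => x _; case: (dg x).
have -> : f (p + t *: v) - f p = g t - g 0 by rewrite /g scale0r addr0.
have [t0|t0] := leP 0 t.
  have [c] := MVT_segment t0 (fun x _ => dg x) (cg _ _).
  rewrite in_itv /= => /andP[c0 ct] ->; exists c; last by rewrite subr0 mulrC.
  by rewrite ger0_norm // ger0_norm.
have [c] := MVT_segment (ltW t0) (fun x _ => dg x) (cg _ _).
rewrite in_itv /= => /andP[c0 ct] E; exists c.
  by rewrite ler0_norm // ltr0_norm // lerN2.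
rewrite -[LHS]opprB E sub0r; ring.
Qed.

End Lines.

(** * Differentiability of C^1 functions on R^3 *)

Section C1.
Context {R : realType}.
Local Notation H := (heis R).
Implicit Types (f : H -> R) (p v : H).

Definition lin3 (a b c : R) (v : H) : R := v.1.1 * a + v.1.2 * b + v.2 * c.

Lemma lin3_linear a b c : linear (lin3 a b c).
Proof.
move=> k u v; rewrite /lin3 /=.
rewrite /GRing.scale /=; ring.
Qed.

HB.instance Definition _ a b c :=
  GRing.isLinear.Build R H R *:%R (lin3 a b c) (lin3_linear a b c).

Lemma lin3_continuous a b c : continuous (lin3 a b c).
Proof.
move=> p; apply: cvgD; first apply: cvgD.
all: apply: cvgMl => /=.
- exact: (cvg_comp _ _ cvg_fst cvg_fst).
- exact: (cvg_comp _ _ cvg_fst cvg_snd).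
- exact: cvg_snd.
Qed.

Lemma heis_normE p : `|p| = Num.max (Num.max `|p.1.1| `|p.1.2|) `|p.2|.
Proof. by []. Qed.

Lemma heis_norm_lt p (e : R) : `|p| < e <-> [/\ `|p.1.1| < e, `|p.1.2| < e & `|p.2| < e].
Proof. by rewrite heis_normE !gt_max; split=> [/andP[/andP[]]|[-> ->]]. Qed.

Lemma heis_norm_le p (e : R) : `|p| <= e <-> [/\ `|p.1.1| <= e, `|p.1.2| <= e & `|p.2| <= e].
Proof. by rewrite heis_normE !ge_max; split=> [/andP[/andP[]]|[-> ->]]. Qed.

(** The increment is taken along three segments parallel to the axes; the mean value theorem on each
    one and the continuity of the partial derivatives at p leave three errors of at most eps/3 times
    the norm. This is needed because [Ck] only speaks of the coordinate directions, which X and Y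
    are not. *)
Lemma C1_is_diff f (fx fy fz : H -> R) p :
  (forall q, is_derive q e_x f (fx q)) -> (forall q, is_derive q e_y f (fy q)) ->
  (forall q, is_derive q e_z f (fz q)) ->
  {for p, continuous fx} -> {for p, continuous fy} -> {for p, continuous fz} ->
  is_diff p f (lin3 (fx p) (fy p) (fz p)).
Proof.
move=> dx dy dz cx cy cz.
have E : f \o shift p = cst (f p) + lin3 (fx p) (fy p) (fz p) +o_ (0 : H) id.
  apply/eqaddoP => _/posnumP[eps].
  have e3 : 0 < eps%:num / 3 by rewrite divr_gt0.
  move: cx cy cz => /cvgrPdist_le /(_ _ e3) /nbhs_ballP[/= dlx dlx0 cx].
  move=> /cvgrPdist_le /(_ _ e3) /nbhs_ballP[/= dly dly0 cy].
  move=> /cvgrPdist_le /(_ _ e3) /nbhs_ballP[/= dlz dlz0 cz].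
  apply/nbhs_ballP; exists (Num.min dlx (Num.min dly dlz)) => /=.
    by rewrite !lt_min dlx0 dly0.
  move=> [[a b] c]; rewrite -ball_normE /= sub0r normrN !lt_min => /and3P[hx hy hz].
  have /heis_norm_le[/= ha hb hc] : `|((a, b), c) : H| <= `|((a, b), c) : H| by [].
  set n := `|((a, b), c) : H| in ha hb hc hx hy hz *.
  have -> : (f \o shift p - (cst (f p) + lin3 (fx p) (fy p) (fz p))) (a, b, c) =
    f ((a,b,c) + p) - (f p + lin3 (fx p) (fy p) (fz p) (a, b, c)) by [].
  have [s1 s1a E1] := mvt_line a (fun s => dx (p + s *: e_x)).
  have [s2 s2b E2] := mvt_line b (fun s => dy (p + a *: e_x + s *: e_y)).
  have [s3 s3c E3] := mvt_line c (fun s => dz (p + a *: e_x + b *: e_y + s *: e_z)).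
  have -> : (a, b, c) + p = p + a *: e_x + b *: e_y + c *: e_z.
    rewrite /e_x /e_y /e_z; case: p {cx cy cz E1 E2 E3} => [[x y] z].
    by congr (_, _, _); rewrite /= /GRing.scale /=; ring.
  have -> : f (p + a *: e_x + b *: e_y + c *: e_z) -
      (f p + lin3 (fx p) (fy p) (fz p) (a, b, c)) =
     a * (fx (p + s1 *: e_x) - fx p) + b * (fy (p + a *: e_x + s2 *: e_y) - fy p)
     + c * (fz (p + a *: e_x + b *: e_y + s3 *: e_z) - fz p).
    rewrite /lin3 /= !mulrBr -E1 -E2 -E3; ring.
  have nb (w : H) (d : R) : `|w| < d -> ball p d (p + w).
    by rewrite -ball_normE /= opprD addrA subrr sub0r normrN.
  have B1 : `|fx (p + s1 *: e_x) - fx p| <= eps%:num / 3.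
    rewrite distrC; apply/cx/nb.
    apply/heis_norm_lt; rewrite /= /GRing.scale /= !(mulr0, mulr1, normr0); split=> //.
    by apply: le_lt_trans hx; apply: le_trans ha.
  have B2 : `|fy (p + a *: e_x + s2 *: e_y) - fy p| <= eps%:num / 3.
    rewrite distrC; rewrite -addrA; apply/cy/nb.
    apply/heis_norm_lt; rewrite /= /GRing.scale /= !(mulr0, mulr1, normr0, addr0, add0r); split=> //.
    - by apply: le_lt_trans hy.
    - by apply: le_lt_trans hy; apply: le_trans hb.
  have B3 : `|fz (p + a *: e_x + b *: e_y + s3 *: e_z) - fz p| <= eps%:num / 3.
    rewrite distrC; rewrite -2!addrA; apply/cz/nb.
    apply/heis_norm_lt; rewrite /= /GRing.scale /= !(mulr0, mulr1, normr0, addr0, add0r); split=> //.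
    - by apply: le_lt_trans hz.
    - by apply: le_lt_trans hz.
    - by apply: le_lt_trans hz; apply: le_trans hc.
  apply: (@le_trans _ _ (n * (eps%:num / 3) + n * (eps%:num / 3) + n * (eps%:num / 3))).
    apply: (le_trans (ler_normD _ _)); apply: lerD; last by rewrite normrM ler_pM.
    by apply: (le_trans (ler_normD _ _)); apply: lerD; rewrite normrM ler_pM.
  by rewrite le_eqVlt; apply/orP; left; apply/eqP; field.
have D := diff_unique (@lin3_continuous _ _ _) E.
apply: DiffDef => //.
by apply/diff_locallyP; rewrite D; split=> //; exact: lin3_continuous.
Qed.

End C1.

(** * Functions of class C^k *)

Section Ck_theory.
Context {R : realType}.
Local Notation H := (heis R).
Implicit Types (f g : H -> R) (p v : H).

Lemma Ck_continuous k f : Ck k f -> continuous f.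
Proof. by case: k => [|k] []. Qed.

Lemma CkS_derive k f : Ck k.+1 f ->
  (forall v, v \in [:: e_x; e_y; e_z] -> forall p, is_derive p v f ('D_v f p)) /\
  (forall v, v \in [:: e_x; e_y; e_z] -> Ck k (fun p => 'D_v f p)).
Proof.
move=> [_ h]; split=> v /h [d c] //.
Qed.

(** The continuity of [f], which [Ck] demands at each level, is deduced from its
    differentiability. *)
Lemma CkS_intro k f fx fy fz :
  (forall q, is_derive q e_x f (fx q)) -> (forall q, is_derive q e_y f (fy q)) ->
  (forall q, is_derive q e_z f (fz q)) ->
  Ck k fx -> Ck k fy -> Ck k fz -> Ck k.+1 f.
Proof.
move=> dx dy dz cx cy cz; split.
  move=> p; apply: differentiable_continuous.
  have := C1_is_diff dx dy dz (Ck_continuous cx (x := p)) (Ck_continuous cy (x := p))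
    (Ck_continuous cz (x := p)).
  by case.
move=> v; rewrite !inE => /or3P[] /eqP ->; split=> [p|].
- by case: (dx p).
- by rewrite (_ : (fun p => _) = fx) //; apply/funext => p; case: (dx p).
- by case: (dy p).
- by rewrite (_ : (fun p => _) = fy) //; apply/funext => p; case: (dy p).
- by case: (dz p).
- by rewrite (_ : (fun p => _) = fz) //; apply/funext => p; case: (dz p).
Qed.

Lemma Ck_elim k f : Ck k.+1 f -> exists fx fy fz,
  [/\ forall q, is_derive q e_x f (fx q), forall q, is_derive q e_y f (fy q),
      forall q, is_derive q e_z f (fz q) & [/\ Ck k fx, Ck k fy & Ck k fz]].
Proof.
move=> /CkS_derive[h1 h2].
exists ('D_e_x f), ('D_e_y f), ('D_e_z f).
by split; [apply: h1..|split; apply: h2]; rewrite !inE eqxx ?orbT.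
Qed.

Lemma CkW k f : Ck k.+1 f -> Ck k f.
Proof.
elim: k f => [|k IH] f; first by case.
move=> /Ck_elim[fx [fy [fz [dx dy dz [cx cy cz]]]]].
by apply: (CkS_intro dx dy dz); apply: IH.
Qed.

Lemma Ck_cst k (c : R) : Ck k (fun=> c).
Proof.
elim: k c => [|k IH] c; first by split => // p; apply: cvg_cst.
by apply: (@CkS_intro _ _ (fun=> 0) (fun=> 0) (fun=> 0)) => // q; apply: is_derive_cst.
Qed.

Lemma Ck_add k f g : Ck k f -> Ck k g -> Ck k (fun p => f p + g p).
Proof.
elim: k f g => [|k IH] f g.
  by move=> [cf _] [cg _]; split => // p; apply: cvgD; [apply: cf|apply: cg].
move=> /Ck_elim[fx [fy [fz [dx dy dz [cx cy cz]]]]].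
move=> /Ck_elim[gx [gy [gz [ex ey ez [bx by_ bz]]]]].
apply: (@CkS_intro _ _ (fun p => fx p + gx p) (fun p => fy p + gy p) (fun p => fz p + gz p)).
- exact: (IH fx gx).
- exact: (IH fy gy).
- exact: (IH fz gz).
Qed.

Lemma is_deriveMul (V : normedModType R) (f g : V -> R) (p v : V) (l m : R) :
  is_derive p v f l -> is_derive p v g m ->
  is_derive p v (fun q => f q * g q) (l * g p + f p * m).
Proof.
move=> df dg; have D := is_deriveM df dg; apply: (is_derive_eq D).
by rewrite /GRing.scale /=; ring.
Qed.

Lemma Ck_mul k f g : Ck k f -> Ck k g -> Ck k (fun p => f p * g p).
Proof.
elim: k f g => [|k IH] f g.
  by move=> [cf _] [cg _]; split => // p; apply: cvgM; [apply: cf|apply: cg].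
move=> hf hg; have cf := CkW hf; have cg := CkW hg; move: hf hg.
move=> /Ck_elim[fx [fy [fz [dx dy dz [cx cy cz]]]]].
move=> /Ck_elim[gx [gy [gz [ex ey ez [bx by_ bz]]]]].
apply: (@CkS_intro _ _ (fun p => fx p * g p + f p * gx p)
  (fun p => fy p * g p + f p * gy p) (fun p => fz p * g p + f p * gz p)).
- by move=> q; apply: (is_deriveMul (dx q) (ex q)).
- by move=> q; apply: (is_deriveMul (dy q) (ey q)).
- by move=> q; apply: (is_deriveMul (dz q) (ez q)).
- by apply: Ck_add; apply: IH.
- by apply: Ck_add; apply: IH.
- by apply: Ck_add; apply: IH.
Qed.

Lemma is_derive_comp1 (h : R -> R) f p v l m :
  is_derive (f p) 1 h m -> is_derive p v f l -> is_derive p v (fun q => h (f q)) (m * l).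
Proof.
move=> dh df.
have df0 : is_derive (0 : R) 1 (fun t => f (p + t *: v)) l.
  by apply: is_derive_line; rewrite scale0r addr0.
have dh0 : is_derive (f (p + (0:R) *: v)) 1 h m by rewrite scale0r addr0.
have dhf := is_derive1_comp dh0 df0.
have E : (fun t : R => t^-1 *: (((fun q => h (f q)) \o shift p) (t *: v) - h (f p))) =
  (fun t : R => t^-1 *: (((h \o (fun t => f (p + t *: v))) \o shift 0) (t *: (1 : R))
    - (h \o (fun t => f (p + t *: v))) 0)).
  apply/funext => t /=; rewrite scale0r !addr0; congr (_ *: (h (f _) - _)).
  by rewrite [t%:A]mulr1 addrC.
case: dhf => dv vv; apply: DeriveDef; first by rewrite /derivable E.
by rewrite /derive E.
Qed.

(** The sequence [h] lists the successive derivatives of [h 0]. Keeping the index [n] general lets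
    the induction on k pass from [h n] to [h n.+1]. *)
Lemma Ck_comp k (h : nat -> R -> R) f n :
  (forall n (x : R), is_derive x 1 (h n) (h n.+1 x)) -> Ck k f ->
  Ck k (fun p => h n (f p)).
Proof.
move=> dh; elim: k n f => [|k IH] n f.
  move=> [cf _]; split => // p; apply: continuous_comp; first exact: cf.
  by apply: differentiable_continuous; apply/derivable1_diffP; case: (dh n (f p)).
move=> hf; have cf := CkW hf; move: hf.
move=> /Ck_elim[fx [fy [fz [dx dy dz [cx cy cz]]]]].
apply: (@CkS_intro _ _ (fun p => h n.+1 (f p) * fx p)
  (fun p => h n.+1 (f p) * fy p) (fun p => h n.+1 (f p) * fz p)).
- by move=> q; apply: is_derive_comp1.
- by move=> q; apply: is_derive_comp1.
- by move=> q; apply: is_derive_comp1.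
- by apply: Ck_mul => //; apply: IH.
- by apply: Ck_mul => //; apply: IH.
- by apply: Ck_mul => //; apply: IH.
Qed.

Lemma Ck1_is_derive k f p v : Ck k.+1 f ->
  is_derive p v f (v.1.1 * 'D_e_x f p + v.1.2 * 'D_e_y f p + v.2 * 'D_e_z f p).
Proof.
move=> /CkS_derive[h1 h2].
have dx q : is_derive q e_x f ('D_e_x f q) by apply: h1; rewrite !inE eqxx ?orbT.
have dy q : is_derive q e_y f ('D_e_y f q) by apply: h1; rewrite !inE eqxx ?orbT.
have dz q : is_derive q e_z f ('D_e_z f q) by apply: h1; rewrite !inE eqxx ?orbT.
have cx : continuous ('D_e_x f) by apply/Ck_continuous/h2; rewrite !inE eqxx ?orbT.
have cy : continuous ('D_e_y f) by apply/Ck_continuous/h2; rewrite !inE eqxx ?orbT.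
have cz : continuous ('D_e_z f) by apply/Ck_continuous/h2; rewrite !inE eqxx ?orbT.
have D := C1_is_diff dx dy dz (cx p) (cy p) (cz p).
apply: DeriveDef; first by apply: diff_derivable; case: D.
by rewrite deriveE; [rewrite diff_val|case: D].
Qed.

Lemma is_derive_affine (L L0 : H -> H) f p v l :
  (forall q (t : R), L (q + t *: v) = L q + t *: L0 v) ->
  is_derive (L p) (L0 v) f l -> is_derive p v (f \o L) l.
Proof.
move=> LE [df <-].
have E : (fun t : R => t^-1 *: (((f \o L) \o shift p) (t *: v) - (f \o L) p)) =
  (fun t : R => t^-1 *: ((f \o shift (L p)) (t *: L0 v) - f (L p))).
  by apply/funext => t /=; congr (_ *: (f _ - _)); rewrite addrC LE addrC.
apply: DeriveDef; first by rewrite /derivable E.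
by rewrite /derive E.
Qed.

(** The partial derivatives of f \o L are constant combinations of those of f composed with L, so
    that the statement reproduces itself one degree lower. *)
Lemma Ck_affine k (L L0 : H -> H) f : continuous L ->
  (forall v q (t : R), L (q + t *: v) = L q + t *: L0 v) ->
  Ck k f -> Ck k (f \o L).
Proof.
move=> cL LE; elim: k f => [|k IH] f.
  by move=> [cf _]; split => // p; apply: continuous_comp; [apply: cL|apply: cf].
move=> hf.
have /CkS_derive[_ cD] := hf.
have cx := IH _ (cD e_x ltac:(by rewrite !inE eqxx ?orbT)).
have cy := IH _ (cD e_y ltac:(by rewrite !inE eqxx ?orbT)).
have cz := IH _ (cD e_z ltac:(by rewrite !inE eqxx ?orbT)).
have C v : Ck k (fun p => (L0 v).1.1 * 'D_e_x f (L p) + (L0 v).1.2 * 'D_e_y f (L p) + (L0 v).2 * 'D_e_z f (L p)).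
  exact: (Ck_add (Ck_add (Ck_mul (Ck_cst k _) cx) (Ck_mul (Ck_cst k _) cy))
    (Ck_mul (Ck_cst k _) cz)).
have D v q : is_derive q v (f \o L)
    ((L0 v).1.1 * 'D_e_x f (L q) + (L0 v).1.2 * 'D_e_y f (L q) + (L0 v).2 * 'D_e_z f (L q)).
  by apply: is_derive_affine (LE v) _; apply: Ck1_is_derive hf.
exact: (CkS_intro (D _) (D _) (D _)).
Qed.

Lemma is_derive_coord p v : [/\ is_derive p v (fun q : H => q.1.1) v.1.1,
  is_derive p v (fun q : H => q.1.2) v.1.2 & is_derive p v (fun q : H => q.2) v.2].
Proof.
have K (g : H -> R) : (forall t : R, g (p + t *: v) = g p + t * g v) -> is_derive p v g (g v).
  move=> gE; have E : (fun t : R => t^-1 *: ((g \o shift p) (t *: v) - g p)) @ 0^' --> g v.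
    apply: (@cvg_trans _ ((fun=> g v) @ (0:R)^')); last exact: cvg_cst.
    apply: near_eq_cvg; near=> t; rewrite /= [_ + p]addrC gE addrAC subrr add0r.
    by rewrite /GRing.scale /= mulKf //; near: t; exact: nbhs_dnbhs_neq.
  by apply: DeriveDef; [apply/cvg_ex; exists (g v)|apply/cvg_lim].
by split; apply: K.
Unshelve. all: end_near. Qed.

Lemma Ck_coord k : [/\ Ck k (fun q : H => q.1.1), Ck k (fun q : H => q.1.2) &
  Ck k (fun q : H => q.2)].
Proof.
case: k => [|k].
  split; split => // p.
  - exact: (cvg_comp _ _ cvg_fst cvg_fst).
  - exact: (cvg_comp _ _ cvg_fst cvg_snd).
  - exact: cvg_snd.
by split; [apply: (@CkS_intro _ _ (fun=> e_x.1.1) (fun=> e_y.1.1) (fun=> e_z.1.1))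
         |apply: (@CkS_intro _ _ (fun=> e_x.1.2) (fun=> e_y.1.2) (fun=> e_z.1.2))
         |apply: (@CkS_intro _ _ (fun=> e_x.2) (fun=> e_y.2) (fun=> e_z.2))];
  do ?[by move=> q; case: (is_derive_coord q e_x)
  | by move=> q; case: (is_derive_coord q e_y)
  | by move=> q; case: (is_derive_coord q e_z)| exact: Ck_cst].
Qed.

(** The 4-periodic list of derivatives of cos, entered at position j: j = 0 starts at cos and j = 3
    at sin, so that one family feeds [Ck_comp] for both. *)
Definition trig (j n : nat) (x : R) : R :=
  match ((j + n) %% 4)%N with 0 => cos x | 1 => - sin x | 2 => - cos x | _ => sin x end.

Lemma is_derive_trig j n (x : R) : is_derive x 1 (trig j n) (trig j n.+1 x).
Proof.
rewrite /trig addnS -[(j + n).+1]addn1 -(modnDml (j + n) 1 4).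
have := @ltn_pmod (j + n) 4 isT; move: ((j + n) %% 4)%N => [|[|[|[|]]]] //= _.
- exact: is_derive_cos.
- exact: (is_deriveN (is_derive_sin _)).
- by have D := is_deriveN (is_derive_cos x); rewrite opprK in D.
- exact: is_derive_sin.
Qed.

Lemma Ck_cos k f : Ck k f -> Ck k (fun p => cos (f p)).
Proof. exact: (@Ck_comp k (trig 0) f 0 (@is_derive_trig 0)). Qed.

Lemma Ck_sin k f : Ck k f -> Ck k (fun p => sin (f p)).
Proof. exact: (@Ck_comp k (trig 3) f 0 (@is_derive_trig 3)). Qed.

End Ck_theory.

(** * Integration over the Heisenberg group *)

Section Lebesgue_affine.
Context {R : realType}.
Local Notation lam := (@lebesgue_measure R).
Local Open Scope ereal_scope.

Lemma continuous_measurableR (f : R -> R) : continuous f ->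
  measurable_fun [set: measurableTypeR R] (f : measurableTypeR R -> measurableTypeR R).
Proof. exact: continuous_measurable_fun. Qed.

Lemma measurable_affine (r a : R) :
  measurable_fun [set: measurableTypeR R]
    ((fun x => r * x + a)%R : measurableTypeR R -> measurableTypeR R).
Proof.
apply: continuous_measurableR => x; apply: cvgD; last exact: cvg_cst.
by apply: cvgMr.
Qed.

(** The push-forward of Lebesgue measure by x |-> r x + a, multiplied by r, gives every interval ]c,
    d] its length, hence is Lebesgue measure by uniqueness. The formula is then integration against
    a push-forward. *)
Lemma ge0_integral_affine (r a : R) (G : measurableTypeR R -> \bar R) : (0 < r)%R ->
  measurable_fun setT G -> (forall x, 0 <= G x) ->
  \int[lam]_x G x = r%:E * \int[lam]_x G (r * x + a)%R.
Proof.
move=> r0 mG G0.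
pose phi := (fun x => r * x + a)%R : measurableTypeR R -> measurableTypeR R.
have mphi : measurable_fun setT phi := measurable_affine r a.
pose pf : {measure set (measurableTypeR R) -> \bar R} :=
  measure_function_pushforward__canonical__measure_function_Measure lam mphi.
pose k : {nonneg R} := NngNum (ltW r0).
pose mu' : {measure set (measurableTypeR R) -> \bar R} :=
  mscale k pf.
have E A : measurable A -> lam A = mu' A.
  apply: lebesgue_measure_unique => _ [[c d] /= _ <-].
  rewrite /mu' /= /mscale /= /pushforward /=.
  have -> : phi @^-1` `]c, d] = `](c - a) / r, (d - a) / r]%classic%R.
    apply/seteqP; split => x; rewrite /phi /= !in_itv /=.
      by rewrite ltr_pdivrMr // ler_pdivlMr // ltrBlDr lerBrDr (mulrC x).
    by rewrite ltr_pdivrMr // ler_pdivlMr // ltrBlDr lerBrDr (mulrC x).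
  rewrite !lebesgue_measure_itv /= !lte_fin ltr_pM2r ?invr_gt0 // ltrD2r.
  case: ifPn => // _; last by rewrite mule0.
  by rewrite -!EFinD -EFinM; congr EFin; field; rewrite gt_eqF.
rewrite (eq_measure_integral mu'); last by move=> A mA _; exact: E.
rewrite ge0_integral_mscale //; congr (_ * _).
by rewrite ge0_integral_pushforward.
Qed.

End Lebesgue_affine.

Section heis_measurable.
Context {R : realType}.
Local Notation H := (heis R).
Local Notation M := (heisM R).

(** Measurability refers to the product sigma-algebra, so open sets have to be written as countable
    unions of products: here the balls of the sup norm with rational centre and radius 1/(n+1) that
    the set contains. *)
Lemma open_heis_measurable (U : set H) : open U -> measurable (U : set M).
Proof.
move=> oU.
pose q3 (q : rat * rat * rat) : H := (ratr q.1.1, ratr q.1.2, ratr q.2).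
pose B (i : rat * rat * rat * nat) : set M :=
  if `[< ball (q3 i.1) i.2.+1%:R^-1 `<=` U >] then ball (q3 i.1) i.2.+1%:R^-1 else set0.
have -> : (U : set M) = \bigcup_i B i.
  apply/seteqP; split => [p Up|p [[q n] _]]; last first.
    by rewrite /B; case: asboolP => //= h /h.
  have /nbhs_ballP[e /= e0 he] := open_nbhs_nbhs (conj oU Up).
  have [n ne] : exists n, n.+1%:R^-1 < e / 2.
    have e2 : 0 < e / 2 by rewrite divr_gt0.
    have [n _ hn] := near_infty_natSinv_lt (PosNum e2).
    by exists n; apply: (hn n) => /=.
  have n0 : 0 < n.+1%:R^-1 :> R by rewrite invr_gt0.
  have dq (x : R) : exists q : rat, `|ratr q - x| < n.+1%:R^-1.
    have : x - n.+1%:R^-1 < x + n.+1%:R^-1 by rewrite ltrD2l gtrN.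
    move=> /rat_in_itvoo[q]; rewrite in_itv /= => hq.
    by exists q; rewrite ltr_distl.
  have [q1 h1] := dq p.1.1; have [q2 h2] := dq p.1.2; have [q3' h3] := dq p.2.
  exists ((q1, q2, q3'), n) => //; rewrite /B asboolT /=.
    by split; [split|]; rewrite -ball_normE.
  move=> s [[/= s1 s2] s3]; apply: he.
  have tri (x y z : R) : `|x - y| < n.+1%:R^-1 -> ball x n.+1%:R^-1 z -> ball y e z.
    rewrite -!ball_normE /= => hx hz.
    rewrite (_ : y - z = - (x - y) + (x - z)); last ring.
    apply: (le_lt_trans (ler_normD _ _)); rewrite normrN.
    by rewrite [e]splitr; apply: ltrD; apply: lt_trans ne.
  by split; [split|] => /=; [apply: tri h1 s1|apply: tri h2 s2|apply: tri h3 s3].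
apply: countable_bigcupT_measurable => [|i]; first exact: countableP.
rewrite /B; case: asboolP => _ //.
rewrite (_ : ball _ _ = (ball (q3 i.1).1.1 i.2.+1%:R^-1 `*` ball (q3 i.1).1.2 i.2.+1%:R^-1)
  `*` ball (q3 i.1).2 i.2.+1%:R^-1) //.
have mb (x : R) : measurable (ball x i.2.+1%:R^-1 : set (measurableTypeR R)).
  by apply: open_measurable; apply: ball_open; rewrite invr_gt0.
by apply: measurableX => //; apply: measurableX.
Qed.

Lemma continuous_heis_measurable (f : H -> R) : continuous f ->
  measurable_fun [set: M] (f : M -> measurableTypeR R).
Proof.
move=> /continuousP cf; apply: (measurability _ (RGenOpens.measurableE R)).
move=> _ [_ [a [b ->] <-]]; rewrite setTI; apply: open_heis_measurable.
exact/cf/interval_open.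
Qed.

Lemma cont_coord1 : continuous (fun p : H => p.1.1).
Proof. by have [] := @Ck_coord R 0 => -[]. Qed.
Lemma cont_coord2 : continuous (fun p : H => p.1.2).
Proof. by have [] := @Ck_coord R 0 => _ []. Qed.
Lemma cont_coord3 : continuous (fun p : H => p.2).
Proof. by have [] := @Ck_coord R 0 => _ _ []. Qed.

End heis_measurable.

(** * Changes of variables and their Jacobians *)

Section change_of_variables.
Context {R : realType}.
Local Open Scope ereal_scope.

(** The number k plays the role of the Jacobian of [phi]. Stated through integrals of non-negative
    functions, the property is stable under composition and compatible with Tonelli. *)
Definition rescales d (T : measurableType d) (m : set T -> \bar R) (k : R) (phi : T -> T) :=
  measurable_fun setT phi /\
  forall F : T -> \bar R, measurable_fun setT F -> (forall x, 0 <= F x) ->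
    \int[m]_x F x = k%:E * \int[m]_x F (phi x).

Lemma rescales_comp d (T : measurableType d) (m : set T -> \bar R) k l phi psi :
  rescales m k phi -> rescales m l psi -> rescales m (k * l)%R (phi \o psi).
Proof.
move=> [mphi Ephi] [mpsi Epsi]; split=> [|F mF F0]; first exact: measurableT_comp.
have mFphi : measurable_fun setT (F \o phi) by exact: measurableT_comp.
by rewrite Ephi // (Epsi _ mFphi (fun x => F0 (phi x))) EFinM muleA.
Qed.

Context d1 d2 (T1 : measurableType d1) (T2 : measurableType d2).
Context (m1 : {sigma_finite_measure set T1 -> \bar R}) (m2 : {sigma_finite_measure set T2 -> \bar R}).

(** By Tonelli: a map that moves only the second coordinate, with the same Jacobian on all fibres,
    has that Jacobian. Shears and partial dilations are of this kind. *)
Lemma rescales_prod2 (k : R) (psi : T1 * T2 -> T2) : (0 <= k)%R ->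
  measurable_fun setT psi ->
  (forall x, rescales m2 k (fun y => psi (x, y))) ->
  rescales (m1 \x m2) k (fun p => (p.1, psi p)).
Proof.
move=> k0 mpsi H.
have mP : measurable_fun setT (fun p : T1 * T2 => (p.1, psi p)).
  exact: measurable_fun_pair.
split=> // F mF F0.
have mFP : measurable_fun setT (F \o (fun p : T1 * T2 => (p.1, psi p))).
  exact: measurableT_comp.
rewrite fubini_tonelli1 // (fubini_tonelli1 (F \o _)) //=.
rewrite -ge0_integralZl_EFin //; last 2 first.
- by move=> x _; apply: integral_ge0 => y _; exact: F0.
- by apply: measurable_fun_fubini_tonelli_F => // p; exact: F0.
apply: eq_integral => x _; have [_ /(_ (fun y => F (x, y)))] := H x.
by apply=> //; exact: measurableT_comp (pair1_measurable x).
Qed.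

Lemma rescales_prod1 (k : R) (psi : T1 * T2 -> T1) : (0 <= k)%R ->
  measurable_fun setT psi ->
  (forall y, rescales m1 k (fun x => psi (x, y))) ->
  rescales (m1 \x m2) k (fun p => (psi p, p.2)).
Proof.
move=> k0 mpsi H.
have mP : measurable_fun setT (fun p : T1 * T2 => (psi p, p.2)).
  exact: measurable_fun_pair.
split=> // F mF F0.
have mFP : measurable_fun setT (F \o (fun p : T1 * T2 => (psi p, p.2))).
  exact: measurableT_comp.
rewrite fubini_tonelli2 // (fubini_tonelli2 (F \o _)) //=.
rewrite -ge0_integralZl_EFin //; last 2 first.
- by move=> x _; apply: integral_ge0 => y _; exact: F0.
- by apply: measurable_fun_fubini_tonelli_G => // p; exact: F0.
apply: eq_integral => y _; have [_ /(_ (fun x => F (x, y)))] := H y.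
by apply=> //; exact: measurableT_comp (pair2_measurable y).
Qed.

End change_of_variables.

Section plane_measure.
Context {R : realType}.
Local Notation lam := (@lebesgue_measure R).
Local Notation T := (measurableTypeR R).

(** A name for the measure of the first two coordinates, to which the sigma-finiteness required by
    Tonelli can be attached. *)
Definition plane : set (T * T)%type -> \bar R := (lam \x lam)%E.

HB.instance Definition _ := Measure.copy plane (lam \x lam)%E.

Let plane_sigma_finite : sigma_finite setT plane.
Proof.
exists (fun n : nat => [set` `[- n%:R, n%:R]%R] `*` [set` `[- n%:R, n%:R]%R]) => [|n].
  apply/seteqP; split => // -[x y] _.
  have hn := archi_boundP (addr_ge0 (normr_ge0 x) (normr_ge0 y)).
  exists (Num.bound (`|x| + `|y|)) => //; split; rewrite /= in_itv /= -ler_norml.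
    by rewrite (le_trans _ (ltW hn)) // lerDl.
  by rewrite (le_trans _ (ltW hn)) // lerDr.
have h : (lam [set` `[- n%:R, n%:R]%R] < +oo)%E.
  by rewrite lebesgue_measure_itv /=; case: ifPn => _; rewrite ?EFinN ltry.
split; first by apply: measurableX; exact: measurable_itv.
rewrite /plane [ltLHS]product_measure1E //; try exact: measurable_itv.
by apply: lte_mul_pinfty => //; rewrite ge0_fin_numE.
Qed.

HB.instance Definition _ := Measure_isSigmaFinite.Build _ _ _ plane plane_sigma_finite.

End plane_measure.

Section heis_change.
Context {R : realType}.
Local Notation H := (heis R).
Local Notation M := (heisM R).
Local Notation mu := (@heis_measure R).
Local Notation lam := (@lebesgue_measure R).

Lemma rescales_affine (r a : R) : 0 < r -> rescales lam r (fun x => r * x + a).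
Proof.
move=> r0; split; first exact: measurable_affine.
by move=> F mF F0; exact: ge0_integral_affine.
Qed.

Lemma rescales_z (r : R) (g : R -> R -> R) : 0 < r ->
  continuous (fun p : H => g p.1.1 p.1.2) ->
  rescales mu r (fun p => (p.1, r * p.2 + g p.1.1 p.1.2)).
Proof.
move=> r0 cg; apply: (@rescales_prod2 R _ _ _ _ (@plane R) lam r (fun p : M => r * p.2 + g p.1.1 p.1.2)); first exact: ltW.
  apply: continuous_heis_measurable => p; apply: cvgD; last exact: cg.
  by apply: cvgMr; exact: cont_coord3.
by move=> p /=; exact: rescales_affine.
Qed.

Lemma rescales_x (r a t : R) : 0 < r ->
  rescales mu r (fun p => (r * p.1.1 + (a * p.1.2 + t), p.1.2, p.2)).
Proof.
move=> r0; apply: (@rescales_prod1 R _ _ _ _ (@plane R) lam r (fun p => (r * p.1.1 + (a * p.1.2 + t), p.1.2))).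
- exact: ltW.
- apply: measurable_fun_pair; apply: continuous_heis_measurable; last exact: cont_coord2.
  move=> p; apply: cvgD; first by apply: cvgMr; exact: cont_coord1.
  by apply: cvgD; [apply: cvgMr; exact: cont_coord2|exact: cvg_cst].
move=> z /=; apply: (@rescales_prod1 R _ _ _ _ lam lam r (fun p => r * p.1 + (a * p.2 + t))).
- exact: ltW.
- have h := @continuous_heis_measurable R (fun p => r * p.1.1 + (a * p.1.2 + t)).
  apply: (measurableT_comp (h _) (pair2_measurable (0 : measurableTypeR R))).
  move=> p; apply: cvgD; first by apply: cvgMr; exact: cont_coord1.
  by apply: cvgD; [apply: cvgMr; exact: cont_coord2|exact: cvg_cst].
by move=> y /=; exact: rescales_affine.
Qed.

Lemma rescales_y (r a t : R) : 0 < r ->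
  rescales mu r (fun p => (p.1.1, r * p.1.2 + (a * p.1.1 + t), p.2)).
Proof.
move=> r0; apply: (@rescales_prod1 R _ _ _ _ (@plane R) lam r (fun p => (p.1.1, r * p.1.2 + (a * p.1.1 + t)))).
- exact: ltW.
- apply: measurable_fun_pair; apply: continuous_heis_measurable; first exact: cont_coord1.
  move=> p; apply: cvgD; first by apply: cvgMr; exact: cont_coord2.
  by apply: cvgD; [apply: cvgMr; exact: cont_coord1|exact: cvg_cst].
move=> z /=; apply: (@rescales_prod2 R _ _ _ _ lam lam r (fun p => r * p.2 + (a * p.1 + t))).
- exact: ltW.
- have h := @continuous_heis_measurable R (fun p => r * p.1.2 + (a * p.1.1 + t)).
  apply: (measurableT_comp (h _) (pair2_measurable (0 : measurableTypeR R))).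
  move=> p; apply: cvgD; first by apply: cvgMr; exact: cont_coord2.
  by apply: cvgD; [apply: cvgMr; exact: cont_coord1|exact: cvg_cst].
by move=> y /=; exact: rescales_affine.
Qed.

(** The flow of X, that is, right translation by (t, 0, 0) in the group. Since y is constant along
    it, it is affine in t. *)
Definition flowX (t : R) (p : H) : H := (p.1.1 + t, p.1.2, p.2 - t * (p.1.2 / 2)).
Definition flowY (t : R) (p : H) : H := (p.1.1, p.1.2 + t, p.2 + t * (p.1.1 / 2)).

(** A translation in x followed by a shear in z, both of Jacobian 1. *)
Lemma rescales_flowX t : rescales mu 1 (flowX t).
Proof.
rewrite -[1]mulr1.
rewrite (_ : flowX t = (fun p : H => (p.1, 1 * p.2 + (- t * (p.1.2 / 2)))) \o
  (fun p : H => (1 * p.1.1 + (0 * p.1.2 + t), p.1.2, p.2))); last first.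
  by apply/funext => -[[x y] z]; rewrite /flowX /= !mul1r mul0r add0r mulNr.
apply: rescales_comp; last exact: rescales_x.
apply: (@rescales_z 1 (fun x y => - t * (y / 2))) => //.
by move=> p; apply: cvgMr; apply: cvgMl; exact: cont_coord2.
Qed.

Lemma rescales_flowY t : rescales mu 1 (flowY t).
Proof.
rewrite -[1]mulr1.
rewrite (_ : flowY t = (fun p : H => (p.1, 1 * p.2 + (t * (p.1.1 / 2)))) \o
  (fun p : H => (p.1.1, 1 * p.1.2 + (0 * p.1.1 + t), p.2))); last first.
  by apply/funext => -[[x y] z]; rewrite /flowY /= !mul1r mul0r add0r.
apply: rescales_comp; last exact: rescales_y.
apply: (@rescales_z 1 (fun x y => t * (x / 2))) => //.
by move=> p; apply: cvgMr; apply: cvgMl; exact: cont_coord1.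
Qed.

(* The automorphism (x + iy, z) |-> (r (c + is) (x + iy), r^2 z). *)
Definition rotdil (r c s : R) (p : H) : H :=
  (r * (c * p.1.1 - s * p.1.2), r * (s * p.1.1 + c * p.1.2), r ^+ 2 * p.2).

(** The dilation stretches x and y by r and z by r^2; the exponent 4 is the homogeneous dimension of
    the group. *)
Lemma rescales_rotdil r c s : 0 < r -> c ^+ 2 + s ^+ 2 = 1 ->
  rescales mu (r ^+ 4) (rotdil r c s).
Proof.
move=> r0.
(* A rotation is a product of three shears. *)
have rot1 c' s' : s' != 0 -> c' ^+ 2 + s' ^+ 2 = 1 -> rescales mu 1 (rotdil 1 c' s').
  move=> s0 cs.
  pose U (p : H) : H := (1 * p.1.1 + ((c' - 1) / s' * p.1.2 + 0), p.1.2, p.2).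
  pose L (p : H) : H := (p.1.1, 1 * p.1.2 + (s' * p.1.1 + 0), p.2).
  rewrite (_ : rotdil 1 c' s' = U \o (L \o U)).
    rewrite -[1]mulr1; apply: rescales_comp; first exact: rescales_x.
    by rewrite -[1]mulr1; apply: rescales_comp; [exact: rescales_y|exact: rescales_x].
  apply/funext => -[[x y] z]; rewrite /rotdil /U /L /=.
  have s2 : s' * s' = (1 - c') * (1 + c') by rewrite -expr2 -[LHS](addKr (c' ^+ 2)) cs; ring.
  congr (_, _, _); last by ring.
    apply: (mulfI s0); transitivity (s' * c' * x - (s' * s') * y); first by ring.
    by rewrite s2; field.
  by field.
have rot : forall c' s', c' ^+ 2 + s' ^+ 2 = 1 -> rescales mu 1 (rotdil 1 c' s').
  (* The decomposition into shears divides by s'. The two rotations with s' = 0 are products of two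
     quarter turns. *)
  move=> c' s' cs; have [s0|] := eqVneq s' 0; last by move=> s0; exact: rot1.
  have r01 : rescales mu 1 (rotdil 1 0 1) by apply: rot1; [exact: oner_neq0|ring].
  have r0N : rescales mu 1 (rotdil 1 0 (-1)).
    by apply: rot1; [rewrite oppr_eq0 oner_neq0|ring].
  move: cs; rewrite s0 expr0n /= addr0 => /eqP; rewrite sqrf_eq1 => /orP[]/eqP ->.
    rewrite (_ : rotdil 1 1 0 = rotdil 1 0 1 \o rotdil 1 0 (-1)).
      by rewrite -[X in rescales _ X]mulr1; exact: rescales_comp.
    by apply/funext => p; rewrite /rotdil /=; congr (_, _, _); ring.
  rewrite (_ : rotdil 1 (-1) 0 = rotdil 1 0 1 \o rotdil 1 0 1).
    by rewrite -[X in rescales _ X]mulr1; exact: rescales_comp.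
  by apply/funext => p; rewrite /rotdil /=; congr (_, _, _); ring.
move=> cs.
pose DX (p : H) : H := (r * p.1.1 + (0 * p.1.2 + 0), p.1.2, p.2).
pose DY (p : H) : H := (p.1.1, r * p.1.2 + (0 * p.1.1 + 0), p.2).
pose DZ (p : H) : H := (p.1, r ^+ 2 * p.2 + 0).
rewrite (_ : rotdil r c s = DX \o (DY \o (DZ \o rotdil 1 c s))).
  rewrite (_ : r ^+ 4 = r * (r * (r ^+ 2 * 1))); last by ring.
  apply: rescales_comp; first exact: rescales_x.
  apply: rescales_comp; first exact: rescales_y.
  apply: rescales_comp; last exact: rot.
  apply: (@rescales_z (r ^+ 2) (fun _ _ => 0)); first exact: exprn_gt0.
  by move=> p; exact: cvg_cst.
by apply/funext => p; rewrite /rotdil /DX /DY /DZ /=; congr (_, _, _); ring.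
Qed.

Lemma integral_preserve phi (f : M -> \bar R) : rescales mu 1 phi ->
  measurable_fun setT f -> (\int[mu]_p f p = \int[mu]_p f (phi p))%E.
Proof.
move=> [mphi E] mf; rewrite integralE [RHS]integralE.
have mfp := measurable_funepos mf; have mfn := measurable_funeneg mf.
rewrite (E _ mfp (funepos_ge0 f)) (E _ mfn (funeneg_ge0 f)) !mul1e.
by congr (_ - _)%E; apply: eq_integral => x _; rewrite ?funeposE ?funenegE.
Qed.

End heis_change.

(** * Continuous functions with bounded support *)

Section Cc.
Context {R : realType}.
Local Notation H := (heis R).
Local Notation M := (heisM R).
Local Notation mu := (@heis_measure R).
Implicit Types (f g : H -> R).

(** Bounded support expressed by a radius: sums, derivatives and compositions only change the
    radius, which is handier than compactness of a closure. [test_functionP] translates between the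
    two. *)
Definition vanishes f := exists B : R, forall p, B < `|p| -> f p = 0.

Definition Cc f := continuous f /\ vanishes f.

Lemma boxE (B : R) : [set p : H | `|p| <= B] =
  [set` `[-B, B]%R] `*` [set` `[-B, B]%R] `*` [set` `[-B, B]%R].
Proof.
apply/seteqP; split => [p /heis_norm_le[]|p [[]]] /=; rewrite !in_itv /= -!ler_norml //.
by move=> h1 h2 h3; apply/heis_norm_le.
Qed.

Lemma compact_box (B : R) : compact [set p : H | `|p| <= B].
Proof.
rewrite boxE.
by apply: compact_setX; [apply: compact_setX|]; exact: segment_compact.
Qed.

Lemma continuous_bounded_box f (B : R) : continuous f ->
  exists2 K : R, 0 <= K & forall p, `|p| <= B -> `|f p| <= K.
Proof.
move=> cf.
have : compact (f @` [set p : H | `|p| <= B]).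
  apply: continuous_compact; last exact: compact_box.
  exact: continuous_subspaceT.
move=> /compact_bounded[N [Nr /(_ (Num.max 0 N + 1))]].
have h1 : N < Num.max 0 N + 1 by rewrite ltr_pwDr // le_max lexx orbT.
move=> /(_ h1) h; exists (Num.max 0 N + 1); first by rewrite addr_ge0 // le_max lexx.
by move=> p pB; apply: h; exists p.
Qed.

Lemma Cc_bounded f : Cc f -> exists2 K : R, 0 <= K & forall p, `|f p| <= K.
Proof.
move=> [cf [B vf]]; have [K K0 hK] := continuous_bounded_box B cf.
by exists K => // p; have [/hK|/vf ->] := leP `|p| B; rewrite ?normr0.
Qed.

Lemma vanishes_ge f (B0 : R) : vanishes f -> exists2 B, B0 <= B & forall p, B < `|p| -> f p = 0.
Proof.
move=> [B vf]; exists (Num.max B0 B); first by rewrite le_max lexx.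
by move=> p; rewrite gt_max => /andP[_ /vf].
Qed.

Lemma Cc_add f g : Cc f -> Cc g -> Cc (fun p => f p + g p).
Proof.
move=> [cf [B vf]] [cg /(vanishes_ge B)[C BC vg]]; split.
  by move=> p; apply: cvgD; [exact: cf|exact: cg].
by exists C => p pC; rewrite vg // vf ?addr0 // (le_lt_trans BC).
Qed.

Lemma Cc_mull f g : continuous f -> Cc g -> Cc (fun p => f p * g p).
Proof.
move=> cf [cg [B vg]]; split; last by exists B => p /vg ->; rewrite mulr0.
by move=> p; apply: cvgM; [exact: cf|exact: cg].
Qed.

Lemma Cc_opp f : Cc f -> Cc (fun p => - f p).
Proof.
move=> [cf [B vf]]; split; last by exists B => p /vf ->; rewrite oppr0.
by move=> p; apply: cvgN; exact: cf.
Qed.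

Lemma Cc_sub f g : Cc f -> Cc g -> Cc (fun p => f p - g p).
Proof. by move=> cf cg; apply: Cc_add => //; exact: Cc_opp. Qed.

(** The integrable majorant used for dominated convergence on the group. *)
Definition boxf (B K : R) (p : H) : R := K * \1_[set p : H | `|p| <= B] p.

Lemma measurable_box (B : R) : measurable ([set p : H | `|p| <= B] : set M).
Proof.
rewrite -[X in measurable X]setCK; apply: measurableC; apply: open_heis_measurable.
rewrite openC; apply: compact_closed; last exact: compact_box.
exact: norm_hausdorff.
Qed.

Lemma box_fin (B : R) : (mu [set p : H | (`|p| <= B)%R] < +oo)%E.
Proof.
rewrite boxE.
have mB := @measurable_itv R `[-B, B].
have fB : (@lebesgue_measure R [set` `[-B, B]%R] < +oo)%E.
  by rewrite lebesgue_measure_itv /=; case: ifPn => _; rewrite ?EFinN -?EFinD ltry.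
rewrite /heis_measure [ltLHS]product_measure1E //; last exact: measurableX.
rewrite lte_mul_pinfty ?ge0_fin_numE // [ltLHS]product_measure1E //.
by rewrite lte_mul_pinfty ?ge0_fin_numE.
Qed.

Lemma box_gt0 (B : R) : 0 < B -> (0 < mu [set p : H | (`|p| <= B)%R])%E.
Proof.
move=> B0.
rewrite boxE.
have mB := @measurable_itv R `[-B, B].
have fB : (0 < @lebesgue_measure R [set` `[-B, B]%R])%E.
  by rewrite lebesgue_measure_itv /= lte_fin gtrN // -EFinD lte_fin opprK addr_gt0.
rewrite /heis_measure [ltRHS]product_measure1E //; last exact: measurableX.
by rewrite mule_gt0 // [ltRHS]product_measure1E // mule_gt0.
Qed.

Lemma boxf_integrable (B K : R) : mu.-integrable setT (EFin \o boxf B K).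
Proof.
have mB := measurable_box B.
rewrite (_ : EFin \o _ = (fun p => K%:E * (\1_[set p : H | `|p| <= B] p)%:E)%E); last first.
  by apply/funext => p /=; rewrite EFinM.
apply: integrableZl => //; apply/integrableP; split.
  by apply/measurable_EFinP; exact: measurable_indic.
under eq_integral do rewrite gee0_abs ?lee_fin //.
by rewrite integral_indic // setIT; exact: box_fin.
Qed.

Lemma Cc_le_box f : Cc f -> exists2 B, 0 <= B & exists2 K, 0 <= K & forall p, `|f p| <= boxf B K p.
Proof.
move=> cf; have [K K0 hK] := Cc_bounded cf.
case: cf => _ /(vanishes_ge 0)[B B0 vf]; exists B => //; exists K => // p; rewrite /boxf indicE.
have [pB|/vf ->] := leP `|p| B; first by rewrite mem_set // mulr1.
by rewrite normr0 mulr_ge0.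
Qed.

Lemma le_measurable_integrable f g : measurable_fun [set: M] f ->
  mu.-integrable setT (EFin \o g) -> (forall p, `|f p| <= g p) -> mu.-integrable setT (EFin \o f).
Proof.
move=> mf ig fg; apply: le_integrable ig => //; first exact/measurable_EFinP.
by move=> p _ /=; rewrite lee_fin (le_trans (fg p)) // ler_norm.
Qed.

Lemma Cc_integrable f : Cc f -> mu.-integrable setT (EFin \o f).
Proof.
move=> cf; have [B _ [K _ h]] := Cc_le_box cf.
apply: le_measurable_integrable (boxf_integrable B K) h.
by apply: continuous_heis_measurable; case: cf.
Qed.

Lemma box_dct (h_ : nat -> H -> R) (h : H -> R) (B K : R) :
  (forall n, continuous (h_ n)) -> continuous h ->
  (forall p, h_ n p @[n --> \oo] --> h p) -> (forall n p, `|h_ n p| <= boxf B K p) ->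
  (\int[mu]_p h_ n p)%R @[n --> \oo] --> (\int[mu]_p h p)%R.
Proof.
move=> ch_ ch h_h hB.
have [|||||ih _ hl] := @dominated_convergence _ M R mu setT measurableT
  (fun n p => (h_ n p)%:E) (fun p => (h p)%:E) (EFin \o boxf B K) _ _ _ _ _.
- by move=> n; apply/measurable_EFinP; exact: continuous_heis_measurable.
- by apply/measurable_EFinP; exact: continuous_heis_measurable.
- by apply/aeW => p _; apply: cvg_EFin; [exact: nearW|exact: h_h].
- exact: boxf_integrable.
- by apply/aeW => p n _; rewrite lee_fin.
apply: fine_cvg; rewrite fineK; last exact: integrable_fin_num.
exact: hl.
Qed.

End Cc.

(** * Measure-preserving flows along straight lines *)

Section flow.
Context {R : realType}.
Local Notation H := (heis R).
Local Notation M := (heisM R).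
Local Notation mu := (@heis_measure R).
Implicit Types (f g : H -> R).

(* The integral curves of [V] are straight lines, so that its flow is
   [fun p => p + t *: V p]; the last clause makes this flow proper. *)
Definition straight_flow (V : H -> H) := [/\
  forall t p, V (p + t *: V p) = V p,
  forall t, rescales mu 1 (fun p : M => p + t *: V p),
  continuous (fun x : R * H => x.2 + x.1 *: V x.2) &
  forall B, exists B', forall t p, `|t| <= 1 -> `|p + t *: V p| <= B -> `|p| <= B'].

Definition Xv (p : H) : H := (1, 0, - (p.1.2 / 2)).
Definition Yv (p : H) : H := (0, 1, p.1.1 / 2).

Lemma flowXE t p : p + t *: Xv p = flowX t p.
Proof.
case: p => [[x y] z]; rewrite /Xv /flowX /=; congr (_, _, _); rewrite /= /GRing.scale /=; ring.
Qed.

Lemma flowYE t p : p + t *: Yv p = flowY t p.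
Proof.
case: p => [[x y] z]; rewrite /Yv /flowY /=; congr (_, _, _); rewrite /= /GRing.scale /=; ring.
Qed.

Lemma cont_triple (T : topologicalType) (a b c : T -> R) : continuous a -> continuous b ->
  continuous c -> continuous (fun x => (a x, b x, c x)).
Proof. by move=> ca cb cc x; exact: (cvg_pair (cvg_pair (ca x) (cb x)) (cc x)). Qed.

Lemma straight_flowX : straight_flow Xv.
Proof.
split.
- by move=> t p; rewrite flowXE.
- move=> t; rewrite (_ : (fun p => _) = flowX t); first exact: rescales_flowX.
  by apply/funext => p; rewrite flowXE.
- rewrite (_ : (fun x => _) = fun x : R * H => (x.2.1.1 + x.1, x.2.1.2, x.2.2 - x.1 * (x.2.1.2 / 2))).
    have c2 : continuous (snd : R * H -> H) by move=> x; exact: cvg_snd.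
    have c1 : continuous (fst : R * H -> R) by move=> x; exact: cvg_fst.
    have cx : continuous (fun x : R * H => x.2.1.1).
      by move=> x; apply: (continuous_comp (c2 x) (@cont_coord1 R _)).
    have cy : continuous (fun x : R * H => x.2.1.2).
      by move=> x; apply: (continuous_comp (c2 x) (@cont_coord2 R _)).
    have cz : continuous (fun x : R * H => x.2.2).
      by move=> x; apply: (continuous_comp (c2 x) (@cont_coord3 R _)).
    apply: cont_triple => // x; first by apply: cvgD; [exact: cx|exact: c1].
    apply: cvgB; first exact: cz.
    by apply: cvgM; [exact: c1|apply: cvgMl; exact: cy].
  by apply/funext => x; rewrite flowXE.
(* With |t| <= 1 one gets |x| <= B + 1 and |z| <= 2 B. *)
- move=> B; exists (2 * B + 1) => t p t1; rewrite flowXE => /heis_norm_le[/= h1 h2 h3].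
  have B0 : 0 <= B by apply: le_trans h2.
  apply/heis_norm_le; split.
  + rewrite (_ : p.1.1 = (p.1.1 + t) - t); last ring.
    by apply: (le_trans (ler_normB _ _)); lra.
  + by lra.
  + rewrite (_ : p.2 = (p.2 - t * (p.1.2 / 2)) + t * (p.1.2 / 2)); last ring.
    have : `|t * (p.1.2 / 2)| <= 1 * B.
      rewrite normrM; apply: ler_pM => //; rewrite normrM (ger0_norm (x := 2^-1)) //.
      by have := normr_ge0 p.1.2; lra.
    by move=> h; apply: (le_trans (ler_normD _ _)); lra.
Qed.

Lemma straight_flowY : straight_flow Yv.
Proof.
split.
- by move=> t p; rewrite flowYE.
- move=> t; rewrite (_ : (fun p => _) = flowY t); first exact: rescales_flowY.
  by apply/funext => p; rewrite flowYE.
- rewrite (_ : (fun x => _) = fun x : R * H => (x.2.1.1, x.2.1.2 + x.1, x.2.2 + x.1 * (x.2.1.1 / 2))).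
    have c2 : continuous (snd : R * H -> H) by move=> x; exact: cvg_snd.
    have c1 : continuous (fst : R * H -> R) by move=> x; exact: cvg_fst.
    have cx : continuous (fun x : R * H => x.2.1.1).
      by move=> x; apply: (continuous_comp (c2 x) (@cont_coord1 R _)).
    have cy : continuous (fun x : R * H => x.2.1.2).
      by move=> x; apply: (continuous_comp (c2 x) (@cont_coord2 R _)).
    have cz : continuous (fun x : R * H => x.2.2).
      by move=> x; apply: (continuous_comp (c2 x) (@cont_coord3 R _)).
    apply: cont_triple => // x; first by apply: cvgD; [exact: cy|exact: c1].
    apply: cvgD; first exact: cz.
    by apply: cvgM; [exact: c1|apply: cvgMl; exact: cx].
  by apply/funext => x; rewrite flowYE.
- move=> B; exists (2 * B + 1) => t p t1; rewrite flowYE => /heis_norm_le[/= h1 h2 h3].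
  have B0 : 0 <= B by apply: le_trans h1.
  apply/heis_norm_le; split.
  + by lra.
  + rewrite (_ : p.1.2 = (p.1.2 + t) - t); last ring.
    by apply: (le_trans (ler_normB _ _)); lra.
  + rewrite (_ : p.2 = (p.2 + t * (p.1.1 / 2)) - t * (p.1.1 / 2)); last ring.
    have : `|t * (p.1.1 / 2)| <= 1 * B.
      rewrite normrM; apply: ler_pM => //; rewrite normrM (ger0_norm (x := 2^-1)) //.
      by have := normr_ge0 p.1.1; lra.
    by move=> h; apply: (le_trans (ler_normB _ _)); lra.
Qed.

Context (V : H -> H) (fV : straight_flow V).

Lemma flow_cont (t : R) : continuous (fun p : H => p + t *: V p).
Proof.
case: fV => _ _ c _ p.
have ct : {for p, continuous (fun q : H => (t, q))}.
  exact: (cvg_pair (cvg_cst t) (@cvg_id _ (nbhs p))).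
exact: (continuous_comp ct (c (t, p))).
Qed.

Lemma flow_cont_time (p : H) : continuous (fun t : R => p + t *: V p).
Proof.
case: fV => _ _ c _ t.
have ct : {for t, continuous (fun t : R => (t, p))}.
  exact: (cvg_pair (@cvg_id _ (nbhs t)) (cvg_cst p)).
exact: (continuous_comp ct (c (t, p))).
Qed.

Lemma integral_flow f (t : R) : Cc f -> (\int[mu]_p f (p + t *: V p) = \int[mu]_p f p)%R.
Proof.
move=> cf; case: fV => _ /(_ t) r _ _.
rewrite /Rintegral; congr fine; apply/esym.
apply: (integral_preserve (f := EFin \o f) r).
by apply/measurable_EFinP; apply: continuous_heis_measurable; case: cf.
Qed.

Lemma Cc_flow f (t : R) : `|t| <= 1 -> Cc f -> Cc (fun p => f (p + t *: V p)).
Proof.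
move=> t1 [cf [B vf]]; split.
  by move=> p; apply: (continuous_comp (flow_cont (t := t) (x := p)) (cf _)).
case: fV => _ _ _ /(_ B)[B' hB]; exists B' => p pB; apply: vf.
by rewrite ltNge; apply: contraTN pB; rewrite -leNgt => /hB; apply.
Qed.

Lemma flow_le_box g : Cc g -> exists B K : R,
  forall t p, `|t| <= 1 -> `|g (p + t *: V p)| <= boxf B K p.
Proof.
move=> cg; have [K K0 hK] := Cc_bounded cg.
case: cg => _ [B vg]; case: fV => _ _ _ /(_ B)[B' hB]; exists B', K => t p t1.
rewrite /boxf indicE; have [h|h] := leP `|p + t *: V p| B.
  by rewrite mem_set ?mulr1 //=; exact: hB h.
by rewrite vg // normr0 mulr_ge0.
Qed.

(** The difference quotients of [f] along the flow have integral 0 because the flow preserves the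
    measure, and they converge to [g]. By the mean value theorem each of their values is a value of
    [g] at flow time at most 1, so properness of the flow puts all of them under one box
    function. *)
Lemma integral_flow_derive f g : Cc f -> Cc g ->
  (forall p, is_derive p (V p) f (g p)) -> (\int[mu]_p g p = 0)%R.
Proof.
move=> cf cg dfg.
pose e (n : nat) : R := n.+1%:R^-1.
have e0 n : e n != 0 by rewrite invr_neq0.
have e1 n : `|e n| <= 1 by rewrite /e ger0_norm ?invr_ge0 ?ler0n // invf_le1 ?ltr0n // ler1n.
pose h_ n p := (e n)^-1 * (f (p + e n *: V p) - f p).
have [VE _ _ _] := fV.
have hE n p : exists2 s : R, `|s| <= `|e n| & h_ n p = g (p + s *: V p).
  have [s0|s sn E] := @mvt_line R H f p (V p) g (e n).
    by rewrite -[X in is_derive _ X _ _](VE s0); exact: dfg.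
  by exists s; rewrite // /h_ E mulKf.
have h0 n : (\int[mu]_p h_ n p = 0)%R.
  rewrite /h_ RintegralZl //; last exact/Cc_integrable/Cc_sub/cf/Cc_flow.
  rewrite RintegralB //; [|exact/Cc_integrable/Cc_flow|exact: Cc_integrable].
  by rewrite integral_flow // subrr mulr0.
have [B [K hBK]] := flow_le_box cg.
have -> : (\int[mu]_p g p = limn (fun n => \int[mu]_p h_ n p))%R.
  apply/esym/cvg_lim => //; apply: (@box_dct _ _ _ B K).
  - move=> n p; apply: cvgMr; apply: cvgB; last by case: cf => cf _; exact: cf.
    by have [c _] := Cc_flow (e1 n) cf; exact: c.
  - by case: cg.
  - move=> p.
    have cgV : {for (0 : R), continuous (fun t : R => g (p + t *: V p))}.
      by apply: continuous_comp; [exact: flow_cont_time|case: cg => cg _; exact: cg].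
    apply/cvgrPdist_lt => eps eps0.
    move/cvgrPdist_lt : cgV => /(_ _ eps0) /nbhs_ballP[/= d d0 hd].
    have [N _ hN] := near_infty_natSinv_lt (PosNum d0).
    exists N => // n /hN /= end_; have [s sn ->] := hE n p.
    have := hd s; rewrite scale0r addr0; apply.
    rewrite -ball_normE /= sub0r normrN; apply: le_lt_trans sn _.
    by rewrite /e ger0_norm ?invr_ge0 ?ler0n.
  - move=> n p; have [s sn ->] := hE n p; apply: hBK.
    exact: le_trans (e1 n).
rewrite (_ : (fun n => _) = fun=> 0); first by rewrite lim_cst.
by apply/funext => n; rewrite h0.
Qed.

End flow.

(** * Completeness of L^2 *)

Lemma fast_cauchy_limit (R : realType) (a : nat -> R) (s : R) : 0 <= s ->
  (forall k, `|a k.+1 - a k| <= s * 2^-1 ^+ k) ->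
  exists l, a @ \oo --> l /\ forall n, `|a n - l| <= 2 * s * 2^-1 ^+ n.
Proof.
move=> s0 da.
have B n j : `|a n - a (n + j)%N| <= 2 * s * 2^-1 ^+ n - 2 * s * 2^-1 ^+ (n + j).
  elim: j => [|j IH]; first by rewrite addn0 !subrr normr0.
  rewrite addnS (_ : a n - a (n + j).+1 = (a n - a (n + j)%N) - (a (n + j).+1 - a (n + j)%N)); last ring.
  apply: (le_trans (ler_normB _ _)); have := da (n + j)%N.
  rewrite exprS; move: IH; set u := 2^-1 ^+ n; set v := 2^-1 ^+ (n + j) => IH h.
  by lra.
have cd : cvgn (series (fun k => a k.+1 - a k)).
  apply: normed_cvg; apply: (@series_le_cvg _ _ (geometric s 2^-1)).
  - by move=> n /=.
  - by move=> n /=; rewrite mulr_ge0 // exprn_ge0.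
  - by move=> n; exact: da.
  - by apply: is_cvg_geometric_series; rewrite ger0_norm // invf_lt1 // ltr1n.
have aE n : a n = series (fun k => a k.+1 - a k) n + a 0%N.
  by rewrite /series /= telescope_sumr // subrK.
exists (limn (series (fun k => a k.+1 - a k)) + a 0%N).
have cl : a @ \oo --> limn (series (fun k => a k.+1 - a k)) + a 0%N.
  have aF : a = series (fun k => a k.+1 - a k) + cst (a 0%N).
    by apply/funext => n; exact: aE.
  by rewrite [X in X @ _]aF; apply: cvgD; [exact: cd|exact: cvg_cst].
split=> // n.
have cn : `|a n - a m| @[m --> \oo] --> `|a n - (limn (series (fun k => a k.+1 - a k)) + a 0%N)|.
  by apply: cvg_norm; apply: cvgB; [exact: cvg_cst|exact: cl].
rewrite -(cvg_lim _ cn) //; apply: limr_le; first by apply/cvg_ex; eexists; exact: cn.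
exists n => // m /= nm; rewrite -(subnKC nm); apply: (le_trans (B _ _)).
by rewrite gerBl !mulr_ge0 // exprn_ge0.
Qed.

Section L2_completeness.
Context {R : realType} d (T : measurableType d) (mu : {measure set T -> \bar R}).
Local Open Scope ereal_scope.

(** Let G be the sum of the 4^k (f_(k+1) - f_k)^2. The weight 4^k takes half of the rate 16^-k: it
    leaves the integral of G at most 2 K, and where G is finite it gives |f_(k+1) - f_k| <= sqrt(G)
    2^-k. There f_n converges with (f_n - f)^2 <= 4 * 4^-n G, which is integrated. *)
Lemma L2_fast_complete (f_ : nat -> T -> R) (K : R) :
  (forall n, measurable_fun setT (f_ n)) ->
  (forall n, \int[mu]_x ((f_ n.+1 x - f_ n x) ^+ 2)%:E <= (K * 16^-1 ^+ n)%:E) ->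
  exists2 f : T -> R, measurable_fun setT f &
    forall n, \int[mu]_x ((f_ n x - f x) ^+ 2)%:E <= (8 * K * 4^-1 ^+ n)%:E.
Proof.
move=> mf dK.
have K0 : (0 <= K)%R.
  by have := le_trans _ (dK 0%N); rewrite expr0 mulr1 -lee_fin; apply; apply: integral_ge0 => x _; rewrite lee_fin sqr_ge0.
pose h k x : \bar R := (4 ^+ k * (f_ k.+1 x - f_ k x) ^+ 2)%:E.
have h0 k x : 0 <= h k x by rewrite lee_fin mulr_ge0 ?sqr_ge0 // exprn_ge0.
have mh k : measurable_fun setT (h k).
  apply/measurable_EFinP; apply: measurable_funM => //.
  by apply: measurable_funX; apply: measurable_funB.
pose G x := \sum_(k <oo) h k x.
have G0 x : 0 <= G x by apply: nneseries_ge0 => k _ _.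
have mG : measurable_fun setT G.
  by apply: ge0_emeasurable_sum.
have iG : \int[mu]_x G x <= (2 * K)%:E.
  rewrite /G integral_nneseries //.
  (* The k-th integral is at most K 4^-k <= 2 K / 2^(k+1), and the latter sum to 2 K. *)
  have := @cvg_geometric_eseries_half R (2 * K) 0.
  rewrite expr0 divr1 => /cvg_lim <- //.
  apply: lee_nneseries => [k _ _|k _]; first by apply: integral_ge0.
  rewrite /h.
  under eq_integral do rewrite EFinM.
  rewrite ge0_integralZl_EFin //; last first.
  - by apply/measurable_EFinP; apply: measurable_funX; apply: measurable_funB.
  - by move=> x _; rewrite lee_fin sqr_ge0.
  apply: le_trans (lee_wpmul2l _ (dK k)) _; first by rewrite lee_fin exprn_ge0.
  rewrite -EFinM lee_fin addn1 expnS natrM natrX.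
  have -> : (16^-1 ^+ k = 4^-1 ^+ k * 4^-1 ^+ k :> R)%R.
    by rewrite -exprMn; congr (_ ^+ k)%R; lra.
  have -> : (4^-1 ^+ k = 2^-1 ^+ k * 2^-1 ^+ k :> R)%R.
    by rewrite -exprMn; congr (_ ^+ k)%R; lra.
  have -> : (4 ^+ k = 2 ^+ k * 2 ^+ k :> R)%R.
    by rewrite -exprMn; congr (_ ^+ k)%R; lra.
  have u0 : (0 < 2 ^+ k :> R)%R by rewrite exprn_gt0.
  have u1 : (1 <= 2 ^+ k :> R)%R by rewrite exprn_ege1 // ler1n.
  rewrite exprVn; move: u0 u1; set u : R := (2 ^+ k)%R => u0 u1.
  rewrite (_ : (u * u * (K * (u^-1 * u^-1 * (u^-1 * u^-1))) = K * (u^-1 * u^-1))%R); last first.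
    by field; rewrite gt_eqF.
  rewrite (_ : (2 * K / (2 * u) = K * u^-1)%R); last by field; rewrite gt_eqF.
  by rewrite ler_wpM2l // ler_piMl ?invr_ge0 ?(ltW u0) // invf_le1.
(* Where G is infinite the default value 0 keeps [f] measurable, and the pointwise bound by a
   positive multiple of G is trivial. *)
pose f x := if G x < +oo then limn (fun n => f_ n x) else 0%R.
have key x : G x < +oo ->
   f_ n x @[n --> \oo] --> f x /\ forall n, ((f_ n x - f x) ^+ 2)%:E <= (4 * 4^-1 ^+ n)%:E * G x.
  move=> Gx; pose g := fine (G x).
  have GE : G x = g%:E by rewrite fineK // ge0_fin_numE.
  have g0 : (0 <= g)%R by rewrite -lee_fin -GE.
  have dg k : (`|f_ k.+1 x - f_ k x| <= Num.sqrt g * 2^-1 ^+ k)%R.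
    have : h k x <= g%:E.
      rewrite -GE; apply: le_trans (nneseries_lim_ge k.+1 _) => //.
      by rewrite big_nat_recr //= leeDr // sume_ge0.
    rewrite lee_fin => hg; rewrite -(ger0_norm (mulr_ge0 (sqrtr_ge0 g) (exprn_ge0 k (ltW _)))) //.
    rewrite -ler_sqr ?nnegrE // !real_normK ?num_real // exprMn sqr_sqrtr //.
    have -> : ((2^-1 ^+ k) ^+ 2 = (4 ^+ k)^-1 :> R)%R.
      by rewrite -exprVn exprAC; congr (_ ^+ k)%R; lra.
    by rewrite ler_pdivlMr ?exprn_gt0 // mulrC.
  have [l [cl hl]] := fast_cauchy_limit (sqrtr_ge0 g) dg.
  have fl : f x = l by rewrite /f Gx; exact: cvg_lim.
  rewrite fl; split => // n; rewrite GE -EFinM lee_fin.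
  rewrite -real_normK ?num_real //.
  apply: le_trans (_ : (2 * Num.sqrt g * 2^-1 ^+ n) ^+ 2 <= _)%R.
    by rewrite ler_sqr ?nnegrE ?hl // !mulr_ge0 ?sqrtr_ge0 // exprn_ge0.
  rewrite !exprMn sqr_sqrtr // exprAC le_eqVlt; apply/orP; left; apply/eqP.
  by rewrite (_ : 2^-1 ^+ 2 = 4^-1 :> R)%R; [ring|lra].
pose A := [set x | G x < +oo].
have mA : measurable A.
  by rewrite -[A]setTI; exact: emeasurable_fun_infty_o.
have mfl : measurable_fun setT f.
  apply: (@measurable_fun_cvg _ _ _ _ (fun n x => (f_ n x * \1_A x)%R)).
    by move=> n; apply: measurable_funM => //; exact: measurable_indic.
  move=> x _; rewrite /f indicE; case: ifPn => Gx.
    by rewrite mem_set //; under eq_fun do rewrite mulr1; have [] := key x Gx; rewrite /f Gx.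
  by rewrite memNset; [under eq_fun do rewrite mulr0; exact: cvg_cst|exact/negP].
have mG4 n : measurable_fun setT (fun x => (4 * 4^-1 ^+ n)%:E * G x).
  by apply: measurable_funeM.
have c0 n : (0 <= 4 * 4^-1 ^+ n :> R)%R by rewrite mulr_ge0 // exprn_ge0.
exists f => // n; apply: (@le_trans _ _ (\int[mu]_x ((4 * 4^-1 ^+ n)%:E * G x))).
  apply: ge0_le_integral => //.
  - by move=> x _; rewrite lee_fin sqr_ge0.
  - by apply/measurable_EFinP; apply: measurable_funX; apply: measurable_funB.
  - move=> x _; have [Gx|] := boolP (G x < +oo); first by have [] := key x Gx.
    rewrite -leNgt leye_eq => /eqP ->; by rewrite gt0_muley ?leey // lte_fin mulr_gt0 // exprn_gt0.
rewrite ge0_integralZl_EFin //.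
have cE : (0 <= (4 * 4^-1 ^+ n)%:E :> \bar R) by rewrite lee_fin.
apply: le_trans (lee_wpmul2l cE iG) _.
by rewrite -EFinM lee_fin le_eqVlt; apply/orP; left; apply/eqP; ring.
Qed.


End L2_completeness.

Local Open Scope complex_scope.

(** * The space L^2 and the test functions *)

Section L2_heis.
Context {R : realType}.
Local Notation H := (heis R).
Local Notation M := (heisM R).
Local Notation mu := (@heis_measure R).
Implicit Types (u v w : H -> R[i]).
Local Notation Re := complex.Re.
Local Notation Im := complex.Im.

(* [ip] is the real part of the L^2 inner product; its imaginary part is recovered
   through the multiplication by i, [imul]. *)
Definition ipf u v (p : H) : R := Re (u p) * Re (v p) + Im (u p) * Im (v p).
Definition ip u v : R := (\int[mu]_p ipf u v p)%R.
Definition n2 u : R := ip u u.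
Definition cmb u (r : R) v (p : H) : R[i] := u p + r%:C * v p.
Definition imul u (p : H) : R[i] := (0 +i* 1) * u p.

Lemma ReD (x y : R[i]) : Re (x + y) = Re x + Re y. Proof. by case: x; case: y. Qed.
Lemma ImD (x y : R[i]) : Im (x + y) = Im x + Im y. Proof. by case: x; case: y. Qed.
Lemma ReM (x y : R[i]) : Re (x * y) = Re x * Re y - Im x * Im y.
Proof. by case: x; case: y. Qed.
Lemma ImM (x y : R[i]) : Im (x * y) = Re x * Im y + Im x * Re y.
Proof. by case: x => a b; case: y => c e /=; rewrite [b * c]mulrC. Qed.
Lemma ReN (x : R[i]) : Re (- x) = - Re x. Proof. by case: x. Qed.
Lemma ImN (x : R[i]) : Im (- x) = - Im x. Proof. by case: x. Qed.
Lemma ReJ (x : R[i]) : Re (conjc x) = Re x. Proof. by case: x. Qed.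
Lemma ImJ (x : R[i]) : Im (conjc x) = - Im x. Proof. by case: x. Qed.
Definition ReImE := (ReD, ImD, ReM, ImM, ReN, ImN, ReJ, ImJ).

Lemma complexP (x y : R[i]) : Re x = Re y -> Im x = Im y -> x = y.
Proof. by case: x => a b; case: y => c e /= -> ->. Qed.

Lemma normc_sq (x : R[i]) : Normc.normc x ^+ 2 = Re x ^+ 2 + Im x ^+ 2.
Proof. by case: x => a b /=; rewrite sqr_sqrtr // addr_ge0 // sqr_ge0. Qed.

Lemma Re_cmb u r v p : Re (cmb u r v p) = Re (u p) + r * Re (v p).
Proof. by rewrite /cmb !ReImE /= mul0r subr0. Qed.
Lemma Im_cmb u r v p : Im (cmb u r v p) = Im (u p) + r * Im (v p).
Proof. by rewrite /cmb !ReImE /= mul0r addr0. Qed.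
Lemma Re_imul u p : Re (imul u p) = - Im (u p).
Proof. by rewrite /imul !ReImE /= mul0r sub0r mul1r. Qed.
Lemma Im_imul u p : Im (imul u p) = Re (u p).
Proof. by rewrite /imul !ReImE /= mul0r add0r mul1r. Qed.

Lemma subE u v : u \- v = cmb u (-1) v.
Proof.
by apply/funext => p /=; apply: complexP; rewrite ?Re_cmb ?Im_cmb !ReImE mulN1r.
Qed.

Lemma ipf_ge0 u p : 0 <= ipf u u p.
Proof. by rewrite /ipf addr_ge0 // -expr2 sqr_ge0. Qed.

(** Membership in L^2 with the norm condition turned into integrability of |u|^2, from which the
    integrability of all products follows; [L2P] is the equivalence. *)
Definition L2' u := [/\ measurable_fun [set: M] (fun p => Re (u p)),
  measurable_fun [set: M] (fun p => Im (u p)) & mu.-integrable setT (EFin \o ipf u u)].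

Lemma ipf_measurable u v : measurable_fun [set: M] (fun p => Re (u p)) ->
  measurable_fun [set: M] (fun p => Im (u p)) -> measurable_fun [set: M] (fun p => Re (v p)) ->
  measurable_fun [set: M] (fun p => Im (v p)) -> measurable_fun [set: M] (ipf u v).
Proof. by move=> mru miu mrv miv; apply: measurable_funD; apply: measurable_funM. Qed.

Lemma L2norm_integral u :
  (L2norm u = (\int[mu]_p (ipf u u p)%:E) `^ (2^-1))%E.
Proof.
rewrite /L2norm unlock /=; congr (_ `^ _)%E; apply: eq_integral => p _ /=.
rewrite ger0_norm; last by case: (u p) => a b; exact: sqrtr_ge0.
by rewrite powR_mulrn ?normc_sq //; case: (u p) => a b; exact: sqrtr_ge0.
Qed.

Lemma L2P u : L2 u <-> L2' u.
Proof.
rewrite /L2 L2norm_integral; split => -[mr mi h]; split=> //.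
  have mI := ipf_measurable mr mi mr mi.
  apply/integrableP; split; first exact/measurable_EFinP.
  under eq_integral do rewrite /= ger0_norm ?ipf_ge0 //.
  by apply: lty_poweRy h; rewrite invr_neq0.
apply: poweR_lty; move/integrableP : h => [_].
by under eq_integral do rewrite /= ger0_norm ?ipf_ge0 //.
Qed.

Lemma L2norm_n2 u : L2' u -> L2norm u = (Num.sqrt (n2 u))%:E.
Proof.
move=> [_ _ iu]; rewrite L2norm_integral.
rewrite -(fineK (integrable_fin_num _ iu)) // poweR_EFin powR12_sqrt //.
by apply: fine_ge0; apply: integral_ge0 => p _; rewrite lee_fin ipf_ge0.
Qed.

Lemma ipf_integrable u v : L2' u -> L2' v -> mu.-integrable setT (EFin \o ipf u v).
Proof.
move=> [mru miu iu] [mrv miv iv].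
have iuv : mu.-integrable setT (EFin \o (fun p => ipf u u p + ipf v v p)).
  by rewrite (_ : EFin \o _ = (EFin \o ipf u u) \+ (EFin \o ipf v v))%E; first exact: integrableD.
apply: le_measurable_integrable iuv _; first exact: (ipf_measurable mru miu mrv miv).
move=> p; rewrite /ipf ler_norml.
set a := Re (u p); set b := Im (u p); set c := Re (v p); set e := Im (v p).
have h1 : 0 <= (a + c) ^+ 2 := sqr_ge0 _; have h2 : 0 <= (b + e) ^+ 2 := sqr_ge0 _.
have h3 : 0 <= (a - c) ^+ 2 := sqr_ge0 _; have h4 : 0 <= (b - e) ^+ 2 := sqr_ge0 _.
have h5 : 0 <= a ^+ 2 := sqr_ge0 _; have h6 : 0 <= b ^+ 2 := sqr_ge0 _.
have h7 : 0 <= c ^+ 2 := sqr_ge0 _; have h8 : 0 <= e ^+ 2 := sqr_ge0 _.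
by apply/andP; split; nra.
Qed.

Lemma L2'_cmb u r v : L2' u -> L2' v -> L2' (cmb u r v).
Proof.
move=> hu hv; have iuv := ipf_integrable hu hv.
case: hu hv => mru miu iu [mrv miv iv]; split.
- rewrite (_ : (fun p => _) = (fun p => Re (u p) + r * Re (v p))).
    by apply: measurable_funD => //; apply: measurable_funM.
  by apply/funext => p; rewrite Re_cmb.
- rewrite (_ : (fun p => _) = (fun p => Im (u p) + r * Im (v p))).
    by apply: measurable_funD => //; apply: measurable_funM.
  by apply/funext => p; rewrite Im_cmb.
rewrite (_ : EFin \o _ = (EFin \o ipf u u) \+ (fun p => (2 * r)%:E * (EFin \o ipf u v) p) \+
   (fun p => (r ^+ 2)%:E * (EFin \o ipf v v) p))%E.
  by apply: integrableD => //; [apply: integrableD => //|]; apply: integrableZl.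
apply/funext => p /=; rewrite -!EFinM -!EFinD; congr EFin.
by rewrite /ipf !Re_cmb !Im_cmb; ring.
Qed.

Lemma L2'_imul u : L2' u -> L2' (imul u).
Proof.
move=> [mr mi i]; split.
- rewrite (_ : (fun p => _) = (fun p => - Im (u p))); first exact: measurableT_comp.
  by apply/funext => p; rewrite Re_imul.
- by rewrite (_ : (fun p => _) = (fun p => Re (u p))) //; apply/funext => p; rewrite Im_imul.
- rewrite (_ : ipf (imul u) (imul u) = ipf u u) //.
  by apply/funext => p; rewrite /ipf Re_imul Im_imul; ring.
Qed.

Lemma ipC u v : ip u v = ip v u.
Proof. by apply: eq_Rintegral => p _; rewrite /ipf mulrC [Im _ * _]mulrC. Qed.

Lemma ip_cmbl u r v w : L2' u -> L2' v -> L2' w -> ip (cmb u r v) w = ip u w + r * ip v w.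
Proof.
move=> hu hv hw; rewrite /ip.
have iu := ipf_integrable hu hw; have iv := ipf_integrable hv hw.
rewrite -RintegralZl // -RintegralD //; last first.
  rewrite (_ : EFin \o _ = (fun p => r%:E * (EFin \o ipf v w) p))%E; last by [].
  exact: integrableZl.
by apply: eq_Rintegral => p _; rewrite /ipf !Re_cmb !Im_cmb; ring.
Qed.

Lemma ip_cmbr u r v w : L2' u -> L2' v -> L2' w -> ip w (cmb u r v) = ip w u + r * ip w v.
Proof. by move=> hu hv hw; rewrite ipC ip_cmbl // ![ip _ w]ipC. Qed.

Lemma n2_ge0 u : 0 <= n2 u.
Proof. by apply: Rintegral_ge0 => p _; exact: ipf_ge0. Qed.

Lemma n2_cmb u r v : L2' u -> L2' v -> n2 (cmb u r v) = n2 u + 2 * r * ip u v + r ^+ 2 * n2 v.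
Proof.
move=> hu hv; have huv := L2'_cmb r hu hv.
rewrite /n2 ip_cmbl // ip_cmbr // (ip_cmbr _ _ _ hv) // (ipC v u); ring.
Qed.

(** The discriminant inequality with no sign assumed for C. It yields Cauchy-Schwarz for the inner
    product and for the forms, and it also turns near-minimality into an approximate Euler
    equation. *)
Lemma quad_disc (A B C : R) : (forall t, 0 <= A + 2 * t * B + t ^+ 2 * C) -> B ^+ 2 <= A * C.
Proof.
move=> h.
have A0 : 0 <= A by have := h 0; rewrite mulr0 mul0r expr0n /= mul0r !addr0.
have [C0|C0] := ltP 0 C.
  have := h (- B / C); rewrite (_ : A + _ + _ = (A * C - B ^+ 2) / C); last by field; rewrite gt_eqF.
  by rewrite pmulr_lge0 ?invr_gt0 // subr_ge0.
have CE : C = 0.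
  apply/eqP; rewrite eq_le C0 /= leNgt; apply/negP => CN.
  (* For C < 0 this t is at least 1 and t (- C) = A + 1 - C + 2 |B|, so that the value of the
     polynomial at t is at most C - 1 < 0. *)
  pose t := (A + 1) / - C + 1 + `|B| * 2 / - C.
  have CN' : 0 < - C by rewrite oppr_gt0.
  have t1 : 1 <= t.
    rewrite /t -addrA [X in _ <= X]addrCA lerDl addr_ge0 //; first by rewrite divr_ge0 // ?addr_ge0 // ltW.
    by rewrite divr_ge0 ?mulr_ge0 // ltW.
  have tC : t * - C = A + 1 - C + `|B| * 2 by rewrite /t; field; rewrite ?oppr_eq0 lt_eqF.
  have := h t; rewrite (_ : A + _ + _ = A + t * (2 * B - t * - C)); last ring.
  rewrite tC => hh; have := ler_norm B => nB.
  have : t * (2 * B - (A + 1 - C + `|B| * 2)) <= 1 * (2 * B - (A + 1 - C + `|B| * 2)).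
    by rewrite ler_wnM2r //; lra.
  by lra.
rewrite CE mulr0; have [->|B0] := eqVneq B 0; first by rewrite expr0n.
have := h (- (A + 1) / (2 * B)); rewrite CE mulr0 addr0.
rewrite (_ : A + _ = - 1); last by field.
by rewrite ler0N1.
Qed.

Lemma ip_CS u v : L2' u -> L2' v -> ip u v ^+ 2 <= n2 u * n2 v.
Proof.
by move=> hu hv; apply: quad_disc => t; have := n2_ge0 (cmb u t v); rewrite n2_cmb.
Qed.

Lemma Re_inner u v : Re (inner u v) = ip u v.
Proof. by rewrite /inner /cintegral /=; apply: eq_Rintegral => p _; rewrite /ipf !ReImE; ring. Qed.

Lemma Im_inner u v : Im (inner u v) = ip u (imul v).
Proof.
rewrite /inner /cintegral /=; apply: eq_Rintegral => p _.
by rewrite /ipf Re_imul Im_imul !ReImE; ring.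
Qed.

Lemma Cc_L2' u : Cc (fun p => Re (u p)) -> Cc (fun p => Im (u p)) -> L2' u.
Proof.
move=> cr ci; split; [by case: cr => c _; exact: continuous_heis_measurable
  |by case: ci => c _; exact: continuous_heis_measurable|].
by apply: Cc_integrable; apply: Cc_add; apply: Cc_mull => //; [case: cr|case: ci].
Qed.

(** The real and imaginary parts converge separately, each with error 8 K 4^-n; hence the constant
    16. *)
Lemma L2'_complete (u_ : nat -> H -> R[i]) (K : R) : (forall n, L2' (u_ n)) ->
  (forall n, n2 (cmb (u_ n.+1) (-1) (u_ n)) <= K * 16^-1 ^+ n) ->
  exists2 u, L2' u & forall n, n2 (cmb (u_ n) (-1) u) <= 16 * K * 4^-1 ^+ n.
Proof.
move=> hu hK.
have dK n : ((\int[mu]_p (ipf (cmb (u_ n.+1) (-1) (u_ n)) (cmb (u_ n.+1) (-1) (u_ n)) p)%:E)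
    <= (K * 16^-1 ^+ n)%:E)%E.
  have [_ _ ii] := L2'_cmb (-1) (hu n.+1) (hu n).
  by rewrite -(fineK (integrable_fin_num _ ii)) // lee_fin; exact: hK.
have mr n : measurable_fun [set: M] (fun p => Re (u_ n p)) by have [] := hu n.
have mi n : measurable_fun [set: M] (fun p => Im (u_ n p)) by have [] := hu n.
have [|f mf hf] := @L2_fast_complete R _ M mu (fun n p => Re (u_ n p)) K mr _.
  move=> n; apply: le_trans (dK n); apply: ge0_le_integral => //.
  - by move=> p _; rewrite lee_fin sqr_ge0.
  - by apply/measurable_EFinP; apply: measurable_funX; apply: measurable_funB.
  - have [a b _] := L2'_cmb (-1) (hu n.+1) (hu n).
    by have mI := ipf_measurable a b a b; apply/measurable_EFinP.
  - move=> p _; rewrite lee_fin /ipf !Re_cmb !Im_cmb !mulN1r -!expr2 lerDl; exact: sqr_ge0.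
have [|g mg hg] := @L2_fast_complete R _ M mu (fun n p => Im (u_ n p)) K mi _.
  move=> n; apply: le_trans (dK n); apply: ge0_le_integral => //.
  - by move=> p _; rewrite lee_fin sqr_ge0.
  - by apply/measurable_EFinP; apply: measurable_funX; apply: measurable_funB.
  - have [a b _] := L2'_cmb (-1) (hu n.+1) (hu n).
    by have mI := ipf_measurable a b a b; apply/measurable_EFinP.
  - move=> p _; rewrite lee_fin /ipf !Re_cmb !Im_cmb !mulN1r -!expr2 lerDr; exact: sqr_ge0.
pose u p : R[i] := f p +i* g p.
have E n : (\int[mu]_p (ipf (cmb (u_ n) (-1) u) (cmb (u_ n) (-1) u) p)%:E <= (16 * K * 4^-1 ^+ n)%:E)%E.
  have -> : 16 * K * 4^-1 ^+ n = 8 * K * 4^-1 ^+ n + 8 * K * 4^-1 ^+ n by ring.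
  rewrite EFinD; apply: le_trans (leeD (hf n) (hg n)).
  rewrite -ge0_integralD //; first last.
  - by apply/measurable_EFinP; apply: measurable_funX; apply: measurable_funB.
  - by move=> p _; rewrite lee_fin sqr_ge0.
  - by apply/measurable_EFinP; apply: measurable_funX; apply: measurable_funB.
  - by move=> p _; rewrite lee_fin sqr_ge0.
  rewrite le_eqVlt; apply/orP; left; apply/eqP; apply: eq_integral => p _.
  by rewrite -EFinD /ipf !Re_cmb !Im_cmb /= !mulN1r -!expr2.
have hd n : L2' (cmb (u_ n) (-1) u).
  have mr' : measurable_fun [set: M] (fun p => Re (cmb (u_ n) (-1) u p)).
    rewrite (_ : (fun p => _) = (fun p => Re (u_ n p) - f p)); first exact: measurable_funB.
    by apply/funext => p; rewrite Re_cmb mulN1r.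
  have mi' : measurable_fun [set: M] (fun p => Im (cmb (u_ n) (-1) u p)).
    rewrite (_ : (fun p => _) = (fun p => Im (u_ n p) - g p)); first exact: measurable_funB.
    by apply/funext => p; rewrite Im_cmb mulN1r.
  have mI := ipf_measurable mr' mi' mr' mi'.
  split=> //; apply/integrableP; split; first exact/measurable_EFinP.
  under eq_integral do rewrite /= ger0_norm ?ipf_ge0 //.
  by apply: le_lt_trans (E n) _; rewrite ltry.
exists u.
  rewrite (_ : u = cmb (u_ 0%N) (-1) (cmb (u_ 0%N) (-1) u)); first exact: L2'_cmb.
  by apply/funext => p; apply: complexP; rewrite !(Re_cmb, Im_cmb); ring.
move=> n; have [_ _ ii] := hd n; rewrite -lee_fin; apply: le_trans (E n).
by rewrite -[X in (_ <= X)%E](fineK (integrable_fin_num _ ii)).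
Qed.

End L2_heis.

Section test_functions.
Context {R : realType}.
Local Notation H := (heis R).
Local Notation mu := (@heis_measure R).
Implicit Types (f g : H -> R) (u v w : H -> R[i]).
Local Notation Re := complex.Re.
Local Notation Im := complex.Im.

Lemma smooth_continuous f : smooth f -> continuous f.
Proof. by move=> /(_ 0%N) []. Qed.

Lemma smooth_add f g : smooth f -> smooth g -> smooth (fun p => f p + g p).
Proof. by move=> sf sg k; apply: Ck_add. Qed.

Lemma smooth_mul f g : smooth f -> smooth g -> smooth (fun p => f p * g p).
Proof. by move=> sf sg k; apply: Ck_mul. Qed.

Lemma smooth_cst (c : R) : smooth (fun=> c : R).
Proof. by move=> k; apply: Ck_cst. Qed.

Lemma smooth_opp f : smooth f -> smooth (fun p => - f p).
Proof.
move=> sf; rewrite (_ : (fun p => _) = (fun p => -1 * f p)).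
  by apply: smooth_mul => //; exact: smooth_cst.
by apply/funext => p; rewrite mulN1r.
Qed.

Lemma smooth_sub f g : smooth f -> smooth g -> smooth (fun p => f p - g p).
Proof. by move=> sf sg; apply: smooth_add => //; exact: smooth_opp. Qed.

Lemma smooth_coord1 : smooth (fun p : H => p.1.1). Proof. by move=> k; case: (@Ck_coord R k). Qed.
Lemma smooth_coord2 : smooth (fun p : H => p.1.2). Proof. by move=> k; case: (@Ck_coord R k). Qed.
Lemma smooth_coord3 : smooth (fun p : H => p.2). Proof. by move=> k; case: (@Ck_coord R k). Qed.

Lemma smooth_derive f (v : H) : v \in [:: e_x; e_y; e_z] -> smooth f -> smooth ('D_v f).
Proof. by move=> vin sf k; have [_] := CkS_derive (sf k.+1); apply. Qed.

Definition dirD f (v p : H) : R := v.1.1 * 'D_e_x f p + v.1.2 * 'D_e_y f p + v.2 * 'D_e_z f p.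

Lemma smooth_is_derive f (p v : H) : smooth f -> is_derive p v f (dirD f v p).
Proof. by move=> sf; exact: (Ck1_is_derive p v (sf 1%N)). Qed.

Lemma is_derive_X f p : smooth f -> is_derive p (Xv p) f (vfX f p).
Proof.
move=> sf; apply: (is_derive_eq (smooth_is_derive p (Xv p) sf)).
by rewrite /dirD /vfX; set a := 'D_e_x f p; set b := 'D_e_y f p; set c := 'D_e_z f p; rewrite /=; ring.
Qed.

Lemma is_derive_Y f p : smooth f -> is_derive p (Yv p) f (vfY f p).
Proof.
move=> sf; apply: (is_derive_eq (smooth_is_derive p (Yv p) sf)).
by rewrite /dirD /vfY; set a := 'D_e_x f p; set b := 'D_e_y f p; set c := 'D_e_z f p; rewrite /=; ring.
Qed.

Lemma smooth_vfX f : smooth f -> smooth (vfX f).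
Proof.
move=> sf; apply: smooth_sub; first by apply: smooth_derive; rewrite // !inE eqxx ?orbT.
apply: smooth_mul; last by apply: smooth_derive; rewrite // !inE eqxx ?orbT.
by apply: smooth_mul; [exact: smooth_coord2|exact: smooth_cst].
Qed.

Lemma smooth_vfY f : smooth f -> smooth (vfY f).
Proof.
move=> sf; apply: smooth_add; first by apply: smooth_derive; rewrite // !inE eqxx ?orbT.
apply: smooth_mul; last by apply: smooth_derive; rewrite // !inE eqxx ?orbT.
by apply: smooth_mul; [exact: smooth_coord1|exact: smooth_cst].
Qed.

Lemma derive_vanish f (v : H) p : (\forall q \near p, f q = 0) -> 'D_v f p = 0.
Proof.
by move=> f0; rewrite (near_eq_derive (g := cst 0) v f0) derive_cst.
Qed.

Lemma far_near (B : R) (p : H) : B < `|p| -> \forall q \near p, B < `|q|.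
Proof.
move=> Bp; have : {for p, continuous (fun q : H => `|q|)} by exact: norm_continuous.
by move=> /cvgr_gt /(_ _ Bp).
Qed.

Lemma vanishes_derive f (v : H) : vanishes f -> vanishes ('D_v f).
Proof.
move=> [B vf]; exists B => p Bp; apply: derive_vanish.
by near do apply: vf; exact: far_near.
Unshelve. all: end_near. Qed.

Lemma vanishes_vfX f : vanishes f -> vanishes (vfX f).
Proof.
move=> vf; have [B vx] := vanishes_derive e_x vf; have [C vz] := vanishes_derive e_z vf.
exists (Num.max B C) => p; rewrite gt_max => /andP[h1 h2].
by rewrite /vfX vx // vz // mulr0 subr0.
Qed.

Lemma vanishes_vfY f : vanishes f -> vanishes (vfY f).
Proof.
move=> vf; have [B vx] := vanishes_derive e_y vf; have [C vz] := vanishes_derive e_z vf.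
exists (Num.max B C) => p; rewrite gt_max => /andP[h1 h2].
by rewrite /vfY vx // vz // mulr0 addr0.
Qed.

Lemma test_functionP u : test_function u <->
  [/\ smooth (fun p => Re (u p)), smooth (fun p => Im (u p)),
      vanishes (fun p => Re (u p)) & vanishes (fun p => Im (u p))].
Proof.
split=> [[sr si c]|[sr si [B vr] [C vi]]].
  have [N [Nr /(_ (N + 1))]] := compact_bounded c.
  rewrite ltrDl ltr01 => /(_ isT) hN.
  have h p : N + 1 < `|p| -> u p = 0.
    move=> pN; apply/eqP; apply: contraTT pN => up.
    by rewrite -leNgt; apply: hN; apply: subset_closure.
  by split=> //; exists (N + 1) => p /h ->.
split=> //; apply: (subclosed_compact _ (@compact_box R (Num.max B C))).
  exact: closed_closure.
rewrite closureE; apply: smallest_sub.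
  by apply: compact_closed; [exact: norm_hausdorff|exact: compact_box].
move=> p /=; apply: contraNT; rewrite -ltNge gt_max => /andP[h1 h2].
by apply/eqP; apply: complexP; rewrite ?vr ?vi.
Qed.

Lemma vanishes_add f g : vanishes f -> vanishes g -> vanishes (fun p => f p + g p).
Proof.
move=> [B vf] [C vg]; exists (Num.max B C) => p; rewrite gt_max => /andP[h1 h2].
by rewrite vf // vg // addr0.
Qed.

Lemma vanishes_mull f g : vanishes g -> vanishes (fun p => f p * g p).
Proof. by move=> [B vg]; exists B => p /vg ->; rewrite mulr0. Qed.

Lemma vanishes_opp f : vanishes f -> vanishes (fun p => - f p).
Proof. by move=> [B vf]; exists B => p /vf ->; rewrite oppr0. Qed.

Definition tfR f := smooth f /\ vanishes f.

Lemma test_functionE u : test_function u <-> tfR (fun p => Re (u p)) /\ tfR (fun p => Im (u p)).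
Proof. by rewrite test_functionP; split=> [[]|[[] ? ? []]]. Qed.

Lemma tfR_add f g : tfR f -> tfR g -> tfR (fun p => f p + g p).
Proof. by move=> [? ?] [? ?]; split; [exact: smooth_add|exact: vanishes_add]. Qed.
Lemma tfR_mull f g : smooth f -> tfR g -> tfR (fun p => f p * g p).
Proof. by move=> ? [? ?]; split; [exact: smooth_mul|exact: vanishes_mull]. Qed.
Lemma tfR_opp f : tfR f -> tfR (fun p => - f p).
Proof. by move=> [? ?]; split; [exact: smooth_opp|exact: vanishes_opp]. Qed.
Lemma tfR_sub f g : tfR f -> tfR g -> tfR (fun p => f p - g p).
Proof. by move=> tf tg; apply: tfR_add => //; exact: tfR_opp. Qed.
Lemma tfR_vfX f : tfR f -> tfR (vfX f).
Proof. by move=> [? ?]; split; [exact: smooth_vfX|exact: vanishes_vfX]. Qed.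
Lemma tfR_vfY f : tfR f -> tfR (vfY f).
Proof. by move=> [? ?]; split; [exact: smooth_vfY|exact: vanishes_vfY]. Qed.
Lemma tfR_Cc f : tfR f -> Cc f.
Proof. by move=> [sf vf]; split=> //; exact: smooth_continuous. Qed.

Lemma tf_L2' u : test_function u -> L2' u.
Proof. by move=> /test_functionE[/tfR_Cc cr /tfR_Cc ci]; exact: Cc_L2'. Qed.

Lemma tf_cmb u r v : test_function u -> test_function v -> test_function (cmb u r v).
Proof.
move=> /test_functionE[ur ui] /test_functionE[vr vi]; apply/test_functionE; split.
- rewrite (_ : (fun p => _) = (fun p => Re (u p) + r * Re (v p))).
    by apply: tfR_add => //; apply: tfR_mull => //; exact: smooth_cst.
  by apply/funext => p; rewrite Re_cmb.
- rewrite (_ : (fun p => _) = (fun p => Im (u p) + r * Im (v p))).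
    by apply: tfR_add => //; apply: tfR_mull => //; exact: smooth_cst.
  by apply/funext => p; rewrite Im_cmb.
Qed.

Lemma tf_imul u : test_function u -> test_function (imul u).
Proof.
move=> /test_functionE[ur ui]; apply/test_functionE; split.
- rewrite (_ : (fun p => _) = (fun p => - Im (u p))); first exact: tfR_opp.
  by apply/funext => p; rewrite Re_imul.
- by rewrite (_ : (fun p => _) = (fun p => Re (u p))) //; apply/funext => p; rewrite Im_imul.
Qed.

Lemma tf0 : test_function (fun=> 0 : R[i]).
Proof.
apply/test_functionE; split; (split; first exact: smooth_cst); by exists 0.
Qed.

Lemma vfX_lin f r g p : smooth f -> smooth g ->
  vfX (fun q => f q + r * g q) p = vfX f p + r * vfX g p.
Proof.
move=> sf sg; have srg := smooth_mul (smooth_cst r) sg.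
have [_ <-] := is_derive_X p (smooth_add sf srg).
have Dg := is_deriveMul (is_derive_cst r p (Xv p)) (is_derive_X p sg).
have D := is_deriveD (is_derive_X p sf) Dg.
by rewrite (@derive_val _ _ _ _ _ _ _ D) mul0r add0r.
Qed.

Lemma vfY_lin f r g p : smooth f -> smooth g ->
  vfY (fun q => f q + r * g q) p = vfY f p + r * vfY g p.
Proof.
move=> sf sg; have srg := smooth_mul (smooth_cst r) sg.
have [_ <-] := is_derive_Y p (smooth_add sf srg).
have Dg := is_deriveMul (is_derive_cst r p (Yv p)) (is_derive_Y p sg).
have D := is_deriveD (is_derive_Y p sf) Dg.
by rewrite (@derive_val _ _ _ _ _ _ _ D) mul0r add0r.
Qed.

Lemma integral_vfX f : tfR f -> (\int[mu]_p vfX f p = 0)%R.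
Proof.
move=> tf; apply: (integral_flow_derive straight_flowX (tfR_Cc tf) (tfR_Cc (tfR_vfX tf))).
by move=> p; apply: is_derive_X; case: tf.
Qed.

Lemma integral_vfY f : tfR f -> (\int[mu]_p vfY f p = 0)%R.
Proof.
move=> tf; apply: (integral_flow_derive straight_flowY (tfR_Cc tf) (tfR_Cc (tfR_vfY tf))).
by move=> p; apply: is_derive_Y; case: tf.
Qed.

Lemma vfX_mul f g p : smooth f -> smooth g ->
  vfX (fun q => f q * g q) p = vfX f p * g p + f p * vfX g p.
Proof.
move=> sf sg; have D := is_deriveMul (is_derive_X p sf) (is_derive_X p sg).
have [_ <-] := D; have [_ ->] // := is_derive_X p (smooth_mul sf sg).
Qed.

Lemma vfY_mul f g p : smooth f -> smooth g ->
  vfY (fun q => f q * g q) p = vfY f p * g p + f p * vfY g p.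
Proof.
move=> sf sg; have D := is_deriveMul (is_derive_Y p sf) (is_derive_Y p sg).
have [_ <-] := D; have [_ ->] // := is_derive_Y p (smooth_mul sf sg).
Qed.

End test_functions.

(** * The magnetic form and its closure *)

Section form.
Context {R : realType}.
Local Notation H := (heis R).
Implicit Types (f g : H -> R) (u v w : H -> R[i]).
Local Notation Re := complex.Re.
Local Notation Im := complex.Im.
Context (A : one_form R) (sA : smooth_form A).

Lemma Re_covX u p : Re (covX A u p) = vfX (fun q => Re (u q)) p - c_dx A p * Im (u p).
Proof. by rewrite /covX /vfXC !ReImE /= mul0r sub0r. Qed.
Lemma Im_covX u p : Im (covX A u p) = vfX (fun q => Im (u q)) p + c_dx A p * Re (u p).
Proof. by rewrite /covX /vfXC !ReImE /= mul0r add0r. Qed.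
Lemma Re_covY u p : Re (covY A u p) = vfY (fun q => Re (u q)) p - c_dy A p * Im (u p).
Proof. by rewrite /covY /vfYC !ReImE /= mul0r sub0r. Qed.
Lemma Im_covY u p : Im (covY A u p) = vfY (fun q => Im (u q)) p + c_dy A p * Re (u p).
Proof. by rewrite /covY /vfYC !ReImE /= mul0r add0r. Qed.

Lemma tf_covX u : test_function u -> test_function (covX A u).
Proof.
case: sA => sx _ _ /test_functionE[ur ui]; apply/test_functionE; split.
  rewrite (funext (Re_covX u)); apply: tfR_sub; first exact: tfR_vfX.
  exact: tfR_mull.
rewrite (funext (Im_covX u)); apply: tfR_add; first exact: tfR_vfX.
exact: tfR_mull.
Qed.

Lemma tf_covY u : test_function u -> test_function (covY A u).
Proof.
case: sA => _ sy _ /test_functionE[ur ui]; apply/test_functionE; split.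
  rewrite (funext (Re_covY u)); apply: tfR_sub; first exact: tfR_vfY.
  exact: tfR_mull.
rewrite (funext (Im_covY u)); apply: tfR_add; first exact: tfR_vfY.
exact: tfR_mull.
Qed.

Lemma covX_cmb u r v : test_function u -> test_function v ->
  covX A (cmb u r v) = cmb (covX A u) r (covX A v).
Proof.
move=> /test_functionE[[ur _] [ui _]] /test_functionE[[vr _] [vi _]].
apply/funext => p; apply: complexP.
  rewrite Re_cmb !Re_covX (funext (Re_cmb u r v)) vfX_lin // Im_cmb; ring.
rewrite Im_cmb !Im_covX (funext (Im_cmb u r v)) vfX_lin // Re_cmb; ring.
Qed.

Lemma covY_cmb u r v : test_function u -> test_function v ->
  covY A (cmb u r v) = cmb (covY A u) r (covY A v).
Proof.
move=> /test_functionE[[ur _] [ui _]] /test_functionE[[vr _] [vi _]].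
apply/funext => p; apply: complexP.
  rewrite Re_cmb !Re_covY (funext (Re_cmb u r v)) vfY_lin // Im_cmb; ring.
rewrite Im_cmb !Im_covY (funext (Im_cmb u r v)) vfY_lin // Re_cmb; ring.
Qed.

Lemma vfX_opp f p : smooth f -> vfX (fun q => - f q) p = - vfX f p.
Proof.
move=> sf; have [_ <-] := is_derive_X p (smooth_opp sf).
by have [_] := is_deriveN (is_derive_X p sf).
Qed.

Lemma vfY_opp f p : smooth f -> vfY (fun q => - f q) p = - vfY f p.
Proof.
move=> sf; have [_ <-] := is_derive_Y p (smooth_opp sf).
by have [_] := is_deriveN (is_derive_Y p sf).
Qed.

Lemma covX_imul u : test_function u -> covX A (imul u) = imul (covX A u).
Proof.
move=> /test_functionE[[ur _] [ui _]]; apply/funext => p; apply: complexP.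
  rewrite Re_imul Re_covX Im_covX (funext (Re_imul u)) vfX_opp // Im_imul; ring.
rewrite Im_imul Re_covX Im_covX (funext (Im_imul u)) Re_imul; ring.
Qed.

Lemma covY_imul u : test_function u -> covY A (imul u) = imul (covY A u).
Proof.
move=> /test_functionE[[ur _] [ui _]]; apply/funext => p; apply: complexP.
  rewrite Re_imul Re_covY Im_covY (funext (Re_imul u)) vfY_opp // Im_imul; ring.
rewrite Im_imul Re_covY Im_covY (funext (Im_imul u)) Re_imul; ring.
Qed.

Lemma L2_covX u : test_function u -> L2' (covX A u).
Proof. by move=> tu; exact: tf_L2' (tf_covX tu). Qed.

Lemma L2_covY u : test_function u -> L2' (covY A u).
Proof. by move=> tu; exact: tf_L2' (tf_covY tu). Qed.

(** The real part of the sesquilinear form. Its imaginary part is [qf u (imul v)], because [imul]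
    commutes with [covX] and [covY]. *)
Definition qf u v : R := ip (covX A u) (covX A v) + ip (covY A u) (covY A v).

Lemma qfC u v : qf u v = qf v u.
Proof. by rewrite /qf ipC (ipC (covY A u)). Qed.

Lemma qf_ge0 u : 0 <= qf u u.
Proof. by rewrite addr_ge0 // n2_ge0. Qed.

Lemma qf_cmbl u r v w : test_function u -> test_function v -> test_function w ->
  qf (cmb u r v) w = qf u w + r * qf v w.
Proof.
move=> tu tv tw; rewrite /qf covX_cmb // covY_cmb //.
rewrite (ip_cmbl r (L2_covX tu) (L2_covX tv) (L2_covX tw)).
rewrite (ip_cmbl r (L2_covY tu) (L2_covY tv) (L2_covY tw)).
by rewrite mulrDr addrACA.
Qed.

Lemma qf_cmbr u r v w : test_function u -> test_function v -> test_function w ->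
  qf w (cmb u r v) = qf w u + r * qf w v.
Proof. by move=> tu tv tw; rewrite qfC qf_cmbl // ![qf _ w]qfC. Qed.

Lemma qf_cmb u r v : test_function u -> test_function v ->
  qf (cmb u r v) (cmb u r v) = qf u u + 2 * r * qf u v + r ^+ 2 * qf v v.
Proof.
move=> tu tv; have tuv := tf_cmb r tu tv.
rewrite qf_cmbl // (qf_cmbr _ tu tv tu) // (qf_cmbr _ tu tv tv) // (qfC v u); ring.
Qed.

Lemma Re_mag_sesq u v : test_function u -> test_function v -> Re (mag_sesq A u v) = qf u v.
Proof.
move=> tu tv; rewrite /mag_sesq /cintegral /= /qf /ip.
have iX := ipf_integrable (L2_covX tu) (L2_covX tv).
have iY := ipf_integrable (L2_covY tu) (L2_covY tv).
rewrite -(RintegralD measurableT iX iY).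
apply: eq_Rintegral => p _; rewrite /ipf ReD !ReM !ReJ !ImJ !mulrN !opprK; by [].
Qed.

Lemma Im_mag_sesq u v : test_function u -> test_function v ->
  Im (mag_sesq A u v) = qf u (imul v).
Proof.
move=> tu tv; rewrite /qf covX_imul // covY_imul //.
rewrite /mag_sesq /cintegral /= /ip.
have iX := ipf_integrable (L2_covX tu) (L2'_imul (L2_covX tv)).
have iY := ipf_integrable (L2_covY tu) (L2'_imul (L2_covY tv)).
rewrite -(RintegralD measurableT iX iY).
by apply: eq_Rintegral => p _; rewrite /ipf !Re_imul !Im_imul ImD !ImM !ReJ !ImJ !mulrN.
Qed.

Lemma mag_quadE u : test_function u -> mag_quad A u = qf u u.
Proof.
move=> tu; rewrite /mag_quad /qf /ip.
have iX := ipf_integrable (L2_covX tu) (L2_covX tu).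
have iY := ipf_integrable (L2_covY tu) (L2_covY tu).
rewrite -(RintegralD measurableT iX iY).
by apply: eq_Rintegral => p _; rewrite /ipf !normc_sq !expr2.
Qed.

(** The terms in A_x cancel because multiplication by i A_x is skew, and the rest of the two
    integrands adds up to X applied to Re (u conj(v)), a test function, whose integral vanishes. *)
Lemma covX_skew u v : test_function u -> test_function v ->
  ip (covX A u) v = - ip u (covX A v).
Proof.
move=> tu tv; apply/eqP; rewrite -addr_eq0 /ip; apply/eqP.
have i1 := ipf_integrable (L2_covX tu) (tf_L2' tv).
have i2 := ipf_integrable (tf_L2' tu) (L2_covX tv).
rewrite -(RintegralD measurableT i1 i2).
case/test_functionE: tu => ur ui; case/test_functionE: tv => vr vi.
have tf : tfR (fun p => Re (u p) * Re (v p) + Im (u p) * Im (v p)).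
  by apply: tfR_add; apply: tfR_mull => //; [case: ur|case: ui].
rewrite -(integral_vfX tf).
apply: eq_Rintegral => p _.
case: ur ui vr vi => [ur _] [ui _] [vr _] [vi _].
have := vfX_lin 1 p (smooth_mul ur vr) (smooth_mul ui vi).
rewrite (_ : (fun q => _ + 1 * _) = (fun p => Re (u p) * Re (v p) + Im (u p) * Im (v p))).
  move=> ->; rewrite !vfX_mul // /ipf !Re_covX !Im_covX; ring.
by apply/funext => q; rewrite mul1r.
Qed.

Lemma covY_skew u v : test_function u -> test_function v ->
  ip (covY A u) v = - ip u (covY A v).
Proof.
move=> tu tv; apply/eqP; rewrite -addr_eq0 /ip; apply/eqP.
have i1 := ipf_integrable (L2_covY tu) (tf_L2' tv).
have i2 := ipf_integrable (tf_L2' tu) (L2_covY tv).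
rewrite -(RintegralD measurableT i1 i2).
case/test_functionE: tu => ur ui; case/test_functionE: tv => vr vi.
have tf : tfR (fun p => Re (u p) * Re (v p) + Im (u p) * Im (v p)).
  by apply: tfR_add; apply: tfR_mull => //; [case: ur|case: ui].
rewrite -(integral_vfY tf).
apply: eq_Rintegral => p _.
case: ur ui vr vi => [ur _] [ui _] [vr _] [vi _].
have := vfY_lin 1 p (smooth_mul ur vr) (smooth_mul ui vi).
rewrite (_ : (fun q => _ + 1 * _) = (fun p => Re (u p) * Re (v p) + Im (u p) * Im (v p))).
  move=> ->; rewrite !vfY_mul // /ipf !Re_covY !Im_covY; ring.
by apply/funext => q; rewrite mul1r.
Qed.

(** Delta_A on test functions, with its non-positive sign. Moving both derivatives onto [w] makes
    q(u, w) continuous in u for the L^2 norm, the source of closability. *)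
Definition lapl w : H -> R[i] := cmb (covX A (covX A w)) 1 (covY A (covY A w)).

Lemma tf_lapl w : test_function w -> test_function (lapl w).
Proof.
by move=> tw; exact: tf_cmb (tf_covX (tf_covX tw)) (tf_covY (tf_covY tw)).
Qed.

Lemma qf_lapl u w : test_function u -> test_function w -> qf u w = - ip u (lapl w).
Proof.
move=> tu tw; have tX := tf_covX tw; have tY := tf_covY tw.
rewrite /qf (covX_skew tu tX) (covY_skew tu tY) /lapl.
by rewrite (ip_cmbr 1 (L2_covX tX) (L2_covY tY) (tf_L2' tu)) mul1r opprD.
Qed.

End form.

(** * Approximating sequences and closability *)

Section approximation.
Context {R : realType}.
Local Notation H := (heis R).
Implicit Types (u v w : H -> R[i]).

Lemma cvg0_le (a b : nat -> R) (N : nat) : (forall n, (N <= n)%N -> `|b n| <= a n) ->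
  a @ \oo --> (0 : R) -> b @ \oo --> (0 : R).
Proof.
move=> ba a0; apply: norm_cvg0; apply: (@squeeze_cvgr _ _ _ _ (cst 0) _ _ _ _ _ a0).
  by exists N => // n /= /ba; rewrite normr_ge0.
exact: cvg_cst.
Qed.

Lemma cvg0_sq (a b : nat -> R) (N : nat) : (forall n, (N <= n)%N -> b n ^+ 2 <= a n) ->
  a @ \oo --> (0 : R) -> b @ \oo --> (0 : R).
Proof.
move=> ba a0.
have s0 : Num.sqrt (a n) @[n --> \oo] --> (0 : R).
  rewrite -(@sqrtr0 R); apply: continuous_cvg => //; exact: sqrt_continuous.
apply: (cvg0_le (N := N) _ s0) => n Nn.
by rewrite -sqrtr_sqr; apply: ler_wsqrtr; exact: ba.
Qed.

Lemma cvg0_lt (a : nat -> R) eps : 0 < eps -> a @ \oo --> (0 : R) ->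
  exists N, forall n, (N <= n)%N -> `|a n| < eps.
Proof.
move=> e0 /cvgrPdist_lt /(_ _ e0)[N _ hN]; exists N => n /hN /=.
by rewrite sub0r normrN.
Qed.

Lemma cmbBB u_ u v_ v : (cmb (cmb u_ (-1) u) (-1) (cmb v_ (-1) v) : H -> R[i]) =
  cmb (cmb u_ (-1) v_) (-1) (cmb u (-1) v).
Proof. by apply/funext => p; apply: complexP; rewrite !(Re_cmb, Im_cmb); ring. Qed.

Lemma cmb_id u v : cmb (cmb u (-1) v) 1 v = u :> (H -> R[i]).
Proof. by apply/funext => p; apply: complexP; rewrite !(Re_cmb, Im_cmb); ring. Qed.

Lemma n2D2 u v : L2' u -> L2' v -> n2 (cmb u 1 v) <= 2 * n2 u + 2 * n2 v.
Proof.
move=> hu hv; have := n2_ge0 (cmb u (-1) v).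
by rewrite !n2_cmb // expr1n sqrrN expr1n; lra.
Qed.

Lemma n2B2 u v : L2' u -> L2' v -> n2 (cmb u (-1) v) <= 2 * n2 u + 2 * n2 v.
Proof.
move=> hu hv; have := n2_ge0 (cmb u 1 v).
by rewrite !n2_cmb // expr1n sqrrN expr1n; lra.
Qed.

Definition L2cvg (u_ : nat -> H -> R[i]) u := n2 (cmb (u_ n) (-1) u) @[n --> \oo] --> (0 : R).

Lemma L2cvg_bounded (u_ : nat -> H -> R[i]) u : L2' u -> (forall n, L2' (u_ n)) -> L2cvg u_ u ->
  exists B N, forall n, (N <= n)%N -> n2 (u_ n) <= B.
Proof.
move=> hu hu_ cu; have [N hN] := cvg0_lt (@ltr01 R) cu.
exists (2 * 1 + 2 * n2 u), N => n /hN; rewrite ger0_norm ?n2_ge0 // => h.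
rewrite -{1}(cmb_id (u_ n) u).
apply: (le_trans (n2D2 (L2'_cmb (-1) (hu_ n) hu) hu)); lra.
Qed.

Lemma L2cvg_ip (u_ v_ : nat -> H -> R[i]) u v :
  L2' u -> L2' v -> (forall n, L2' (u_ n)) -> (forall n, L2' (v_ n)) ->
  L2cvg u_ u -> L2cvg v_ v -> ip (u_ n) (v_ n) @[n --> \oo] --> ip u v.
Proof.
move=> hu hv hu_ hv_ cu cv; apply/subr_cvg0.
have [B [N hB]] := L2cvg_bounded hv hv_ cv.
have E n : ip (u_ n) (v_ n) - ip u v =
    ip (cmb (u_ n) (-1) u) (v_ n) + ip u (cmb (v_ n) (-1) v).
  by rewrite ip_cmbl // ip_cmbr //; ring.
rewrite (funext E) -[X in _ --> X]addr0; apply: cvgD.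
  apply: (@cvg0_sq (fun n => n2 (cmb (u_ n) (-1) u) * B) _ N).
    move=> n Nn; apply: le_trans (ip_CS (L2'_cmb (-1) (hu_ n) hu) (hv_ n)) _.
    by apply: ler_wpM2l; [exact: n2_ge0|exact: hB].
  by rewrite -(mul0r B); apply: cvgM; [exact: cu|exact: cvg_cst].
apply: (@cvg0_sq (fun n => n2 u * n2 (cmb (v_ n) (-1) v)) _ 0).
  by move=> n _; exact: ip_CS hu (L2'_cmb (-1) (hv_ n) hv).
by rewrite -(mulr0 (n2 u)); apply: cvgM; [exact: cvg_cst|exact: cv].
Qed.

(** Expand s |u - v/s|^2 >= 0. *)
Lemma ip_amgm u v (s : R) : 0 < s -> L2' u -> L2' v -> 2 * ip u v <= s * n2 u + s^-1 * n2 v.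
Proof.
move=> s0 hu hv; have := n2_ge0 (cmb u (- s^-1) v); rewrite n2_cmb // => h.
have : 0 <= s * (n2 u + 2 * - s^-1 * ip u v + (- s^-1) ^+ 2 * n2 v) by rewrite mulr_ge0 // ltW.
rewrite (_ : s * _ = s * n2 u - 2 * ip u v + s^-1 * n2 v); first by lra.
by field; rewrite gt_eqF.
Qed.

Context (A : one_form R) (sA : smooth_form A).
Local Notation q := (qf A).

Definition dq u v := q (cmb u (-1) v) (cmb u (-1) v).

(** [form_approx] rewritten with real numbers: the extended-real norm becomes [n2], and the limit
    over pairs of indices becomes an eps-N condition. *)
Definition approx (u_ : nat -> H -> R[i]) u := [/\ L2' u, forall n, test_function (u_ n), L2cvg u_ u &
  forall eps, 0 < eps -> exists N : nat, forall n m, (N <= n)%N -> (N <= m)%N ->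
    dq (u_ n) (u_ m) < eps].

Lemma approxP (u_ : nat -> H -> R[i]) u : form_approx A u_ u <-> approx u_ u.
Proof.
have sq (x_ : nat -> H -> R[i]) x : (forall n, L2' (cmb (x_ n) (-1) x)) ->
    L2norm (x_ n \- x) @[n --> \oo] --> 0%E <-> L2cvg x_ x.
  move=> hx.
  rewrite (_ : (fun n => _) = (fun n => (Num.sqrt (n2 (cmb (x_ n) (-1) x)))%:E)); last first.
    by apply/funext => n; rewrite subE L2norm_n2.
  split=> [/fine_cvg /= h|h].
    rewrite /L2cvg (_ : (fun n => _) = (fun n => Num.sqrt (n2 (cmb (x_ n) (-1) x)) * Num.sqrt (n2 (cmb (x_ n) (-1) x)))).
      by rewrite -(mulr0 (0 : R)); apply: cvgM.
    by apply/funext => n; rewrite -expr2 sqr_sqrtr // n2_ge0.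
  apply: cvg_EFin; first exact: nearW.
  rewrite -(@sqrtr0 R); apply: (@continuous_cvg _ _ _ _ _ _ Num.sqrt) => //; exact: sqrt_continuous.
split=> [[/L2P hu tu c1 c2]|[hu tu c1 c2]].
  have hu_ n := tf_L2' (tu n); split=> //; first by apply/sq => // n; exact: L2'_cmb.
  move=> eps e0; move/cvgrPdist_lt : c2 => /(_ _ e0)[[P Q] [/= [N1 _ h1] [N2 _ h2]] hPQ].
  exists (maxn N1 N2) => n m; rewrite !geq_max => /andP[n1 n2] /andP[m1 m2].
  have := hPQ (n, m) (conj (h1 _ n1) (h2 _ m2)).
  rewrite /= sub0r normrN subE (mag_quadE sA (tf_cmb (-1) (tu n) (tu m))).
  by rewrite ger0_norm // qf_ge0.
have hu_ n := tf_L2' (tu n); split=> //; first exact/L2P.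
  by apply/sq => // n; exact: L2'_cmb.
apply/cvgrPdist_lt => eps e0; have [N hN] := c2 _ e0.
exists ([set n | (N <= n)%N], [set n | (N <= n)%N]); first by split; exists N.
move=> [n m] [/= Nn Nm]; rewrite sub0r normrN subE (mag_quadE sA (tf_cmb (-1) (tu n) (tu m))).
by rewrite ger0_norm ?qf_ge0 //; exact: hN.
Qed.

Lemma qf_CS u v : test_function u -> test_function v -> q u v ^+ 2 <= q u u * q v v.
Proof.
by move=> tu tv; apply: quad_disc => t; have := qf_ge0 A (cmb u t v); rewrite qf_cmb.
Qed.

Lemma qfD2 u v : test_function u -> test_function v ->
  q (cmb u 1 v) (cmb u 1 v) <= 2 * q u u + 2 * q v v.
Proof.
move=> tu tv; have := qf_ge0 A (cmb u (-1) v).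
rewrite (qf_cmb sA 1 tu tv) (qf_cmb sA (-1) tu tv) expr1n sqrrN expr1n.
by move: (q u u) (q u v) (q v v) => a b c; lra.
Qed.

Lemma qfB2 u v : test_function u -> test_function v -> dq u v <= 2 * q u u + 2 * q v v.
Proof.
move=> tu tv; have := qf_ge0 A (cmb u 1 v).
rewrite /dq (qf_cmb sA 1 tu tv) (qf_cmb sA (-1) tu tv) expr1n sqrrN expr1n.
by move: (q u u) (q u v) (q v v) => a b c; lra.
Qed.

Lemma approx_bounded (u_ : nat -> H -> R[i]) u : approx u_ u ->
  exists B N, forall n, (N <= n)%N -> q (u_ n) (u_ n) <= B.
Proof.
move=> [_ tu _ /(_ 1 ltr01)[N hN]]; exists (2 * 1 + 2 * q (u_ N) (u_ N)), N => n Nn.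
have := hN n N Nn (leqnn N); rewrite /dq.
have tc := tf_cmb (-1) (tu n) (tu N); set w := cmb (u_ n) _ _ in tc * => h.
have := qfD2 tc (tu N); rewrite {1 2}/w cmb_id.
by move: (q w w) (q (u_ n) (u_ n)) (q (u_ N) (u_ N)) h => x y z; lra.
Qed.

(* The form is closable: q(w_n, w_m) = -<w_n, L w_m> tends to 0 for fixed m. *)
Lemma approx_closable (u_ v_ : nat -> H -> R[i]) u : approx u_ u -> approx v_ u ->
  dq (u_ n) (v_ n) @[n --> \oo] --> (0 : R).
Proof.
move=> [hu tu cu qu] [_ tv cv qv].
have hu_ n := tf_L2' (tu n); have hv_ n := tf_L2' (tv n).
pose w n := cmb (u_ n) (-1) (v_ n).
have tw n : test_function (w n) by exact: tf_cmb.
have cw : n2 (w n) @[n --> \oo] --> (0 : R).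
  apply: (@cvg0_le (fun n => 2 * n2 (cmb (u_ n) (-1) u) + 2 * n2 (cmb (v_ n) (-1) u)) _ 0).
    move=> n _; rewrite ger0_norm ?n2_ge0 //.
    rewrite (_ : w n = cmb (cmb (u_ n) (-1) u) (-1) (cmb (v_ n) (-1) u)).
      by apply: n2B2; exact: L2'_cmb.
    by rewrite cmbBB; apply/funext => p; apply: complexP; rewrite !(Re_cmb, Im_cmb); ring.
  rewrite -(addr0 (0 : R)) -{1 2}(mulr0 (2 : R)).
  by apply: cvgD; apply: cvgM; (exact: cvg_cst || assumption).
apply/cvgrPdist_lt => eps e0; rewrite /dq.
have e6 : 0 < eps / 6 by rewrite divr_gt0.
have [N1 h1] := qu _ e6; have [N2 h2] := qv _ e6.
pose m := maxn N1 N2.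
pose K := n2 (lapl A (w m)).
have K0 : 0 <= K by exact: n2_ge0.
(* The weight for [ip_amgm]: it gives s^-1 K <= eps/6 whatever K is, and [N3] is then chosen so that
   s |w_n|^2 <= eps/6. *)
pose s := 6 * (K + 1) / eps.
have s0 : 0 < s by rewrite divr_gt0 // mulr_gt0 // ltr_wpDl.
have [N3 h3] := cvg0_lt (divr_gt0 e6 s0) cw.
exists (maxn m N3) => // n /=; rewrite geq_max => /andP[mn n3].
rewrite sub0r normrN ger0_norm ?qf_ge0 // -/(w n).
have [tn tm] := (tw n, tw m).
have nm : q (cmb (w n) (-1) (w m)) (cmb (w n) (-1) (w m)) < 2 / 3 * eps.
  have E : cmb (w n) (-1) (w m) = cmb (cmb (u_ n) (-1) (u_ m)) (-1) (cmb (v_ n) (-1) (v_ m)).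
    by rewrite /w cmbBB.
  have ta := tf_cmb (-1) (tu n) (tu m); have tb := tf_cmb (-1) (tv n) (tv m).
  have := h1 n m (leq_trans (leq_maxl _ _) mn) (leq_maxl _ _).
  have := h2 n m (leq_trans (leq_maxr _ _) mn) (leq_maxr _ _).
  rewrite E /dq; set a := cmb (u_ n) _ _ in ta *; set b := cmb (v_ n) _ _ in tb *.
  have := qfB2 ta tb; rewrite /dq.
  by move: (q a a) (q b b) (q (cmb a (-1) b) (cmb a (-1) b)) => x y z; lra.
have := h3 n n3; rewrite ger0_norm ?n2_ge0 // => hn.
have amgm : 2 * q (w n) (w m) <= eps / 3.
  have tl := tf_lapl sA tm; have tl' := tf_cmb (-1) (tf0 (R := R)) tl.
  have -> : q (w n) (w m) = ip (w n) (cmb (fun=> 0) (-1) (lapl A (w m))).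
    rewrite qf_lapl // ip_cmbr; [|exact/tf_L2'/tf0|exact: tf_L2'|exact: tf_L2'].
    rewrite (_ : ip (w n) (fun=> 0) = 0) ?add0r ?mulN1r //.
    rewrite /ip (_ : ipf _ _ = fun=> 0); first by rewrite Rintegral_cst ?mul0r.
    by apply/funext => p; rewrite /ipf /= !mulr0 addr0.
  apply: le_trans (ip_amgm s0 (tf_L2' tn) (tf_L2' tl')) _.
  have -> : n2 (cmb (fun=> 0) (-1) (lapl A (w m))) = K.
    by rewrite /K /n2 /ip; apply: eq_Rintegral => p _; rewrite /ipf !Re_cmb !Im_cmb /=; ring.
  have : s * n2 (w n) <= eps / 6 by rewrite mulrC -ler_pdivlMr // ltW.
  have : s^-1 * K <= eps / 6.
    rewrite /s invf_div mulrAC ler_pdivrMr ?mulr_gt0 ?ltr_wpDl //.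
    by rewrite (_ : eps / 6 * _ = eps * K + eps) ?lerDl ?ltW //; field.
  by lra.
(* In q(w_n) = q(w_n - w_m) + 2 q(w_n, w_m) - q(w_m) the three terms are bounded by 2 eps/3, eps/3
   and 0. *)
have := qf_ge0 A (w m); move: nm amgm; rewrite (qf_cmb sA (-1) tn tm) sqrrN expr1n.
by move: (q (w n) (w n)) (q (w n) (w m)) (q (w m) (w m)) => x y z; lra.
Qed.

End approximation.

(** * The bottom of the spectrum *)

Section spectral.
Context {R : realType}.
Local Notation H := (heis R).
Local Notation mu := (@heis_measure R).
Implicit Types (u v w : H -> R[i]).
Local Notation Re := complex.Re.
Context (A : one_form R) (sA : smooth_form A).
Local Notation q := (qf A).

(** q(u, v) - q(u', v') = q(u - u', v) + q(u', v - v'). In each term Cauchy-Schwarz pairs a factor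
    that vanishes by closability with a bounded one. The closed form therefore does not depend on
    the approximating sequences. *)
Lemma approx_form_lim (u_ u'_ v_ v'_ : nat -> H -> R[i]) u v :
  approx A u_ u -> approx A u'_ u -> approx A v_ v -> approx A v'_ v ->
  q (u_ n) (v_ n) - q (u'_ n) (v'_ n) @[n --> \oo] --> (0 : R).
Proof.
move=> au au' av av'.
have cu := approx_closable sA au au'; have cv := approx_closable sA av av'.
have [_ tu _ _] := au; have [_ tu' _ _] := au'.
have [_ tv _ _] := av; have [_ tv' _ _] := av'.
have [B [N hB]] := approx_bounded sA av; have [C [N' hC]] := approx_bounded sA au'.
have E n : q (u_ n) (v_ n) - q (u'_ n) (v'_ n) =
    q (cmb (u_ n) (-1) (u'_ n)) (v_ n) + q (u'_ n) (cmb (v_ n) (-1) (v'_ n)).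
  rewrite (qf_cmbl sA (-1) (tu n) (tu' n) (tv n)) (qf_cmbr sA (-1) (tv n) (tv' n) (tu' n)).
  by move: (q (u_ n) (v_ n)) (q (u'_ n) (v'_ n)) (q (u'_ n) (v_ n)) => x y z; ring.
rewrite (funext E) -[X in _ --> X]addr0; apply: cvgD.
  apply: (@cvg0_sq _ (fun n => dq A (u_ n) (u'_ n) * B) _ N).
    move=> n Nn; apply: le_trans (qf_CS sA (tf_cmb (-1) (tu n) (tu' n)) (tv n)) _.
    by apply: ler_wpM2l; [exact: qf_ge0|exact: hB].
  by rewrite -(mul0r B); apply: cvgM; [exact: cu|exact: cvg_cst].
apply: (@cvg0_sq _ (fun n => C * dq A (v_ n) (v'_ n)) _ N').
  move=> n Nn; apply: le_trans (qf_CS sA (tu' n) (tf_cmb (-1) (tv n) (tv' n))) _.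
  by apply: ler_wpM2r; [exact: qf_ge0|exact: hC].
by rewrite -(mulr0 C); apply: cvgM; [exact: cvg_cst|exact: cv].
Qed.

(** [closed_form] only provides some pair of sequences; here the value is recovered along any
    prescribed pair. *)
Lemma closed_form_lim u v (u_ v_ : nat -> H -> R[i]) l : approx A u_ u -> approx A v_ v ->
  closed_form A u v l -> q (u_ n) (v_ n) @[n --> \oo] --> Re l.
Proof.
move=> au av [u'_ [v'_ [/(approxP sA) au' /(approxP sA) av' cr _]]].
have [_ tu' _ _] := au'; have [_ tv' _ _] := av'.
have E n : q (u_ n) (v_ n) = (q (u_ n) (v_ n) - q (u'_ n) (v'_ n)) + Re (mag_sesq A (u'_ n) (v'_ n)).
  by rewrite Re_mag_sesq // subrK.
rewrite (funext E) -[Re l]add0r; apply: cvgD; last exact: cr.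
exact: approx_form_lim au au' av av'.
Qed.

Lemma L2cvg_cst u : L2' u -> L2cvg (fun=> u) u.
Proof.
move=> hu; apply: (@cvg0_le _ (fun=> 0 : R) _ 0) => [n _|]; last exact: cvg_cst.
rewrite n2_cmb // /n2 (_ : _ + _ = 0) ?normr0 //.
by move: (ip u u) => x; ring.
Qed.

Lemma approx_cst u : test_function u -> approx A (fun=> u) u.
Proof.
move=> tu; have hu := tf_L2' tu; split=> //.
  exact: L2cvg_cst.
move=> eps e0; exists 0%N => n m _ _; rewrite /dq (qf_cmb sA (-1) tu tu).
by rewrite (_ : _ + _ = 0) //; move: (q u u) => x; ring.
Qed.

(** Multiplication by i is unitary and commutes with the covariant derivatives. It reduces the
    imaginary part of the form identity for v to the real part for i v. *)
Lemma approx_imul (u_ : nat -> H -> R[i]) u : approx A u_ u ->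
  approx A (fun n => imul (u_ n)) (imul u).
Proof.
move=> [hu tu cu qu].
have imul_cmb x r y : cmb (imul x) r (imul y) = imul (cmb x r y) :> (H -> R[i]).
  by apply/funext => p; apply: complexP;
     rewrite ?(Re_cmb, Im_cmb) ?(Re_imul, Im_imul) ?(Re_cmb, Im_cmb); ring.
have ipi x y : ip (imul x) (imul y) = ip x y.
  by apply: eq_Rintegral => p _; rewrite /ipf !Re_imul !Im_imul; ring.
split; [exact: L2'_imul|by move=> n; exact: tf_imul| |].
  rewrite /L2cvg (_ : (fun n => _) = (fun n => n2 (cmb (u_ n) (-1) u))) //.
  by apply/funext => n; rewrite imul_cmb /n2 ipi.
move=> eps /qu[N hN]; exists N => n m Nn Nm; have := hN n m Nn Nm.
rewrite /dq /qf imul_cmb; have tc := tf_cmb (-1) (tu n) (tu m).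
by rewrite (covX_imul A tc) (covY_imul A tc) !ipi.
Qed.

(** The real part of the form of -Delta_A - t. It is coercive for t < m ([af_ge]) and still
    non-negative for t = m, where [bottom_in_spectrum] uses it. *)
Definition af (t : R) u v := q u v - t * ip u v.

Lemma af_cmb t u r v : test_function u -> test_function v ->
  af t (cmb u r v) (cmb u r v) = af t u u + 2 * r * af t u v + r ^+ 2 * af t v v.
Proof.
move=> tu tv; rewrite /af (qf_cmb sA r tu tv).
have := n2_cmb r (tf_L2' tu) (tf_L2' tv); rewrite /n2 => ->.
by move: (q u u) (q u v) (q v v) (ip u u) (ip u v) (ip v v) => a b c d e f; ring.
Qed.

Lemma af_CS t u v : (forall w, test_function w -> 0 <= af t w w) ->
  test_function u -> test_function v -> af t u v ^+ 2 <= af t u u * af t v v.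
Proof.
move=> a0 tu tv; apply: quad_disc => s; have := a0 _ (tf_cmb s tu tv).
by rewrite (af_cmb t s tu tv).
Qed.

Context (m : R) (hm : forall w, test_function w -> m * n2 w <= q w w).

Lemma af_ge t w : test_function w -> (m - t) * n2 w <= af t w w.
Proof. by move=> tw; have := hm tw; rewrite /af /n2; lra. Qed.

(** If J(u_n) is within 16^-n of inf J, then J(u_n + s w) >= inf J says that 16^-n + 2 s (a(u_n, w)
    - <g, w>) + s^2 a(w, w) is non-negative for every s. The discriminant of this polynomial is the
    Euler equation up to an error. The rate 16^-n is the one that [L2'_complete] takes. *)
Lemma minimizing_sequence (t : R) g : t < m -> L2' g -> exists u_ : nat -> H -> R[i],
  (forall n, test_function (u_ n)) /\
  forall n w, test_function w -> (af t (u_ n) w - ip g w) ^+ 2 <= 16^-1 ^+ n * af t w w.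
Proof.
move=> tm hg; pose J u := af t u u - 2 * ip g u.
pose S := [set J u | u in @test_function R].
have d0 : 0 < m - t by rewrite subr_gt0.
have Jlb u : test_function u -> - ((m - t)^-1 * n2 g) <= J u.
  move=> tu; have h1 := af_ge t tu; have h2 := ip_amgm d0 (tf_L2' tu) hg.
  by rewrite /J (ipC g); move: h1 h2; move: (af t u u) (n2 u) (ip u g) (n2 g) => a b c e; lra.
have infS : has_inf S.
  split; first by exists (J (fun=> 0)); exists (fun=> 0) => //; exact: tf0.
  by exists (- ((m - t)^-1 * n2 g)) => _ [u tu <-]; exact: Jlb.
have e0 n : 0 < 16^-1 ^+ n :> R by rewrite exprn_gt0.
have ex n : exists u, test_function u /\ J u < inf S + 16^-1 ^+ n.
  by have [_ [u tu <-] h] := inf_adherent (e0 n) infS; exists u.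
have [u_ hu] := choice ex; exists u_; split=> [n|n w tw]; first by case: (hu n).
have [tu Ju] := hu n; apply: quad_disc => s.
have tc := tf_cmb s tu tw.
have : inf S <= J (cmb (u_ n) s w) by apply: ge_inf; [case: infS|exists (cmb (u_ n) s w)].
have -> : J (cmb (u_ n) s w) = J (u_ n) + 2 * s * (af t (u_ n) w - ip g w) + s ^+ 2 * af t w w.
  rewrite /J (af_cmb t s tu tw) (ip_cmbr s (tf_L2' tu) (tf_L2' tw) hg).
  by move: (af t _ _) (af t _ _) (af t _ _) (ip g _) (ip g _) => a b c d e; ring.
by move: Ju; move: (J (u_ n)) (inf S) => a b; lra.
Qed.

(** With w = u_n - u_k, the value a(w, w) is the difference of the residuals of the Euler equation
    at n and at k. Hence the minimizing sequence is Cauchy for a, then in L^2 by coercivity and for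
    q = a + t <.,.>. In the limit q(u, v) = <g + t u, v>, which dictates f = g + t u. *)
Lemma resolvent_surj (t : R) g : t < m -> L2 g -> exists u f, magnetic_laplacian A u f /\
  {ae mu, forall p, f p - t%:C * u p = g p}.
Proof.
move=> tm /L2P hg; have [u_ [tu hu]] := minimizing_sequence tm hg.
have d0 : 0 < m - t by rewrite subr_gt0.
have e0 n : 0 < 16^-1 ^+ n :> R by rewrite exprn_gt0.
have hu_ n := tf_L2' (tu n).
have cau n k : af t (cmb (u_ n) (-1) (u_ k)) (cmb (u_ n) (-1) (u_ k)) <= 2 * (16^-1 ^+ n + 16^-1 ^+ k).
  have tw := tf_cmb (-1) (tu n) (tu k); move: (hu n _ tw) (hu k _ tw).
  set w := cmb (u_ n) _ _ in tw *.
  have -> : af t w w = (af t (u_ n) w - ip g w) - (af t (u_ k) w - ip g w).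
    rewrite {1}/w /af (qf_cmbl sA (-1) (tu n) (tu k) tw) (ip_cmbl (-1) (hu_ n) (hu_ k) (tf_L2' tw)).
    by move: (q _ _) (q _ _) (ip (u_ n) w) (ip (u_ k) w) (ip g w) => a b c d e; ring.
  (* The weight 1/4 makes the two residuals together absorb only half of a(w, w). *)
  have bd (B e a : R) : 0 < e -> B ^+ 2 <= e * a -> `|B| <= e + a / 4.
    move=> e_0 h; have a_0 : 0 <= a by rewrite -(pmulr_rge0 _ e_0); apply: le_trans h; exact: sqr_ge0.
    rewrite -ler_sqr ?nnegrE ?addr_ge0 ?divr_ge0 // ?(ltW e_0) // real_normK ?num_real //.
    by apply: le_trans h _; have : 0 <= (e - a / 4) ^+ 2 := sqr_ge0 _; lra.
  move: (af t (u_ n) w - ip g w) (af t (u_ k) w - ip g w) (e0 n) (e0 k) => B1 B2 en ek.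
  move=> /(bd _ _ _ en) b1 /(bd _ _ _ ek) b2.
  by have := ler_norm B1; have := ler_norm (- B2); rewrite normrN; lra.
have cauN n k : n2 (cmb (u_ n) (-1) (u_ k)) <= 2 / (m - t) * (16^-1 ^+ n + 16^-1 ^+ k).
  rewrite mulrAC ler_pdivlMr // mulrC.
  by apply: le_trans (cau n k); exact: (af_ge t (tf_cmb (-1) (tu n) (tu k))).
have [|u hL2u cu] := @L2'_complete R u_ (4 / (m - t)) hu_.
  move=> n; apply: le_trans (cauN _ _) _.
  rewrite exprS (_ : 4 / (m - t) = 2 / (m - t) * 2); last by field; rewrite gt_eqF.
  rewrite -[X in _ <= X]mulrA; apply: ler_wpM2l; first by rewrite divr_ge0 // ltW.
  by have := e0 n; move: (16^-1 ^+ n) => x; lra.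
have cvu : L2cvg u_ u.
  apply: (@cvg0_le _ (fun n => geometric (16 * (4 / (m - t))) 4^-1 n) _ 0).
    by move=> n _; rewrite ger0_norm ?n2_ge0.
  by apply: cvg_geometric; rewrite ger0_norm // invf_lt1 // ltr1n.
have e_cvg : (16^-1 ^+ n : R) @[n --> \oo] --> (0 : R).
  rewrite (_ : (fun n => _) = geometric 1 16^-1); last by apply/funext => n; rewrite /= mul1r.
  by apply: cvg_geometric; rewrite ger0_norm // invf_lt1 // ltr1n.
have au : approx A u_ u.
  split=> // eps eps0.
  pose K := 2 * (1 + `|t| / (m - t)).
  have K0 : 0 < K by rewrite mulr_gt0 // ltr_pwDl // divr_ge0 // ltW.
  have eK : 0 < eps / K / 2 by rewrite !divr_gt0.
  have [N hN] := cvg0_lt eK e_cvg.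
  exists N => n k /hN + /hN; rewrite !ger0_norm ?(ltW (e0 _)) // => en ek.
  have : dq A (u_ n) (u_ k) <= K * (16^-1 ^+ n + 16^-1 ^+ k).
    have := cau n k; have := cauN n k; rewrite /af /dq -/(n2 _).
    have := n2_ge0 (cmb (u_ n) (-1) (u_ k)).
    move: (q _ _) (n2 _) (e0 n) (e0 k); move: (16^-1 ^+ n) (16^-1 ^+ k) => x y Q N2 x0 y0 h0 h1 h2.
    have : t * N2 <= `|t| * (2 / (m - t) * (x + y)).
      by apply: (@le_trans _ _ (`|t| * N2)); [rewrite ler_wpM2r // ler_norm|rewrite ler_wpM2l].
    rewrite /K (_ : 2 * (1 + `|t| / (m - t)) * (x + y) = 2 * (x + y) + `|t| * (2 / (m - t) * (x + y))); last first.
      by field; rewrite gt_eqF.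
    by lra.
  move=> h; apply: le_lt_trans h _; rewrite mulrC -ltr_pdivlMr //.
  by rewrite [eps / K]splitr; exact: ltrD.
pose f := cmb g t u.
have hf : L2' f by exact: L2'_cmb.
have key v (v_ : nat -> H -> R[i]) : approx A v_ v -> q (u_ n) (v_ n) @[n --> \oo] --> ip f v.
  move=> av; have [hv tv cv _] := av; have hv_ n := tf_L2' (tv n).
  have c1 := L2cvg_ip hL2u hv hu_ hv_ cvu cv.
  have cstg := L2cvg_cst hg.
  have c2 := L2cvg_ip hg hv (fun=> hg) hv_ cstg cv.
  have c3 : af t (u_ n) (v_ n) - ip g (v_ n) @[n --> \oo] --> (0 : R).
    have [B [N hB]] := approx_bounded sA av; have [C [N' hC]] := L2cvg_bounded hv hv_ cv.
    apply: (@cvg0_sq _ (fun n => 16^-1 ^+ n * (B + `|t| * C)) _ (maxn N N')).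
      move=> n; rewrite geq_max => /andP[n1 n2_]; apply: le_trans (hu n _ (tv n)) _.
      apply: ler_wpM2l; first exact: ltW.
      rewrite /af; apply: lerD; first exact: hB.
      rewrite -mulNr; apply: (@le_trans _ _ (`|t| * n2 (v_ n))).
        by rewrite ler_wpM2r ?n2_ge0 // -normrN ler_norm.
      by rewrite ler_wpM2l // hC.
    by rewrite -(mul0r (B + `|t| * C)); apply: cvgM; [exact: e_cvg|exact: cvg_cst].
  have E n : q (u_ n) (v_ n) =
      (af t (u_ n) (v_ n) - ip g (v_ n)) + (ip g (v_ n) + t * ip (u_ n) (v_ n)).
    by rewrite /af; move: (q _ _) (ip _ _) (ip _ _) => a b c; ring.
  rewrite /f (ip_cmbl t hg hL2u hv) (funext E) -[ip g v + _]add0r.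
  apply: cvgD; first exact: c3.
  by apply: cvgD; [exact: c2|apply: cvgM; [exact: cvg_cst|exact: c1]].
exists u, f; split.
  split; [by exists u_; apply/approxP|exact/L2P|].
  move=> v [v_ /(approxP sA) av]; exists u_, v_; have [_ tv _ _] := av.
  split; [exact/approxP|exact/approxP| |].
    rewrite Re_inner (_ : (fun n => _) = (fun n => q (u_ n) (v_ n))); first exact: key.
    by apply/funext => n; rewrite Re_mag_sesq.
  (* The imaginary part is the real part tested against i v. *)
  rewrite Im_inner (_ : (fun n => _) = (fun n => q (u_ n) (imul (v_ n)))).
    exact: (key _ _ (approx_imul av)).
  by apply/funext => n; rewrite Im_mag_sesq.
apply: aeW => p; apply: complexP; rewrite !ReImE /f ?Re_cmb ?Im_cmb /=; ring.
Qed.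

End spectral.

Section bottom.
Context {R : realType}.
Local Notation H := (heis R).
Local Notation M := (heisM R).
Local Notation mu := (@heis_measure R).
Implicit Types (u v w : H -> R[i]).
Context (A : one_form R) (sA : smooth_form A).
Local Notation q := (qf A).
Context (m : R) (hm : forall w, test_function w -> m * n2 w <= q w w).

Lemma shiftE (f u : H -> R[i]) (t : R) : (fun p => f p - t%:C * u p) = cmb f (- t) u.
Proof.
by apply/funext => p; apply: complexP; rewrite !ReImE ?Re_cmb ?Im_cmb /=; ring.
Qed.

(** The equation tested with v = u, brought back to test functions, since the lower bound by m is
    known only there. *)
Lemma laplacian_ip u f : magnetic_laplacian A u f -> exists u_ : nat -> H -> R[i], approx A u_ u /\
  [/\ L2' u, L2' f & q (u_ n) (u_ n) @[n --> \oo] --> ip f u].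
Proof.
move=> [[u_ /(approxP sA) au] /L2P hf cfv]; exists u_; split=> //.
have [hu _ _ _] := au; split=> //.
have cf : closed_form A u u (inner f u) by apply: cfv; exists u_; exact/(approxP sA).
by have := closed_form_lim sA au au cf; rewrite Re_inner.
Qed.

Lemma ip_le_sqrt u v : L2' u -> L2' v -> ip u v <= Num.sqrt (n2 u) * Num.sqrt (n2 v).
Proof.
move=> hu hv; rewrite -sqrtrM ?n2_ge0 //; apply: le_trans (ler_norm _) _.
by rewrite -sqrtr_sqr; apply: ler_wsqrtr; exact: ip_CS.
Qed.

(** (m - t) |u|^2 <= <f - t u, u> <= |f - t u| |u|. *)
Lemma resolvent_bound (t : R) u f : t < m -> magnetic_laplacian A u f ->
  (L2norm u <= (m - t)^-1%:E * L2norm (fun p => f p - t%:C * u p)%R)%E.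
Proof.
move=> tm /laplacian_ip[u_ [au [hu hf cq]]].
have d0 : 0 < m - t by rewrite subr_gt0.
have [_ tu cu _] := au; have hu_ n := tf_L2' (tu n).
rewrite shiftE; have hh := L2'_cmb (- t) hf hu; set h := cmb f _ u in hh *.
rewrite !L2norm_n2 // -EFinM lee_fin.
have cn := L2cvg_ip hu hu hu_ hu_ cu cu.
have lim_le : m * n2 u <= ip f u.
  apply: (ler_cvg_to (cvgM (cvg_cst m) cn) cq).
  by apply: nearW => n; exact: hm.
have key : (m - t) * n2 u <= ip h u.
  by rewrite /h ip_cmbl // -/(n2 u); move: (ip f u) (n2 u) lim_le => a b; lra.
have := ip_CS hh hu; have n0 := n2_ge0 u; have h0 := n2_ge0 h => CS.
rewrite ler_pdivlMl //.
have := sqrtr_ge0 (n2 u); rewrite le_eqVlt => /predU1P[<-|s0].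
  by rewrite mulr0 sqrtr_ge0.
rewrite -(ler_pM2r s0); have := ip_le_sqrt hh hu.
by rewrite -mulrA -expr2 sqr_sqrtr //; apply: le_trans.
Qed.

Lemma ip_ae u u' v : L2' u -> L2' u' -> L2' v -> {ae mu, forall p, u p = u' p} -> ip u v = ip u' v.
Proof.
move=> hu hu' hv uu'; rewrite /ip /Rintegral; congr fine.
have mI x : L2' x -> measurable_fun [set: M] (EFin \o ipf x v).
  move=> [a b _]; have [c d _] := hv; apply/measurable_EFinP.
  exact: (ipf_measurable a b c d).
apply: ae_eq_integral => //; [exact: mI hu|exact: mI hu'|].
case: uu' => N [mN N0 sub]; exists N; split=> // p /= h; apply: sub => /= E; apply: h => _.
by rewrite /ipf E.
Qed.

Lemma bottom_in_spectrum : (forall eps, 0 < eps -> exists w, [/\ test_function w, 0 < n2 w &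
    q w w < (m + eps) * n2 w]) ->
  spectrum (magnetic_laplacian A) m%:C.
Proof.
move=> hmin [surj [C hC]].
(* The given bound C may fail to be positive. With C' >= 1 and w chosen for eps = 1/(2 C'), the
   final chain of inequalities reads |w|^4 <= |w|^4 / 2. *)
pose C' := Num.max C 1.
have C0 : 0 < C' by rewrite lt_max ltr01 orbT.
have [|w [tw w0 qw]] := hmin ((C')^-1 / 2); first by rewrite divr_gt0 // invr_gt0.
have hw := tf_L2' tw.
have [u [f [Tuf ae]]] := surj w ((L2P _).2 hw).
have bound := hC _ _ Tuf.
have [u_ [au [hu hf cq]]] := laplacian_ip Tuf.
have [_ tu cu _] := au; have hu_ n := tf_L2' (tu n).
have hh := L2'_cmb (- m) hf hu.
have a0 x : test_function x -> 0 <= af A m x x.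
  by move=> tx; have := af_ge hm m tx; rewrite subrr mul0r.
have hE v : L2' v -> ip (cmb f (- m) u) v = ip w v.
  by move=> hv; apply: ip_ae => //; rewrite -shiftE.
have cuw : q (u_ n) w @[n --> \oo] --> ip f w.
  have aw := approx_cst sA tw.
  have fw : form_domain A w by exists (fun=> w); exact/(approxP sA).
  have [_ _ /(_ w fw) cf] := Tuf.
  by have := closed_form_lim sA au aw cf; rewrite Re_inner.
have c1 : af A m (u_ n) w @[n --> \oo] --> n2 w.
  rewrite /n2 -hE // ip_cmbl // mulNr; apply: cvgB => //.
  apply: cvgM; first exact: cvg_cst.
  exact: (L2cvg_ip hu hw hu_ (fun=> hw) cu (L2cvg_cst hw)).
have c2 : af A m (u_ n) (u_ n) @[n --> \oo] --> ip w u.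
  rewrite -hE // ip_cmbl // mulNr; apply: cvgB => //.
  apply: cvgM; first exact: cvg_cst.
  exact: (L2cvg_ip hu hu hu_ hu_ cu cu).
(* The solution [u] is only in the form domain: Cauchy-Schwarz for a is applied to the test
   functions u_n and then passed to the limit. *)
have le1 : n2 w * n2 w <= ip w u * af A m w w.
  apply: (ler_cvg_to (cvgM c1 c1) (cvgM c2 (cvg_cst (af A m w w)))).
  apply: nearW => n; have := af_CS sA a0 (tu n) tw.
  by rewrite expr2.
have n2h : n2 (cmb f (- m) u) = n2 w by rewrite /n2 hE // ipC hE.
move: bound; rewrite shiftE !L2norm_n2 // n2h -EFinM lee_fin => bound.
have le2 : ip w u <= C' * n2 w.
  apply: le_trans (ip_le_sqrt hw hu) _.
  rewrite -[X in C' * X]sqr_sqrtr ?n2_ge0 // expr2 mulrCA.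
  apply: ler_wpM2l; first exact: sqrtr_ge0.
  apply: le_trans bound _; apply: ler_wpM2r; first exact: sqrtr_ge0.
  by rewrite /C' le_max lexx.
have le3 : af A m w w <= (C')^-1 / 2 * n2 w by rewrite /af -/(n2 w); lra.
have : n2 w * n2 w <= (C' * n2 w) * ((C')^-1 / 2 * n2 w).
  apply: le_trans le1 _; apply: (@le_trans _ _ ((C' * n2 w) * af A m w w)).
    by apply: ler_wpM2r => //; exact: a0.
  by apply: ler_wpM2l => //; rewrite mulr_ge0 ?n2_ge0 // ltW.
rewrite (_ : _ * (_ / 2 * _) = n2 w * n2 w / 2); last by field; rewrite gt_eqF.
have : 0 < n2 w * n2 w by rewrite mulr_gt0.
by move: (n2 w * n2 w) => x; lra.
Qed.

Lemma inf_spectrum : (forall eps, 0 < eps -> exists w, [/\ test_function w, 0 < n2 w &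
    q w w < (m + eps) * n2 w]) ->
  ereal_inf [set t%:E | t in [set t : R | spectrum (magnetic_laplacian A) t%:C]] = m%:E.
Proof.
move=> hmin; apply/eqP; rewrite eq_le; apply/andP; split.
  by apply: ereal_inf_lbound; exists m => //; exact: bottom_in_spectrum.
apply: le_ereal_inf_tmp => _ [t st <-]; rewrite lee_fin leNgt; apply/negP => tm; apply: st.
split=> [g hg|]; first exact: (resolvent_surj sA hm tm hg).
by exists (m - t)^-1 => u f; exact: resolvent_bound.
Qed.

End bottom.

(** * Gauge invariance *)

Section poincare.
Context {R : realType}.
Local Notation H := (heis R).
Local Notation lam := (@lebesgue_measure R).
Implicit Types (f : H -> R) (p v : H).

Lemma dirD_cont f v : smooth f -> continuous (dirD f v).
Proof.
move=> sf; have c (e : H) : e \in [:: e_x; e_y; e_z] -> continuous ('D_e f).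
  by move=> ein; have [_ /(_ e ein)] := CkS_derive (sf 1%N); exact: Ck_continuous.
have cx := c e_x (mem_head _ _).
have cy : continuous ('D_e_y f) by apply: c; rewrite !inE eqxx ?orbT.
have cz : continuous ('D_e_z f) by apply: c; rewrite !inE eqxx ?orbT.
move=> p; apply: cvgD; first apply: cvgD.
- by apply: cvgMr; exact: cx.
- by apply: cvgMr; exact: cy.
- by apply: cvgMr; exact: cz.
Qed.

Lemma dirDZ f (t : R) v p : dirD f (t *: v) p = t * dirD f v p.
Proof.
rewrite /dirD; set a := 'D_e_x f p; set b := 'D_e_y f p; set c := 'D_e_z f p.
by rewrite /= /GRing.scale /=; ring.
Qed.

Lemma is_derive_ray f v (t : R) : smooth f ->
  is_derive t 1 (fun s : R => f (s *: v)) (dirD f v (t *: v)).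
Proof.
move=> sf; have D := is_derive_line (smooth_is_derive (0 + t *: v) v sf).
by rewrite add0r in D; under [X in is_derive _ _ X _]eq_fun do rewrite -[_ *: v]add0r.
Qed.

Lemma is_derive_scaled_line f p v (t h : R) : smooth f ->
  is_derive h 1 (fun s : R => f (t *: (p + s *: v))) (t * dirD f v (t *: (p + h *: v))).
Proof.
move=> sf.
have E (s : R) : t *: (p + s *: v) = t *: p + s *: (t *: v).
  by rewrite scalerDr !scalerA mulrC.
under [X in is_derive _ _ X _]eq_fun do rewrite E.
by rewrite E -dirDZ; apply: is_derive_line; exact: smooth_is_derive.
Qed.

Context (a : 'I_3 -> H -> R) (sa : forall i, smooth (a i)).

Definition pr (i : 'I_3) (p : H) : R :=
  match val i with 0 => p.1.1 | 1 => p.1.2 | _ => p.2 end.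

Lemma is_derive_pr i p v (h : R) : is_derive h 1 (fun s : R => pr i (p + s *: v)) (pr i v).
Proof.
apply: is_derive_line; have [d1 d2 d3] := is_derive_coord (p + h *: v) v.
by case: i => -[|[|[|j]]].
Qed.

(** The integral of the 1-form along the segment from 0 to p. *)
Definition potential (p : H) : R :=
  (\int[lam]_(t in `[0, 1]%classic) \sum_(i < 3) pr i p * a i (t *: p))%R.

Hypothesis closed_a : forall p v w,
  \sum_(i < 3) pr i v * dirD (a i) w p = \sum_(i < 3) pr i w * dirD (a i) v p.

Lemma is_derive_sum3 (V : normedModType R) (F : 'I_3 -> V -> R) (dF : 'I_3 -> R) (x v : V) :
  (forall i, is_derive x v (F i) (dF i)) ->
  is_derive x v (fun y => \sum_(i < 3) F i y) (\sum_(i < 3) dF i).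
Proof.
move=> h; have := is_derive_sum (fun i : 'I_3 => h i).
by rewrite (_ : \sum_(i < 3) F i = (fun y => \sum_(i < 3) F i y)) //;
   apply/funext => y; rewrite fct_sumE.
Qed.

Lemma cvg_sum3 (T : topologicalType) (F : 'I_3 -> T -> R) :
  (forall i, continuous (F i)) -> continuous (fun y => \sum_(i < 3) F i y).
Proof.
move=> h x.
have E y : \sum_(i < 3) F i y = F ord0 y + (F (lift ord0 ord0) y + F (lift ord0 (lift ord0 ord0)) y).
  by rewrite !big_ord_recl big_ord0 addr0.
rewrite /continuous_at E (funext E); apply: cvgD; first exact: h.
by apply: cvgD; exact: h.
Qed.

(** Differentiation under the integral gives the integrand sum_i v_i a_i(t p) + t p_i (d_v a_i)(t
    p). Closedness exchanges v and p in the second term, after which it is the derivative in t of t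
    sum_i v_i a_i(t p). *)
Lemma is_derive_potential p v : is_derive p v potential (\sum_(i < 3) pr i v * a i p).
Proof.
pose G (h t : R) : R := \sum_(i < 3) pr i (p + h *: v) * a i (t *: (p + h *: v)).
pose dG (h t : R) : R := \sum_(i < 3) (pr i v * a i (t *: (p + h *: v)) +
   pr i (p + h *: v) * (t * dirD (a i) v (t *: (p + h *: v)))).
have GdG (h t : R) : is_derive h 1 (G ^~ t) (dG h t).
  apply: is_derive_sum3 => i; apply: is_deriveMul; first exact: is_derive_pr.
  exact: is_derive_scaled_line.
have ct (f : H -> R) (q : H) : continuous f -> continuous (fun t : R => f (t *: q)).
  move=> cf t; apply: continuous_comp; last exact: cf.
  exact: scalel_continuous.
have intc (f : R -> R) : continuous f -> lam.-integrable `[0, 1]%classic (EFin \o f).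
  move=> cf; apply: continuous_compact_integrable; first exact: segment_compact.
  exact: continuous_subspaceT.
have intG h : lam.-integrable `[0, 1]%classic (EFin \o G h).
  by apply: intc; apply: cvg_sum3 => i t; apply: cvgMr; apply: ct; exact: smooth_continuous.
pose B := `|p| + `|v|.
have prB i q : `|pr i q| <= `|q|.
  have /heis_norm_le[h1 h2 h3] : `|q| <= `|q| by [].
  by case: i => -[|[|[|j]]].
have exA i : exists k : R, 0 <= k /\ forall q, `|q| <= B -> `|a i q| <= k.
  by have [k k0 hk] := continuous_bounded_box B (smooth_continuous (sa i)); exists k.
have exD i : exists k : R, 0 <= k /\ forall q, `|q| <= B -> `|dirD (a i) v q| <= k.
  by have [k k0 hk] := continuous_bounded_box B (@dirD_cont (a i) v (sa i)); exists k.
have [Ka hKa] := choice exA; have [Kd hKd] := choice exD.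
(* A constant majorant of dG, uniform for |h| <= 1 and t in [0, 1]: all points at which the
   coefficients are evaluated have norm at most B. *)
pose K := \sum_(i < 3) (`|pr i v| * Ka i + B * Kd i).
have B0 : 0 <= B by rewrite addr_ge0.
have K0 : 0 <= K.
  by apply: sumr_ge0 => i _; rewrite addr_ge0 // mulr_ge0 //; [have [] := hKa i|have [] := hKd i].
have hK h t : `|h| <= 1 -> 0 <= t <= 1 -> `|dG h t| <= K.
  move=> h1 /andP[t0 t1]; apply: le_trans (ler_norm_sum _ _ _) _; apply: ler_sum => i _.
  have b1 : `|p + h *: v| <= B.
    apply: le_trans (ler_normD _ _) _; rewrite lerD2l normrZ.
    by rewrite -[X in _ <= X]mul1r ler_wpM2r.
  have b2 : `|t *: (p + h *: v)| <= B.
    by rewrite normrZ ger0_norm // (le_trans _ b1) // ler_piMl.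
  apply: le_trans (ler_normD _ _) _; apply: lerD; rewrite normrM.
    by apply: ler_wpM2l => //; have [_] := hKa i; apply.
  apply: ler_pM => //; first by apply: le_trans b1.
  rewrite normrM ger0_norm // -[X in _ <= X]mul1r; apply: ler_pM => //.
  by have [_] := hKd i; apply.
have d1G h t : partial1of2 G h t = dG h t.
  by rewrite partial1of2E; have [_] := GdG h t.
have I0 : `]-1, 1[%classic (0 : R) by rewrite /= in_itv /= ltrN10 ltr01.
have D := @cvg_differentiation_under_integral R _ _ lam G `[0, 1]%classic
  (measurable_itv _) 0 (-1) 1 I0 (fun h _ => intG h)
  (fun h t _ _ => @ex_derive _ _ _ _ _ _ _ (GdG h t)) (fun=> K) (fun=> K0)
  (intc _ (fun=> cvg_cst K)) _.
have {D}D : h^-1 *: (potential (h *: v + p) - potential p) @[h --> 0^'] -->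
    (\int[lam]_(t in `[0, 1]%classic) dG 0 t)%R.
  rewrite (_ : (fun h => _) = fun h : R => h^-1 *:
    ((\int[lam]_(t in `[0, 1]%classic) G (h + 0)%R t) - (\int[lam]_(t in `[0, 1]%classic) G 0%R t))%R).
    rewrite (_ : (\int[lam]_(t in `[0, 1]%classic) dG 0 t)%R =
      (\int[lam]_(t in `[0, 1]%classic) partial1of2 G 0 t)%R); last first.
      by apply: eq_Rintegral => t _; rewrite d1G.
    apply: D => h t; rewrite /= !in_itv /= => /andP[h1 h2] t01; rewrite d1G; apply: hK => //.
    by rewrite ler_norml !ltW.
  apply/funext => h; congr (_ *: (_ - _)); rewrite /potential; apply: eq_Rintegral => t _; rewrite /G.
    by rewrite addr0 addrC.
  by rewrite scale0r addr0.
have E : (\int[lam]_(t in `[0, 1]%classic) dG 0 t)%R = \sum_(i < 3) pr i v * a i p.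
  pose P (t : R) := \sum_(i < 3) pr i v * (t * a i (t *: p)).
  have dP (t : R) : is_derive t 1 P (dG 0 t).
    have -> : dG 0 t = \sum_(i < 3) pr i v * (1 * a i (t *: p) + t * dirD (a i) p (t *: p)).
      rewrite /dG scale0r addr0.
      under [RHS]eq_bigr do rewrite mulrDr mul1r mulrCA.
      rewrite !big_split /=; congr (_ + _).
      under eq_bigr do rewrite mulrCA.
      by rewrite -!mulr_sumr closed_a.
    apply: is_derive_sum3 => i.
    have D1 := is_deriveMul (is_derive_id t (1 : R)) (is_derive_ray p t (sa i)).
    have D2 := is_deriveMul (is_derive_cst (pr i v) t (1 : R)) D1.
    by apply: (is_derive_eq D2); rewrite mul0r add0r.
  have cP : continuous P.
    by move=> t; apply: differentiable_continuous; apply/derivable1_diffP; have [] := dP t.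
  have cdG : continuous (dG 0).
    apply: cvg_sum3 => i t; rewrite scale0r addr0; apply: cvgD.
      by apply: cvgMr; apply: ct; exact: smooth_continuous.
    apply: cvgMr; apply: cvgM; first exact: cvg_id.
    by apply: ct; exact: dirD_cont.
  have := @continuous_FTC2 R (dG 0) P 0 1 ltr01 _ _ _.
  rewrite /Rintegral => ->.
  - rewrite -EFinB /=; have -> : P 0 = 0 by apply: big1 => i _; rewrite mul0r mulr0.
    by rewrite subr0; apply: eq_bigr => i _; rewrite scale1r mul1r.
  - exact: continuous_subspaceT.
  - split; first by move=> t _; have [] := dP t.
      by apply: cvg_at_right_filter; exact: cP.
    by apply: cvg_at_left_filter; exact: cP.
  - by move=> t _; rewrite derive1E; have [] := dP t.
rewrite -E; apply: DeriveDef; first by apply/cvg_ex; eexists; exact: D.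
by apply/cvg_lim.
Qed.

End poincare.

Section gauge.
Context {R : realType}.
Local Notation H := (heis R).

Lemma poincare (a1 a2 a3 : H -> R) : smooth a1 -> smooth a2 -> smooth a3 ->
  (forall p, 'D_e_x a2 p = 'D_e_y a1 p) -> (forall p, 'D_e_x a3 p = 'D_e_z a1 p) ->
  (forall p, 'D_e_y a3 p = 'D_e_z a2 p) ->
  exists2 phi : H -> R, smooth phi &
    forall p, [/\ 'D_e_x phi p = a1 p, 'D_e_y phi p = a2 p & 'D_e_z phi p = a3 p].
Proof.
move=> s1 s2 s3 h21 h31 h32.
pose a (i : 'I_3) := match val i with 0 => a1 | 1 => a2 | _ => a3 end.
have sa i : smooth (a i) by case: i => -[|[|[|j]]].
have E (F : 'I_3 -> R) : \sum_(i < 3) F i = F ord0 + (F (lift ord0 ord0) + F (lift ord0 (lift ord0 ord0))).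
  by rewrite !big_ord_recl big_ord0 addr0.
pose i1 : 'I_3 := lift ord0 ord0; pose i2 : 'I_3 := lift ord0 (lift ord0 ord0).
have a_0 : a ord0 = a1 by []. have a_1 : a i1 = a2 by []. have a_2 : a i2 = a3 by [].
have pr0 (q : H) : pr ord0 q = q.1.1 by []. have pr1 (q : H) : pr i1 q = q.1.2 by [].
have pr2 (q : H) : pr i2 q = q.2 by [].
have {}E (F : 'I_3 -> R) : \sum_(i < 3) F i = F ord0 + (F i1 + F i2) by exact: E.
have cl p v w : \sum_(i < 3) pr i v * dirD (a i) w p = \sum_(i < 3) pr i w * dirD (a i) v p.
  rewrite !E !pr0 !pr1 !pr2 a_0 a_1 a_2 /dirD h21 h31 h32.
  move: ('D_e_x a1 p) ('D_e_y a1 p) ('D_e_z a1 p) ('D_e_y a2 p) ('D_e_z a2 p) ('D_e_z a3 p).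
  by move: v.1.1 v.1.2 v.2 w.1.1 w.1.2 w.2 => *; ring.
have D p v := is_derive_potential sa cl p v.
have dx p : is_derive p e_x (potential a) (a1 p).
  by apply: (is_derive_eq (D p e_x)); rewrite E pr0 pr1 pr2 a_0 a_1 a_2 ?(mul0r, mul1r, addr0, add0r).
have dy p : is_derive p e_y (potential a) (a2 p).
  by apply: (is_derive_eq (D p e_y)); rewrite E pr0 pr1 pr2 a_0 a_1 a_2 ?(mul0r, mul1r, addr0, add0r).
have dz p : is_derive p e_z (potential a) (a3 p).
  by apply: (is_derive_eq (D p e_z)); rewrite E pr0 pr1 pr2 a_0 a_1 a_2 ?(mul0r, mul1r, addr0, add0r).
exists (potential a).
  by case=> [|k]; [case: (CkS_intro dx dy dz (s1 0%N) (s2 0%N) (s3 0%N))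
                  |exact: (CkS_intro dx dy dz (s1 k) (s2 k) (s3 k))].
by move=> p; have [_ ->] := dx p; have [_ ->] := dy p; have [_ ->] := dz p.
Qed.

End gauge.

(** * The infimum of the Rayleigh quotients and its transport *)

Section bottom_transport.
Context {R : realType}.
Local Notation H := (heis R).
Local Notation Re := complex.Re.
Local Notation Im := complex.Im.
Implicit Types (u w : H -> R[i]) (A : one_form R).

(** The number m is the infimum of the Rayleigh quotients. The two clauses avoid the division by
    [n2 w] and are the hypotheses of [inf_spectrum]. *)
Definition is_bottom A (m : R) :=
  (forall w, test_function w -> m * n2 w <= qf A w w) /\
  forall eps, 0 < eps -> exists w, [/\ test_function w, 0 < n2 w &
    qf A w w < (m + eps) * n2 w].

Lemma is_bottom_ge A m : is_bottom A m -> 0 <= m.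
Proof.
move=> [_ h]; rewrite leNgt; apply/negP => m0.
have [|w [tw w0]] := h (- m); first by rewrite oppr_gt0.
by rewrite subrr mul0r ltNge qf_ge0.
Qed.

Lemma is_bottom_le A m m' : (forall w, test_function w -> m * n2 w <= qf A w w) ->
  is_bottom A m' -> m <= m'.
Proof.
move=> hm [_ h]; rewrite leNgt; apply/negP => mm.
have [|w [tw w0 qw]] := h (m - m'); first by rewrite subr_gt0.
by have := hm w tw; rewrite leNgt (_ : m = m' + (m - m')) ?qw //; ring.
Qed.

Lemma is_bottom_exists A : (exists w : H -> R[i], test_function w /\ 0 < n2 w) ->
  exists m, is_bottom A m.
Proof.
move=> [w0 [tw0 w00]].
pose S := [set x | exists w, [/\ test_function w, 0 < n2 w & x = qf A w w / n2 w]].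
have infS : has_inf S.
  split; first by exists (qf A w0 w0 / n2 w0), w0.
  by exists 0 => _ [w [_ wp ->]]; rewrite divr_ge0 ?qf_ge0 // ltW.
exists (inf S); split=> [w tw|eps e0].
  have := n2_ge0 w; rewrite le_eqVlt => /predU1P[<-|wp]; first by rewrite mulr0 qf_ge0.
  by rewrite -ler_pdivlMr //; apply: ge_inf; [case: infS|exists w].
have [_ [w [tw wp ->]] h] := inf_adherent e0 infS; exists w; split=> //.
by rewrite -ltr_pdivrMr.
Qed.

(** The factor k absorbs the Jacobian of a change of variables, so that Rayleigh quotients are
    multiplied by s. One direction carries near-minimizers over; the lower bound needs the converse
    transport with s^-1. *)
Definition transport A A' (s : R) := forall w, test_function w -> exists w' k,
  [/\ test_function w', 0 < k, n2 w' = k * n2 w & qf A' w' w' = k * s * qf A w w].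

Lemma is_bottom_transport A A' s m : 0 < s -> transport A A' s -> transport A' A s^-1 ->
  is_bottom A m -> is_bottom A' (s * m).
Proof.
move=> s0 tAA' tA'A [hm hmin]; split=> [w tw|eps e0].
  have [w' [k [tw' k0 nw qw]]] := tA'A w tw.
  have := hm w' tw'; rewrite nw qw -mulrA mulrCA ler_pM2l //.
  by rewrite ler_pdivlMl // mulrA.
have es : 0 < eps / s by rewrite divr_gt0.
have [w [tw wp qw]] := hmin _ es.
have [w' [k [tw' k0 nw qw']]] := tAA' w tw; exists w'; split=> //; first by rewrite nw mulr_gt0.
rewrite nw qw' (_ : (s * m + eps) * _ = k * s * ((m + eps / s) * n2 w)).
  by rewrite ltr_pM2l // mulr_gt0.
by field; rewrite gt_eqF.
Qed.

Lemma ipf_eq_ip u u' : (forall p, ipf u u p = ipf u' u' p) -> n2 u = n2 u'.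
Proof. by move=> h; apply: eq_Rintegral => p _; rewrite h. Qed.

Section phase.
Variables (phi : H -> R) (sphi : smooth phi).

Definition phase u (p : H) : R[i] := (cos (phi p) +i* sin (phi p)) * u p.

Lemma Re_phase u p : Re (phase u p) = cos (phi p) * Re (u p) - sin (phi p) * Im (u p).
Proof. by rewrite /phase ReM. Qed.
Lemma Im_phase u p : Im (phase u p) = cos (phi p) * Im (u p) + sin (phi p) * Re (u p).
Proof. by rewrite /phase ImM. Qed.

Lemma smooth_cos : smooth (fun p => cos (phi p)).
Proof. by move=> k; apply: Ck_cos. Qed.
Lemma smooth_sin : smooth (fun p => sin (phi p)).
Proof. by move=> k; apply: Ck_sin. Qed.

Lemma tf_phase u : test_function u -> test_function (phase u).
Proof.
move=> /test_functionE[ur ui]; apply/test_functionE; split.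
  rewrite (funext (Re_phase u)); apply: tfR_sub; apply: tfR_mull => //.
    exact: smooth_cos.
  exact: smooth_sin.
rewrite (funext (Im_phase u)); apply: tfR_add; apply: tfR_mull => //.
  exact: smooth_cos.
exact: smooth_sin.
Qed.

Lemma ipf_phase u p : ipf (phase u) (phase u) p = ipf u u p.
Proof.
rewrite /ipf Re_phase Im_phase; have := cos2Dsin2 (phi p).
move: (cos _) (sin _) (Re _) (Im _) => c s a b cs.
rewrite (_ : _ + _ = (c ^+ 2 + s ^+ 2) * (a * a + b * b)); last ring.
by rewrite cs mul1r.
Qed.

Lemma vfX_cos p : vfX (fun q => cos (phi q)) p = - sin (phi p) * vfX phi p.
Proof.
have [_ <-] := is_derive_X p smooth_cos.
by have [_] := is_derive_comp1 (is_derive_cos (phi p)) (is_derive_X p sphi).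
Qed.
Lemma vfX_sin p : vfX (fun q => sin (phi q)) p = cos (phi p) * vfX phi p.
Proof.
have [_ <-] := is_derive_X p smooth_sin.
by have [_] := is_derive_comp1 (is_derive_sin (phi p)) (is_derive_X p sphi).
Qed.
Lemma vfY_cos p : vfY (fun q => cos (phi q)) p = - sin (phi p) * vfY phi p.
Proof.
have [_ <-] := is_derive_Y p smooth_cos.
by have [_] := is_derive_comp1 (is_derive_cos (phi p)) (is_derive_Y p sphi).
Qed.
Lemma vfY_sin p : vfY (fun q => sin (phi q)) p = cos (phi p) * vfY phi p.
Proof.
have [_ <-] := is_derive_Y p smooth_sin.
by have [_] := is_derive_comp1 (is_derive_sin (phi p)) (is_derive_Y p sphi).
Qed.

Lemma vfX_sub f g p : smooth f -> smooth g ->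
  vfX (fun q => f q - g q) p = vfX f p - vfX g p :> R.
Proof.
move=> sf sg; have [_ <-] := is_derive_X p (smooth_sub sf sg).
by have [_] := is_deriveB (is_derive_X p sf) (is_derive_X p sg).
Qed.
Lemma vfX_add f g p : smooth f -> smooth g ->
  vfX (fun q => f q + g q) p = vfX f p + vfX g p :> R.
Proof.
move=> sf sg; have [_ <-] := is_derive_X p (smooth_add sf sg).
by have [_] := is_deriveD (is_derive_X p sf) (is_derive_X p sg).
Qed.
Lemma vfY_sub f g p : smooth f -> smooth g ->
  vfY (fun q => f q - g q) p = vfY f p - vfY g p :> R.
Proof.
move=> sf sg; have [_ <-] := is_derive_Y p (smooth_sub sf sg).
by have [_] := is_deriveB (is_derive_Y p sf) (is_derive_Y p sg).
Qed.
Lemma vfY_add f g p : smooth f -> smooth g ->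
  vfY (fun q => f q + g q) p = vfY f p + vfY g p :> R.
Proof.
move=> sf sg; have [_ <-] := is_derive_Y p (smooth_add sf sg).
by have [_] := is_deriveD (is_derive_Y p sf) (is_derive_Y p sg).
Qed.

(** (X + i A'_x)(e^(i phi) u) = e^(i phi) (X + i (A'_x + X phi)) u by the product rule. *)
Lemma covX_phase A A' u : test_function u ->
  (forall p, c_dx A p = c_dx A' p + vfX phi p) -> covX A' (phase u) = phase (covX A u).
Proof.
move=> /test_functionE[[ur _] [ui _]] AA'; have sc := smooth_cos; have ss := smooth_sin.
apply/funext => p; apply: complexP.
  rewrite Re_phase Re_covX Re_covX Im_covX (funext (Re_phase u)) Im_phase AA'.
  rewrite vfX_sub; [|exact: smooth_mul|exact: smooth_mul].
  rewrite !vfX_mul // vfX_cos vfX_sin.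
  by move: (cos _) (sin _) (Re _) (Im _) (vfX _ _) (vfX _ _) (vfX _ _) (c_dx _ _) => *; ring.
rewrite Im_phase Im_covX Re_covX Im_covX (funext (Im_phase u)) Re_phase AA'.
rewrite vfX_add; [|exact: smooth_mul|exact: smooth_mul].
rewrite !vfX_mul // vfX_cos vfX_sin.
by move: (cos _) (sin _) (Re _) (Im _) (vfX _ _) (vfX _ _) (vfX _ _) (c_dx _ _) => *; ring.
Qed.

Lemma covY_phase A A' u : test_function u ->
  (forall p, c_dy A p = c_dy A' p + vfY phi p) -> covY A' (phase u) = phase (covY A u).
Proof.
move=> /test_functionE[[ur _] [ui _]] AA'; have sc := smooth_cos; have ss := smooth_sin.
apply/funext => p; apply: complexP.
  rewrite Re_phase Re_covY Re_covY Im_covY (funext (Re_phase u)) Im_phase AA'.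
  rewrite vfY_sub; [|exact: smooth_mul|exact: smooth_mul].
  rewrite !vfY_mul // vfY_cos vfY_sin.
  by move: (cos _) (sin _) (Re _) (Im _) (vfY _ _) (vfY _ _) (vfY _ _) (c_dy _ _) => *; ring.
rewrite Im_phase Im_covY Re_covY Im_covY (funext (Im_phase u)) Re_phase AA'.
rewrite vfY_add; [|exact: smooth_mul|exact: smooth_mul].
rewrite !vfY_mul // vfY_cos vfY_sin.
by move: (cos _) (sin _) (Re _) (Im _) (vfY _ _) (vfY _ _) (vfY _ _) (c_dy _ _) => *; ring.
Qed.

End phase.

Lemma potential_of_difference (a a' : H -> R * R * R) :
  smooth (fun p => (a p).1.1) -> smooth (fun p => (a p).1.2) -> smooth (fun p => (a p).2) ->
  smooth (fun p => (a' p).1.1) -> smooth (fun p => (a' p).1.2) -> smooth (fun p => (a' p).2) ->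
  (forall p, extd a p = extd a' p) -> exists2 phi : H -> R, smooth phi & forall p,
  [/\ 'D_e_x phi p = (a p).1.1 - (a' p).1.1, 'D_e_y phi p = (a p).1.2 - (a' p).1.2 &
      'D_e_z phi p = (a p).2 - (a' p).2].
Proof.
move=> s1 s2 s3 s1' s2' s3' E.
have DB f g (p v : H) : smooth f -> smooth g ->
    'D_v (fun q => f q - g q) p = 'D_v f p - 'D_v g p :> R.
  move=> sf sg; have [df _] := smooth_is_derive p v sf; have [dg _] := smooth_is_derive p v sg.
  exact: deriveB.
apply: poincare; [exact: smooth_sub|exact: smooth_sub|exact: smooth_sub| | |].
- move=> p; rewrite !DB //; have := congr1 (fun x => x.1.1) (E p); rewrite /extd /=.
  by move: ('D_e_x _ p) ('D_e_y _ p) ('D_e_x _ p) ('D_e_y _ p) => x y z t h; lra.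
- move=> p; rewrite !DB //; have := congr1 (fun x => x.1.2) (E p); rewrite /extd /=.
  by move: ('D_e_x _ p) ('D_e_z _ p) ('D_e_x _ p) ('D_e_z _ p) => x y z t h; lra.
- move=> p; rewrite !DB //; have := congr1 (fun x => x.2) (E p); rewrite /extd /=.
  by move: ('D_e_y _ p) ('D_e_z _ p) ('D_e_y _ p) ('D_e_z _ p) => x y z t h; lra.
Qed.

Lemma gauge_transport A A' B : smooth_form A -> smooth_form A' ->
  is_extd A B -> is_extd A' B -> transport A A' 1.
Proof.
move=> [sx sy so] [sx' sy' so'] eA eA'.
have smy k : smooth (fun p : H => p.1.2 / k) by apply: smooth_mul; [exact: smooth_coord2|exact: smooth_cst].
have smx k : smooth (fun p : H => p.1.1 / k) by apply: smooth_mul; [exact: smooth_coord1|exact: smooth_cst].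
have s1 C : smooth (c_dx C) -> smooth (c_om C) -> smooth (fun p => (coord1 C p).1.1 : R).
  by move=> h1 h2; apply: smooth_add => //; apply: smooth_mul.
have s2 C : smooth (c_dy C) -> smooth (c_om C) -> smooth (fun p => (coord1 C p).1.2 : R).
  by move=> h1 h2; apply: smooth_sub => //; apply: smooth_mul.
have E p : extd (coord1 A) p = extd (coord1 A') p by rewrite eA eA'.
have [phi sphi hphi] := potential_of_difference (s1 A sx so) (s2 A sy so) so
  (s1 A' sx' so') (s2 A' sy' so') so' E.
(* The identity d phi = A - A', evaluated on X, picks out the coefficients of dx in the coframe. *)
have hX p : c_dx A p = c_dx A' p + vfX phi p.
  by have [hx _ hz] := hphi p; rewrite /vfX hx hz /coord1 /=; ring.
have hY p : c_dy A p = c_dy A' p + vfY phi p.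
  by have [_ hy hz] := hphi p; rewrite /vfY hy hz /coord1 /=; ring.
move=> w tw; exists (phase phi w), 1; split=> //.
- exact: tf_phase.
- by rewrite mul1r; apply: ipf_eq_ip => p; exact: ipf_phase.
- rewrite !mul1r /qf (covX_phase sphi tw hX) (covY_phase sphi tw hY).
  by congr (_ + _); apply: ipf_eq_ip => p; exact: ipf_phase.
Qed.

End bottom_transport.

(** * Rotations and dilations *)

Section rotation_dilation.
Context {R : realType}.
Local Notation H := (heis R).
Local Notation M := (heisM R).
Local Notation mu := (@heis_measure R).
Implicit Types (u w : H -> R[i]) (A : one_form R) (f : H -> R).
Local Notation Re := complex.Re.
Local Notation Im := complex.Im.

Lemma Re_lin (a b : R) (x y : R[i]) : Re (a%:C * x + b%:C * y) = a * Re x + b * Re y.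
Proof. by rewrite ReD !ReM /= !mul0r !subr0. Qed.
Lemma Im_lin (a b : R) (x y : R[i]) : Im (a%:C * x + b%:C * y) = a * Im x + b * Im y.
Proof. by rewrite ImD !ImM /= !mul0r !addr0. Qed.

Section rotdil.
Variables (r c s : R) (r0 : 0 < r) (cs : c ^+ 2 + s ^+ 2 = 1).
Local Notation Phi := (rotdil r c s).

Lemma rotdil_line v q (t : R) : Phi (q + t *: v) = Phi q + t *: Phi v.
Proof.
case: q v => [[x y] z] [[x' y'] z']; rewrite /rotdil /=.
by congr (_, _, _); rewrite /= /GRing.scale /=; ring.
Qed.

Lemma rotdil_cont : continuous Phi.
Proof.
apply: cont_triple => p.
- apply: cvgMr; apply: cvgB; apply: cvgMr; [exact: cont_coord1|exact: cont_coord2].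
- apply: cvgMr; apply: cvgD; apply: cvgMr; [exact: cont_coord1|exact: cont_coord2].
- by apply: cvgMr; exact: cont_coord3.
Qed.

Lemma smooth_rotdil f : smooth f -> smooth (f \o Phi).
Proof. by move=> sf k; apply: (Ck_affine rotdil_cont rotdil_line). Qed.

(** [Phi] is a group automorphism, so its differential sends X to r (c X + s Y). In the z-component
    this match uses c^2 + s^2 = 1. *)
Lemma vfX_rotdil f p : smooth f ->
  vfX (f \o Phi) p = r * (c * vfX f (Phi p) + s * vfY f (Phi p)).
Proof.
move=> sf; have [_ <-] := is_derive_X p (smooth_rotdil sf).
have D := is_derive_affine (rotdil_line (Xv p)) (smooth_is_derive (Phi p) (Phi (Xv p)) sf).
have [_ ->] := D; rewrite /dirD /vfX /vfY.
have -> : (Phi (Xv p)).1.1 = r * c by rewrite /rotdil /Xv /=; ring.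
have -> : (Phi (Xv p)).1.2 = r * s by rewrite /rotdil /Xv /=; ring.
have -> : (Phi (Xv p)).2 = r * (- (c * ((Phi p).1.2 / 2)) + s * ((Phi p).1.1 / 2)).
  rewrite /rotdil /Xv /= [RHS](_ : _ = (c ^+ 2 + s ^+ 2) * (r ^+ 2 * - (p.1.2 / 2))); first by rewrite cs mul1r.
  by ring.
move: ('D_e_x f _) ('D_e_y f _) ('D_e_z f _) (Phi p).1.2 (Phi p).1.1 => *; ring.
Qed.

Lemma vfY_rotdil f p : smooth f ->
  vfY (f \o Phi) p = r * (- s * vfX f (Phi p) + c * vfY f (Phi p)).
Proof.
move=> sf; have [_ <-] := is_derive_Y p (smooth_rotdil sf).
have D := is_derive_affine (rotdil_line (Yv p)) (smooth_is_derive (Phi p) (Phi (Yv p)) sf).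
have [_ ->] := D; rewrite /dirD /vfX /vfY.
have -> : (Phi (Yv p)).1.1 = - r * s by rewrite /rotdil /Yv /=; ring.
have -> : (Phi (Yv p)).1.2 = r * c by rewrite /rotdil /Yv /=; ring.
have -> : (Phi (Yv p)).2 = r * (s * ((Phi p).1.2 / 2) + c * ((Phi p).1.1 / 2)).
  rewrite /rotdil /Yv /= [RHS](_ : _ = (c ^+ 2 + s ^+ 2) * (r ^+ 2 * (p.1.1 / 2))); first by rewrite cs mul1r.
  by ring.
move: ('D_e_x f _) ('D_e_y f _) ('D_e_z f _) (Phi p).1.2 (Phi p).1.1 => *; ring.
Qed.

(** The new radius is read off the inverse map, which is the transposed rotation and the dilation by
    1/r. *)
Lemma vanishes_rotdil f : vanishes f -> vanishes (f \o Phi).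
Proof.
move=> [B vf].
have r20 : 0 < r ^+ 2 by rewrite exprn_gt0.
exists (2 * r^-1 * `|B| + (r ^+ 2)^-1 * `|B|) => p Kp; apply: vf.
rewrite ltNge; apply: contraTN Kp; rewrite -leNgt => /heis_norm_le[/= h1 h2 h3].
have BB := ler_norm B; have B0 := normr_ge0 B.
have sq1 (x y : R) : x ^+ 2 + y ^+ 2 = 1 -> `|x| <= 1.
  by move=> h; rewrite -sqrtr1 -sqrtr_sqr; apply: ler_wsqrtr; rewrite -h lerDl sqr_ge0.
have c1 := sq1 _ _ cs; have s1 : `|s| <= 1 by apply: (sq1 s c); rewrite addrC.
set X := r * (c * p.1.1 - _) in h1; set Y := r * (s * p.1.1 + _) in h2.
have mle (k x : R) : `|k| <= 1 -> `|x| <= B -> `|k * x| <= `|B|.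
  by move=> k1 xB; rewrite normrM -[X in _ <= X]mul1r; apply: ler_pM => //; exact: le_trans xB BB.
have sum2 (x y : R) : `|x| <= `|B| -> `|y| <= `|B| -> `|r^-1 * (x + y)| <= 2 * r^-1 * `|B|.
  move=> hx hy; rewrite normrM (ger0_norm (x := r^-1)) ?invr_ge0 ?(ltW r0) //.
  rewrite mulrAC mulrC; apply: ler_wpM2r; first by rewrite invr_ge0 ltW.
  by apply: le_trans (ler_normD _ _) _; lra.
have e2 : 0 <= (r ^+ 2)^-1 * `|B| by rewrite mulr_ge0 // invr_ge0 ltW.
have e1 : 0 <= 2 * r^-1 * `|B| by rewrite !mulr_ge0 // invr_ge0 ltW.
apply/heis_norm_le; split.
- have -> : p.1.1 = r^-1 * (c * X + s * Y).
    rewrite (_ : c * X + s * Y = (c ^+ 2 + s ^+ 2) * (r * p.1.1)); last by rewrite /X /Y; ring.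
    by rewrite cs mul1r mulKf // gt_eqF.
  by apply: (le_trans (sum2 _ _ (mle _ _ c1 h1) (mle _ _ s1 h2))); rewrite lerDl.
- have -> : p.1.2 = r^-1 * (- s * X + c * Y).
    rewrite (_ : - s * X + c * Y = (c ^+ 2 + s ^+ 2) * (r * p.1.2)); last by rewrite /X /Y; ring.
    by rewrite cs mul1r mulKf // gt_eqF.
  have s1' : `|- s| <= 1 by rewrite normrN.
  by apply: (le_trans (sum2 _ _ (mle _ _ s1' h1) (mle _ _ c1 h2))); rewrite lerDl.
- have -> : p.2 = (r ^+ 2)^-1 * (r ^+ 2 * p.2) by rewrite mulKf // gt_eqF.
  rewrite normrM (ger0_norm (x := (r ^+ 2)^-1)) ?invr_ge0 ?(ltW r20) //.
  apply: (@le_trans _ _ ((r ^+ 2)^-1 * `|B|)); last by rewrite lerDr.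
  by apply: ler_wpM2l; [rewrite invr_ge0 ltW|exact: le_trans h3 BB].
Qed.

Lemma tfR_rotdil f : tfR f -> tfR (f \o Phi).
Proof. by move=> [sf vf]; split; [exact: smooth_rotdil|exact: vanishes_rotdil]. Qed.

Lemma Cc_rotdil f : Cc f -> Cc (f \o Phi).
Proof.
move=> [cf vf]; split; last exact: vanishes_rotdil.
by move=> p; apply: continuous_comp; [exact: rotdil_cont|exact: cf].
Qed.

(** The two identities say that A' and the pull-back of A by [Phi] agree on X and Y. For w \o Phi
    the pair of covariant derivatives is then r times a rotation of the pair for w, taken at Phi p:
    this gives the factor r^2, while k = r^-4 comes from the Jacobian. *)
Lemma rotdil_transport A A' : 
  (forall p, c_dx A' p = r * (c * c_dx A (Phi p) + s * c_dy A (Phi p))) ->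
  (forall p, c_dy A' p = r * (- s * c_dx A (Phi p) + c * c_dy A (Phi p))) ->
  smooth_form A -> transport A A' (r ^+ 2).
Proof.
move=> hx hy sA w tw; exists (w \o Phi), (r ^+ 4)^-1.
have r4 : 0 < r ^+ 4 by rewrite exprn_gt0.
have scale (F : H -> R) : Cc F -> (forall p, 0 <= F p) ->
    (\int[mu]_p F (Phi p) = (r ^+ 4)^-1 * \int[mu]_p F p)%R.
  move=> cF F0; have [_ E] := rescales_rotdil r0 cs.
  have mF : measurable_fun [set: M] (EFin \o F).
    by apply/measurable_EFinP; apply: continuous_heis_measurable; case: cF.
  have E' : (\int[mu]_p (F p)%:E = (r ^+ 4)%:E * \int[mu]_p (F (Phi p))%:E)%E.
    by apply: (E (EFin \o F) mF) => p; rewrite lee_fin.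
  have fin := integrable_fin_num measurableT (Cc_integrable (Cc_rotdil cF)).
  by rewrite /Rintegral E' fineM // mulKf // gt_eqF.
have [tr ti] := (test_functionE w).1 tw.
have [sr _] := tr; have [si _] := ti.
have RX p : covX A' (w \o Phi) p = (r * c)%:C * covX A w (Phi p) + (r * s)%:C * covY A w (Phi p).
  apply: complexP.
    have E : vfX (fun q => Re ((w \o Phi) q)) p = _ := vfX_rotdil p sr.
    rewrite [RHS]Re_lin [LHS](Re_covX A' (w \o Phi) p) E (Re_covX A w (Phi p)) (Re_covY A w (Phi p)) (hx p) {E}.
    move: (vfX _ (Phi p)) (vfY _ (Phi p)) (c_dx A _) (c_dy A _) => *; rewrite /=; ring.
  have E : vfX (fun q => Im ((w \o Phi) q)) p = _ := vfX_rotdil p si.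
    rewrite [RHS]Im_lin [LHS](Im_covX A' (w \o Phi) p) E (Im_covX A w (Phi p)) (Im_covY A w (Phi p)) (hx p) {E}.
  move: (vfX _ (Phi p)) (vfY _ (Phi p)) (c_dx A _) (c_dy A _) => *; rewrite /=; ring.
have RY p : covY A' (w \o Phi) p = (- r * s)%:C * covX A w (Phi p) + (r * c)%:C * covY A w (Phi p).
  apply: complexP.
    have E : vfY (fun q => Re ((w \o Phi) q)) p = _ := vfY_rotdil p sr.
    rewrite [RHS]Re_lin [LHS](Re_covY A' (w \o Phi) p) E (Re_covX A w (Phi p)) (Re_covY A w (Phi p)) (hy p) {E}.
    move: (vfX _ (Phi p)) (vfY _ (Phi p)) (c_dx A _) (c_dy A _) => *; rewrite /=; ring.
  have E : vfY (fun q => Im ((w \o Phi) q)) p = _ := vfY_rotdil p si.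
    rewrite [RHS]Im_lin [LHS](Im_covY A' (w \o Phi) p) E (Im_covX A w (Phi p)) (Im_covY A w (Phi p)) (hy p) {E}.
  move: (vfX _ (Phi p)) (vfY _ (Phi p)) (c_dx A _) (c_dy A _) => *; rewrite /=; ring.
have Cipf u : test_function u -> Cc (ipf u u).
  move=> /test_functionE[ur ui]; apply: Cc_add; apply: Cc_mull; try exact: tfR_Cc.
    by case: (tfR_Cc ur).
  by case: (tfR_Cc ui).
have tX := tf_covX sA tw; have tY := tf_covY sA tw.
split.
- by apply/test_functionE; split; [exact: (tfR_rotdil tr)|exact: (tfR_rotdil ti)].
- by rewrite invr_gt0.
- by rewrite /n2 /ip -(scale _ (Cipf _ tw)) //; exact: ipf_ge0.
pose F p := ipf (covX A w) (covX A w) p + ipf (covY A w) (covY A w) p.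
have cF : Cc F by apply: Cc_add; exact: Cipf.
have -> : qf A w w = (\int[mu]_p F p)%R.
  have iX := ipf_integrable (tf_L2' tX) (tf_L2' tX).
  have iY := ipf_integrable (tf_L2' tY) (tf_L2' tY).
  by rewrite /qf /ip -(RintegralD measurableT iX iY).
rewrite mulrAC -scale //; last by move=> p; rewrite addr_ge0 // ipf_ge0.
have L2lin a b (U V : H -> R[i]) : L2' U -> L2' V ->
    L2' (fun p => a%:C * U p + b%:C * V p).
  move=> hU hV; rewrite (_ : (fun p => _) = cmb (cmb U (a - 1) U) b V).
    by apply: L2'_cmb => //; exact: L2'_cmb.
  by apply/funext => p; apply: complexP; rewrite !(Re_cmb, Im_cmb) (Re_lin, Im_lin); ring.
have hXP : L2' (covX A w \o Phi).
  have /test_functionE[h1 h2] := tX.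
  by apply: tf_L2'; apply/test_functionE; split; [exact: (tfR_rotdil h1)|exact: (tfR_rotdil h2)].
have hYP : L2' (covY A w \o Phi).
  have /test_functionE[h1 h2] := tY.
  by apply: tf_L2'; apply/test_functionE; split; [exact: (tfR_rotdil h1)|exact: (tfR_rotdil h2)].
rewrite /qf (funext RX) (funext RY).
have iX := ipf_integrable (L2lin (r * c) (r * s) _ _ hXP hYP) (L2lin (r * c) (r * s) _ _ hXP hYP).
have iY := ipf_integrable (L2lin (- r * s) (r * c) _ _ hXP hYP) (L2lin (- r * s) (r * c) _ _ hXP hYP).
rewrite /ip -(RintegralD measurableT iX iY) [RHS]mulrC -RintegralZl //; last first.
  exact: Cc_integrable (Cc_rotdil cF).
apply: eq_Rintegral => p _; rewrite /F /ipf !(Re_lin, Im_lin).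
move: (Re (covX _ _ _)) (Im (covX _ _ _)) (Re (covY _ _ _)) (Im (covY _ _ _)) => x y z t.
rewrite -[r ^+ 2 in RHS]mulr1 -cs; ring.
Qed.

End rotdil.

(* The potential with dA = b1 dx/\omega + b2 dy/\omega that is covariant under
   rotations and dilations. *)
Definition std_form (b1 b2 : R) : one_form R :=
  let beta p := b1 * p.1.1 + b2 * p.1.2 in
  OneForm (fun p => - (p.1.2 * beta p / 3)) (fun p => p.1.1 * beta p / 3) beta.

Lemma smooth_std_form b1 b2 : smooth_form (std_form b1 b2).
Proof.
have sb : smooth (fun p : H => b1 * p.1.1 + b2 * p.1.2).
  by apply: smooth_add; apply: smooth_mul; (exact: smooth_cst || exact: smooth_coord1 || exact: smooth_coord2).
split=> //=.
- apply: smooth_opp; apply: smooth_mul; last exact: smooth_cst.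
  by apply: smooth_mul => //; exact: smooth_coord2.
- apply: smooth_mul; last exact: smooth_cst.
  by apply: smooth_mul => //; exact: smooth_coord1.
Qed.

Lemma extd_std_form b1 b2 : is_extd (std_form b1 b2) (const_field b1 b2).
Proof.
move=> p; rewrite /extd /coord2 /const_field /std_form.
pose beta (q : H) := b1 * q.1.1 + b2 * q.1.2.
have db (v : H) : is_derive p v beta (b1 * v.1.1 + b2 * v.1.2).
  have [d1 d2 _] := is_derive_coord p v.
  have e1 := is_deriveMul (is_derive_cst b1 p v) d1.
  have e2 := is_deriveMul (is_derive_cst b2 p v) d2.
  by apply: (is_derive_eq (is_deriveD e1 e2)); rewrite !mul0r !add0r.
have d1 (v : H) : is_derive p v (fun q => 6^-1 * (q.1.2 * beta q))
    (6^-1 * (v.1.2 * beta p + p.1.2 * (b1 * v.1.1 + b2 * v.1.2))).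
  have [_ d2 _] := is_derive_coord p v.
  have e := is_deriveMul (is_derive_cst (6^-1 : R) p v) (is_deriveMul d2 (db v)).
  by apply: (is_derive_eq e); rewrite mul0r add0r.
have d2 (v : H) : is_derive p v (fun q => - 6^-1 * (q.1.1 * beta q))
    (- 6^-1 * (v.1.1 * beta p + p.1.1 * (b1 * v.1.1 + b2 * v.1.2))).
  have [d _ _] := is_derive_coord p v.
  have e := is_deriveMul (is_derive_cst (- 6^-1 : R) p v) (is_deriveMul d (db v)).
  by apply: (is_derive_eq e); rewrite mul0r add0r.
rewrite (_ : (fun q => (coord1 _ q).1.1) = (fun q => 6^-1 * (q.1.2 * beta q))); last first.
  by apply/funext => q; rewrite /coord1 /= -/(beta q); field.
rewrite (_ : (fun q => (coord1 _ q).1.2) = (fun q => - 6^-1 * (q.1.1 * beta q))); last first.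
  by apply/funext => q; rewrite /coord1 /= -/(beta q); field.
rewrite (_ : (fun q => (coord1 _ q).2) = beta) //.
have [_ ->] := d2 e_x; have [_ ->] := d1 e_y; have [_ ->] := db e_x.
have [_ ->] := d1 e_z; have [_ ->] := db e_y; have [_ ->] := d2 e_z.
by rewrite /e_x /e_y /e_z /=; congr (_, _, _); rewrite /beta; field.
Qed.

(** The dx- and dy-coefficients of [std_form] are quadratic in (x, y), which accounts for r^2, and
    the frame contributes another r; the rotation acts on (b1, b2). *)
Lemma std_form_transport r c s b1 b2 : 0 < r -> c ^+ 2 + s ^+ 2 = 1 ->
  transport (std_form b1 b2)
    (std_form (r ^+ 3 * (b1 * c + b2 * s)) (r ^+ 3 * (- b1 * s + b2 * c))) (r ^+ 2).
Proof.
move=> r0 cs; apply: (rotdil_transport r0 cs); last exact: smooth_std_form.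
- move=> p; rewrite /std_form /rotdil /=.
  transitivity ((c ^+ 2 + s ^+ 2) * - (p.1.2 * (r ^+ 3 * ((b1 * c + b2 * s) * p.1.1
    + (- b1 * s + b2 * c) * p.1.2)) / 3)); [by rewrite cs; field|by field].
- move=> p; rewrite /std_form /rotdil /=.
  transitivity ((c ^+ 2 + s ^+ 2) * (p.1.1 * (r ^+ 3 * ((b1 * c + b2 * s) * p.1.1
    + (- b1 * s + b2 * c) * p.1.2)) / 3)); [by rewrite cs; field|by field].
Qed.

End rotation_dilation.

(** * Holonomy along loops *)

Section parallel_transport.
Context {R : realType}.
Local Notation H := (heis R).
Local Notation M := (heisM R).
Local Notation mu := (@heis_measure R).
Implicit Types (u w : H -> R[i]) (f : H -> R).
Local Notation Re := complex.Re.
Local Notation Im := complex.Im.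

Definition nrm u := Num.sqrt (n2 u).

Lemma nrmD u w : L2' u -> L2' w -> nrm (cmb u 1 w) <= nrm u + nrm w.
Proof.
move=> hu hw; have h0 : 0 <= nrm u + nrm w by rewrite addr_ge0 // sqrtr_ge0.
rewrite -[X in _ <= X]ger0_norm // -sqrtr_sqr; apply: ler_wsqrtr.
rewrite n2_cmb // expr1n mul1r mulr1 sqrrD /nrm !sqr_sqrtr ?n2_ge0 //.
have := ip_le_sqrt hu hw.
by move: (ip u w) (n2 u) (n2 w) (Num.sqrt _) (Num.sqrt _) => x y z s t; lra.
Qed.

Variables (V : H -> H) (theta : H -> R).
Hypotheses (fV : straight_flow V) (ctheta : continuous theta).
Hypothesis thetaV : forall t p, theta (p + t *: V p) = theta p.

(* Parallel transport along the integral curves of [V], on which [theta] is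
   constant, for the covariant derivative V + i theta. *)
Definition ptrans (t : R) u (p : H) : R[i] :=
  (cos (t * theta p) +i* sin (t * theta p)) * u (p + t *: V p).

Lemma Re_ptrans t u p : Re (ptrans t u p) =
  cos (t * theta p) * Re (u (p + t *: V p)) - sin (t * theta p) * Im (u (p + t *: V p)).
Proof. by rewrite /ptrans ReM. Qed.
Lemma Im_ptrans t u p : Im (ptrans t u p) =
  cos (t * theta p) * Im (u (p + t *: V p)) + sin (t * theta p) * Re (u (p + t *: V p)).
Proof. by rewrite /ptrans ImM. Qed.

Lemma ipf_ptrans t u p : ipf (ptrans t u) (ptrans t u) p = ipf u u (p + t *: V p).
Proof.
rewrite /ipf Re_ptrans Im_ptrans; have := cos2Dsin2 (t * theta p).
move: (cos _) (sin _) (Re _) (Im _) => c s a b cs.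
rewrite (_ : _ + _ = (c ^+ 2 + s ^+ 2) * (a * a + b * b)); last ring.
by rewrite cs mul1r.
Qed.

Lemma cont_phase (g : R -> R) (t : R) : continuous g -> continuous (fun p => g (t * theta p)).
Proof.
move=> cg p; apply: (@continuous_comp _ _ _ (fun p => t * theta p) g); last exact: cg.
by apply: cvgMr; exact: ctheta.
Qed.

Lemma n2_ptrans t u : L2' u -> L2' (ptrans t u) /\ n2 (ptrans t u) = n2 u.
Proof.
move=> [mr mi iu]; have [_ /(_ t) [mPhi E] _ _] := fV.
have cc := cont_phase (t := t) (@continuous_cos R); have cs := cont_phase (t := t) (@continuous_sin R).
have mc := continuous_heis_measurable cc; have ms := continuous_heis_measurable cs.
have mrP : measurable_fun [set: M] (fun p => Re (u (p + t *: V p))).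
  exact: (measurableT_comp mr mPhi).
have miP : measurable_fun [set: M] (fun p => Im (u (p + t *: V p))).
  exact: (measurableT_comp mi mPhi).
have mrW : measurable_fun [set: M] (fun p => Re (ptrans t u p)).
  by rewrite (funext (Re_ptrans t u)); apply: measurable_funB; apply: measurable_funM.
have miW : measurable_fun [set: M] (fun p => Im (ptrans t u p)).
  by rewrite (funext (Im_ptrans t u)); apply: measurable_funD; apply: measurable_funM.
have mI := ipf_measurable mr mi mr mi.
have EI : (\int[mu]_p (ipf u u p)%:E = \int[mu]_p (ipf (ptrans t u) (ptrans t u) p)%:E)%E.
  under [RHS]eq_integral do rewrite ipf_ptrans.
  rewrite (E (EFin \o ipf u u)) ?mul1e //; first exact/measurable_EFinP.
  by move=> p; rewrite lee_fin ipf_ge0.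
split; last by rewrite /n2 /ip /Rintegral EI.
split=> //; apply/integrableP; split.
  by apply/measurable_EFinP; exact: (ipf_measurable mrW miW mrW miW).
have h w : (fun p => `|(EFin \o ipf w w) p|%E) = (fun p => (ipf w w p)%:E).
  by apply/funext => p; rewrite /= ger0_norm ?ipf_ge0.
by move/integrableP: iu => [_]; rewrite !h EI.
Qed.

Lemma ptrans_cmb t u r w : ptrans t (cmb u r w) = cmb (ptrans t u) r (ptrans t w).
Proof.
apply/funext => p; apply: complexP; rewrite !(Re_cmb, Im_cmb) !(Re_ptrans, Im_ptrans) Re_cmb Im_cmb; ring.
Qed.

Lemma ptransD t s u : ptrans t (ptrans s u) = ptrans (t + s) u.
Proof.
have [VE _ _ _] := fV; apply/funext => p; rewrite /ptrans thetaV mulrA; congr (_ * u _).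
  by apply: complexP; rewrite ?ReM ?ImM /= mulrDl ?cosD ?sinD; ring.
by rewrite VE scalerDl addrA.
Qed.

(** W_((n+1) t) u - u = W_t (W_(n t) u - u) + (W_t u - u), with W_t isometric. A long transport is
    thereby reduced to short ones. *)
Lemma nrm_ptrans_iter t u n : L2' u ->
  nrm (cmb (ptrans (n%:R * t) u) (-1) u) <= n%:R * nrm (cmb (ptrans t u) (-1) u).
Proof.
move=> hu; elim: n => [|n IH].
  rewrite !mul0r /nrm (_ : n2 _ = 0) ?sqrtr0 //.
  rewrite (_ : ptrans 0 u = u); first by rewrite n2_cmb // /n2; ring.
  by apply/funext => p; apply: complexP; rewrite ?Re_ptrans ?Im_ptrans !mul0r cos0 sin0 scale0r addr0; ring.
have hW s : L2' (ptrans s u) by have [] := n2_ptrans s hu.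
have hd s : L2' (cmb (ptrans s u) (-1) u) by exact: L2'_cmb.
rewrite (_ : cmb (ptrans (n.+1%:R * t) u) (-1) u =
   cmb (ptrans t (cmb (ptrans (n%:R * t) u) (-1) u)) 1 (cmb (ptrans t u) (-1) u)).
  have [hL nE] := n2_ptrans t (hd (n%:R * t)).
  apply: (le_trans (nrmD hL (hd t))).
  by rewrite {1}/nrm nE -natr1 mulrDl mul1r lerD2r.
rewrite ptrans_cmb ptransD (_ : t + n%:R * t = n.+1%:R * t); last by rewrite -natr1; ring.
by apply/funext => p; apply: complexP; rewrite !(Re_cmb, Im_cmb); ring.
Qed.

Variables (u : H -> R[i]) (Du : H -> R[i]).
Hypotheses (cu : Cc (fun p => Re (u p))) (ci : Cc (fun p => Im (u p))).
Hypotheses (cDu : Cc (fun p => Re (Du p))) (ciD : Cc (fun p => Im (Du p))).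
(** Together with [dIm], this is Du = (V + i theta) u in real and imaginary parts. *)
Hypothesis dRe : forall p, is_derive p (V p) (fun q => Re (u q)) (Re (Du p) + theta p * Im (u p)).
Hypothesis dIm : forall p, is_derive p (V p) (fun q => Im (u q)) (Im (Du p) - theta p * Re (u p)).

(** The derivative of W_t u in t is W_t Du: differentiating the phase supplies the term i theta. *)
Lemma is_derive_ptrans p (t : R) :
  is_derive t 1 (fun s => Re (ptrans s u p)) (Re (ptrans t Du p)) /\
  is_derive t 1 (fun s => Im (ptrans s u p)) (Im (ptrans t Du p)).
Proof.
have [VE _ _ _] := fV.
have dR : is_derive t 1 (fun s : R => Re (u (p + s *: V p)))
    (Re (Du (p + t *: V p)) + theta p * Im (u (p + t *: V p))).
  apply: (@is_derive_line R H (fun q => Re (u q))).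
  by have := dRe (p + t *: V p); rewrite VE thetaV.
have dI : is_derive t 1 (fun s : R => Im (u (p + s *: V p)))
    (Im (Du (p + t *: V p)) - theta p * Re (u (p + t *: V p))).
  apply: (@is_derive_line R H (fun q => Im (u q))).
  by have := dIm (p + t *: V p); rewrite VE thetaV.
have dl : is_derive t 1 (fun s : R => s * theta p) (theta p).
  have := is_deriveMul (is_derive_id t (1 : R)) (is_derive_cst (theta p) t (1 : R)).
  by rewrite mulr0 addr0 mul1r.
have dc : is_derive t 1 (fun s : R => cos (s * theta p)) (- sin (t * theta p) * theta p).
  exact: is_derive1_comp (is_derive_cos _) dl.
have ds : is_derive t 1 (fun s : R => sin (s * theta p)) (cos (t * theta p) * theta p).
  exact: is_derive1_comp (is_derive_sin _) dl.
split.
- have := is_deriveB (is_deriveMul dc dR) (is_deriveMul ds dI).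
  rewrite (_ : _ - _ = (fun s => Re (ptrans s u p))); last by apply/funext => s; rewrite Re_ptrans.
  move=> D; apply: (is_derive_eq D); rewrite Re_ptrans.
  move: (cos (t * theta p)) (sin (t * theta p)) => c d.
  by move: (Re (u _)) (Im (u _)) (Re (Du _)) (Im (Du _)) => *; ring.
- have := is_deriveD (is_deriveMul dc dI) (is_deriveMul ds dR).
  rewrite (_ : _ + _ = (fun s => Im (ptrans s u p))); last by apply/funext => s; rewrite Im_ptrans.
  move=> D; apply: (is_derive_eq D); rewrite Im_ptrans.
  move: (cos (t * theta p)) (sin (t * theta p)) => c d.
  by move: (Re (u _)) (Im (u _)) (Re (Du _)) (Im (Du _)) => *; ring.
Qed.

Lemma ptrans0 w : ptrans 0 w = w.
Proof.
by apply/funext => p; apply: complexP; rewrite ?Re_ptrans ?Im_ptrans !mul0r cos0 sin0 scale0r addr0; ring.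
Qed.

(** The mean value theorem fails for complex values, so the real and imaginary parts get
    intermediate times of their own. *)
Lemma ptrans_mvt p (t : R) :
  (exists2 s : R, `|s| <= `|t| & Re (ptrans t u p) - Re (u p) = t * Re (ptrans s Du p)) /\
  (exists2 s : R, `|s| <= `|t| & Im (ptrans t u p) - Im (u p) = t * Im (ptrans s Du p)).
Proof.
have E (g dg : R -> R) : (forall s : R, is_derive s 1 g (dg s)) ->
    exists2 s : R, `|s| <= `|t| & g t - g 0 = t * dg s.
  move=> dg'; have [s st] := @mvt_line R R g 0 1 dg t (fun s => dg' _).
  by rewrite !add0r ![_%:A]mulr1 => h; exists s.
split.
  have := E (fun s => Re (ptrans s u p)) (fun s => Re (ptrans s Du p)) (fun s => (is_derive_ptrans p s).1).
  by rewrite ptrans0.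
have := E (fun s => Im (ptrans s u p)) (fun s => Im (ptrans s Du p)) (fun s => (is_derive_ptrans p s).2).
by rewrite ptrans0.
Qed.

Lemma ptrans_cont w t : continuous (fun p => Re (w p)) -> continuous (fun p => Im (w p)) ->
  continuous (fun p => Re (ptrans t w p)) /\ continuous (fun p => Im (ptrans t w p)).
Proof.
move=> cr cim; have cc := cont_phase (t := t) (@continuous_cos R); have cs := cont_phase (t := t) (@continuous_sin R).
have fl (f : H -> R) : continuous f -> continuous (fun p : H => f (p + t *: V p)).
  by move=> cf p; apply: (continuous_comp (@flow_cont R V fV t p) (cf _)).
have cR := fl _ cr; have cI := fl _ cim.
split=> p.
  rewrite (funext (Re_ptrans t w)); apply: cvgB; apply: cvgM;
    [exact: cc|exact: cR|exact: cs|exact: cI].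
rewrite (funext (Im_ptrans t w)); apply: cvgD; apply: cvgM;
  [exact: cc|exact: cI|exact: cs|exact: cR].
Qed.

Lemma ptrans_cont_time w p : continuous (fun q => Re (w q)) -> continuous (fun q => Im (w q)) ->
  continuous (fun s : R => Re (ptrans s w p)) /\ continuous (fun s : R => Im (ptrans s w p)).
Proof.
move=> cr cim.
have cg (g : R -> R) : continuous g -> continuous (fun s : R => g (s * theta p)).
  move=> cg' s; have h : {for s, continuous (fun s : R => s * theta p)}.
    exact: (cvgMr_tmp (@cvg_id _ (nbhs s))).
  exact: (continuous_comp h (cg' _)).
have cc := cg _ (@continuous_cos R); have cs := cg _ (@continuous_sin R).
have fl (f : H -> R) : continuous f -> continuous (fun s : R => f (p + s *: V p)).
  by move=> cf s; apply: (continuous_comp (@flow_cont_time R V fV p s) (cf _)).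
have cR := fl _ cr; have cI := fl _ cim.
split=> s.
  rewrite (funext (fun s => Re_ptrans s w p)); apply: cvgB; apply: cvgM;
    [exact: cc|exact: cR|exact: cs|exact: cI].
rewrite (funext (fun s => Im_ptrans s w p)); apply: cvgD; apply: cvgM;
  [exact: cc|exact: cI|exact: cs|exact: cR].
Qed.

(** The time T is cut into equal steps of length e, so that |W_T u - u| <= |T| |W_e u - u| / |e|. As
    e tends to 0, the square of the last quotient tends to |Du|^2 by dominated convergence. *)
Lemma ptrans_estimate (T : R) : T != 0 ->
  nrm (cmb (ptrans T u) (-1) u) <= `|T| * nrm Du.
Proof.
move=> T0; have hu := Cc_L2' cu ci; have hD := Cc_L2' cDu ciD.
(* The shift by K makes all steps at most 1 in absolute value, the range in which the flow is
   controlled by one box. *)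
pose K := Num.bound `|T|.
pose e n : R := T / (n + K).+1%:R.
have nK n : 0 < (n + K).+1%:R :> R by rewrite ltr0n.
have e0 n : e n != 0 by rewrite mulf_neq0 // invr_neq0 // gt_eqF.
have e1 n : `|e n| <= 1.
  rewrite /e normrM normfV (gtr0_norm (nK n)) ler_pdivrMr // mul1r.
  apply: (le_trans (ltW (archi_boundP (normr_ge0 T)))).
  by rewrite ler_nat ltnW // ltnS leq_addl.
pose Q n p := (e n) ^- 2 * ipf (cmb (ptrans (e n) u) (-1) u) (cmb (ptrans (e n) u) (-1) u) p.
have hW n : L2' (cmb (ptrans (e n) u) (-1) u).
  by apply: L2'_cmb => //; have [] := n2_ptrans (e n) hu.
have QE n p : exists s1 s2 : R, [/\ `|s1| <= `|e n|, `|s2| <= `|e n| &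
    Q n p = Re (ptrans s1 Du p) ^+ 2 + Im (ptrans s2 Du p) ^+ 2].
  have [[s1 h1 E1] [s2 h2 E2]] := ptrans_mvt p (e n); exists s1, s2; split=> //.
  rewrite /Q /ipf Re_cmb Im_cmb !mulN1r E1 E2.
  by move: (Re _) (Im _) => x y; field.
have cipf w : Cc (fun p => Re (w p)) -> Cc (fun p => Im (w p)) -> Cc (ipf w w).
  by move=> h1 h2; apply: Cc_add; apply: Cc_mull => //; [case: h1|case: h2].
have [B [C hBC]] := flow_le_box fV (cipf _ cDu ciD).
have cQ : (\int[mu]_p Q n p)%R @[n --> \oo] --> (\int[mu]_p ipf Du Du p)%R.
  apply: (@box_dct _ _ _ B (2 * C)).
  - move=> n p; apply: cvgMr.
    have [c1 c2] := ptrans_cont (e n) (proj1 cu) (proj1 ci).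
    have c3 : continuous (fun p => Re (cmb (ptrans (e n) u) (-1) u p)).
      rewrite (funext (Re_cmb _ _ _)) => q; apply: cvgD; first exact: c1.
      by apply: cvgMr; have [c _] := cu; exact: c.
    have c4 : continuous (fun p => Im (cmb (ptrans (e n) u) (-1) u p)).
      rewrite (funext (Im_cmb _ _ _)) => q; apply: cvgD; first exact: c2.
      by apply: cvgMr; have [c _] := ci; exact: c.
    by apply: cvgD; apply: cvgM; [exact: c3|exact: c3|exact: c4|exact: c4].
  - by have [] := cipf _ cDu ciD.
  - move=> p; have [cR cI] := ptrans_cont_time p (proj1 cDu) (proj1 ciD).
    have [s1 hs1] := choice (fun n => QE n p); have [s2 hs2] := choice hs1.
    have ecvg : e n @[n --> \oo] --> (0 : R).
      apply: (@cvg0_le _ (fun n => `|T| * harmonic n) _ 0).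
        move=> n _; rewrite /e normrM ler_wpM2l // normfV (gtr0_norm (nK n)) /=.
        by rewrite lef_pV2 ?posrE ?ltr0n // ler_nat ltnS leq_addr.
      rewrite -(mulr0 `|T|); apply: cvgM; [exact: cvg_cst|exact: cvg_harmonic].
    have scvg (s : nat -> R) : (forall n, `|s n| <= `|e n|) -> s @ \oo --> (0 : R).
      move=> se; apply: (@cvg0_le _ (fun n => `|e n|) _ 0) => [n _|]; first exact: se.
      by rewrite -(@normr0 _ R); exact: cvg_norm.
    have c1 := scvg s1 (fun n => let: And3 h _ _ := hs2 n in h).
    have c2 := scvg s2 (fun n => let: And3 _ h _ := hs2 n in h).
    have E n : Q n p = Re (ptrans (s1 n) Du p) ^+ 2 + Im (ptrans (s2 n) Du p) ^+ 2.
      by have [] := hs2 n.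
    rewrite (funext E) /ipf.
    have k1 : Re (ptrans (s1 n) Du p) @[n --> \oo] --> Re (Du p).
      by rewrite -{2}(ptrans0 Du); exact: (continuous_cvg _ (cR 0) c1).
    have k2 : Im (ptrans (s2 n) Du p) @[n --> \oo] --> Im (Du p).
      by rewrite -{2}(ptrans0 Du); exact: (continuous_cvg _ (cI 0) c2).
    by have k3 := cvgD (cvgM k1 k1) (cvgM k2 k2); exact: k3.
  - move=> n p; have [s1 [s2 [h1 h2 ->]]] := QE n p.
    have b (s : R) : `|s| <= `|e n| -> ipf (ptrans s Du) (ptrans s Du) p <= boxf B C p.
      move=> se; rewrite ipf_ptrans; apply: le_trans (ler_norm _) (hBC _ _ _).
      exact: le_trans (e1 n).
    have := b _ h1; have := b _ h2; rewrite /ipf -!expr2.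
    rewrite ger0_norm ?addr_ge0 ?sqr_ge0 //.
    have -> : boxf B (2 * C) p = 2 * boxf B C p by rewrite /boxf; ring.
    have := sqr_ge0 (Im (ptrans s1 Du p)); have := sqr_ge0 (Re (ptrans s2 Du p)).
    by lra.
have QI n : (\int[mu]_p Q n p = (e n) ^- 2 * n2 (cmb (ptrans (e n) u) (-1) u))%R.
  by rewrite /Q RintegralZl //; have [] := hW n.
have bound n : n2 (cmb (ptrans T u) (-1) u) <= T ^+ 2 * (\int[mu]_p Q n p)%R.
  have := nrm_ptrans_iter (e n) (n + K).+1 hu.
  rewrite (_ : _ * e n = T); last by rewrite /e mulrC divfK // gt_eqF.
  rewrite -ler_sqr ?nnegrE ?mulr_ge0 ?sqrtr_ge0 ?ler0n //.
  rewrite exprMn /nrm !sqr_sqrtr ?n2_ge0 // QI => h; apply: le_trans h _.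
  rewrite le_eqVlt; apply/orP; left; apply/eqP; rewrite /e; field.
  by rewrite T0 /= gt_eqF.
have lim : n2 (cmb (ptrans T u) (-1) u) <= T ^+ 2 * n2 Du.
  apply: (ler_cvg_to (cvg_cst _) (cvgM (cvg_cst (T ^+ 2)) cQ)).
  exact: nearW.
rewrite -sqrtr_sqr /nrm -sqrtrM ?sqr_ge0 //; exact: ler_wsqrtr.
Qed.

End parallel_transport.

(** * A loop with holonomy -1 and the lower bound it gives *)

Section loop.
Context {R : realType}.
Local Notation H := (heis R).
Implicit Types (u w : H -> R[i]).
Local Notation Re := complex.Re.
Local Notation Im := complex.Im.

(** W_t w - u = W_t (w - u) + (W_t u - u): a further leg of the loop costs only the displacement of
    [u] itself along that leg, where [ptrans_estimate] applies. *)
Lemma nrm_ptrans_step (V : H -> H) (theta : H -> R) t u w :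
  straight_flow V -> continuous theta -> L2' u -> L2' w ->
  L2' (ptrans V theta t w) /\
  nrm (cmb (ptrans V theta t w) (-1) u) <=
    nrm (cmb w (-1) u) + nrm (cmb (ptrans V theta t u) (-1) u).
Proof.
move=> fV ct hu hw; have [hTw _] := n2_ptrans fV ct t hw; split=> //.
have [hTu _] := n2_ptrans fV ct t hu.
have [hTd nE] := n2_ptrans fV ct t (L2'_cmb (-1) hw hu).
have := nrmD hTd (L2'_cmb (-1) hTu hu).
rewrite {2}/nrm nE ptrans_cmb; congr (_ <= _); congr nrm.
by apply/funext => p; apply: complexP; rewrite ?Re_cmb ?Im_cmb; ring.
Qed.

(* A primitive of dx /\ omega adapted to the argument: it vanishes along X, and
   its phase is constant along the integral curves of Y. *)
Definition loop_form : one_form R :=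
  OneForm (fun=> 0) (fun p => p.1.1 ^+ 2 / 2) (fun p => p.1.1).

Lemma smooth_loop_form : smooth_form loop_form.
Proof.
split; [exact: smooth_cst|rewrite /=|exact: smooth_coord1].
under eq_fun do rewrite expr2.
by apply: smooth_mul; [apply: smooth_mul; exact: smooth_coord1|exact: smooth_cst].
Qed.

Lemma extd_loop_form : is_extd loop_form (const_field 1 0).
Proof.
move=> p; rewrite /extd /coord2 /const_field /loop_form /=.
have [dx dy dz] : [/\ forall v : H, is_derive p v (fun q : H => q.1.1) v.1.1,
    forall v : H, is_derive p v (fun q : H => q.1.2) v.1.2 &
    forall v : H, is_derive p v (fun q : H => q.2) v.2].
  by split=> v; have [] := is_derive_coord p v.
have D2 (v : H) : is_derive p v (fun q : H => q.1.1 ^+ 2 / 2 - q.1.1 / 2 * q.1.1) 0.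
  rewrite (_ : (fun q => _) = fun=> 0); first exact: is_derive_cst.
  by apply/funext => q; field.
have D1 (v : H) : is_derive p v (fun q : H => 0 + q.1.2 / 2 * q.1.1) (v.1.2 / 2 * p.1.1 + p.1.2 / 2 * v.1.1).
  have h := is_deriveMul (is_deriveMul (dy v) (is_derive_cst (2^-1 : R) p v)) (dx v).
  rewrite (_ : (fun q => _) = fun q : H => q.1.2 * 2^-1 * q.1.1); last first.
    by apply/funext => q; rewrite add0r.
  by apply: (is_derive_eq h); rewrite mulr0 addr0.
have [_ ->] := D2 e_x; have [_ ->] := D1 e_y; have [_ ->] := dx e_x.
have [_ ->] := D1 e_z; have [_ ->] := dx e_y; have [_ ->] := D2 e_z.
by rewrite /e_x /e_y /e_z /=; congr (_, _, _); field.
Qed.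

Let phase0 (p : H) : R := 0.
Let phase2 (p : H) : R := p.1.1 ^+ 2 / 2.
Let tX t u := ptrans (@Xv R) phase0 t u.
Let tY t u := ptrans (@Yv R) phase2 t u.

Let cis (x : R) : R[i] := cos x +i* sin x.
Let cisD x y : cis x * cis y = cis (x + y).
Proof. by apply: complexP; rewrite ?ReM ?ImM /= ?cosD ?sinD; ring. Qed.

(* The phase gained along this closed loop from (x, y, z) is
   s ((x + 1)^2 + (x - 1)^2 - 2 x^2) / 2 = s, with s = pi. *)
Lemma loop_holonomy u :
  tX 1 (tY pi (tX (-2) (tY pi (tX 1 (tY (- (2 * pi)) u))))) = (fun p => - u p).
Proof.
apply/funext => p; rewrite /tX /tY /ptrans -!/(cis _) !mulrA !cisD !flowXE !flowYE.
case: p => [[x y] z]; rewrite /phase0 /phase2 /flowX /flowY /=.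
set a := cis _; set q := (_, _, _).
rewrite (_ : q = (x, y, z)); last by rewrite /q; congr (_, _, _); field.
rewrite (_ : a = -1) ?mulN1r //.
rewrite /a (_ : _ + _ = pi); last by field.
by rewrite /cis cospi sinpi; apply: complexP; rewrite /= ?oppr0.
Qed.

(** The six legs in numbers: the X-legs add up to 4 a and the Y-legs to 4 pi b <= 16 b, against 2 N
    = |-u - u|. *)
Let chain (r0 r1 r2 r3 r4 r5 r6 qX1 qX2 qY1 qY2 N a b : R) :
  r1 <= r0 + qY2 -> r2 <= r1 + qX1 -> r3 <= r2 + qY1 -> r4 <= r3 + qX2 ->
  r5 <= r4 + qY1 -> r6 <= r5 + qX1 -> r0 = 0 -> r6 = 2 * N ->
  qX1 <= 1 * a -> qX2 <= 2 * a -> qY1 <= pi * b -> qY2 <= 2 * pi * b ->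
  pi * b <= 4 * b -> N <= 2 * a + 8 * b.
Proof. lra. Qed.

(** From |u| <= 2 a + 8 b one gets |u|^2 <= 8 a^2 + 128 b^2 <= 128 (a^2 + b^2); this is the origin
    of 128. *)
Lemma loop_bound u : test_function u -> 128^-1 * n2 u <= qf loop_form u u.
Proof.
move=> tu; have sA := smooth_loop_form.
have tX' := tf_covX sA tu; have tY' := tf_covY sA tu.
have hu := tf_L2' tu.
have fX := @straight_flowX R; have fY := @straight_flowY R.
have c0 : continuous phase0 by move=> p; exact: cvg_cst.
have c2 : continuous phase2.
  by have [_ /smooth_continuous h _] := sA.
have [ur ui] : Cc (fun p => Re (u p)) /\ Cc (fun p => Im (u p)).
  by have [/tfR_Cc h1 /tfR_Cc h2] := (test_functionE u).1 tu.
have [Xr Xi] : Cc (fun p => Re (covX loop_form u p)) /\ Cc (fun p => Im (covX loop_form u p)).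
  by have [/tfR_Cc h1 /tfR_Cc h2] := (test_functionE _).1 tX'.
have [Yr Yi] : Cc (fun p => Re (covY loop_form u p)) /\ Cc (fun p => Im (covY loop_form u p)).
  by have [/tfR_Cc h1 /tfR_Cc h2] := (test_functionE _).1 tY'.
have [sr si] : smooth (fun p => Re (u p)) /\ smooth (fun p => Im (u p)).
  by have [[? _] [? _]] := (test_functionE u).1 tu.
have estX t : t != 0 -> nrm (cmb (tX t u) (-1) u) <= `|t| * nrm (covX loop_form u).
  apply: (ptrans_estimate fX c0 (fun _ _ => erefl) ur ui Xr Xi) => p.
    apply: (is_derive_eq (is_derive_X p sr)).
    by rewrite Re_covX /phase0 /= mul0r subr0 addr0.
  apply: (is_derive_eq (is_derive_X p si)).
  by rewrite Im_covX /phase0 /= mul0r addr0 subr0.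
have phase2Y t p : phase2 (p + t *: Yv p) = phase2 p by rewrite flowYE.
have estY t : t != 0 -> nrm (cmb (tY t u) (-1) u) <= `|t| * nrm (covY loop_form u).
  apply: (ptrans_estimate fY c2 phase2Y ur ui Yr Yi) => p.
    by apply: (is_derive_eq (is_derive_Y p sr)); rewrite Re_covY subrK.
  by apply: (is_derive_eq (is_derive_Y p si)); rewrite Im_covY addrK.
have p0 : 0 < pi :> R := pi_gt0 R.
have p4 : pi <= 4 :> R by have := pihalf_lt2 R; lra.
have [h1 b1] := nrm_ptrans_step (- (2 * pi)) fY c2 hu hu.
have [h2 b2] := nrm_ptrans_step 1 fX c0 hu h1.
have [h3 b3] := nrm_ptrans_step pi fY c2 hu h2.
have [h4 b4] := nrm_ptrans_step (-2) fX c0 hu h3.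
have [h5 b5] := nrm_ptrans_step pi fY c2 hu h4.
have [h6 b6] := nrm_ptrans_step 1 fX c0 hu h5.
have E0 : nrm (cmb u (-1) u) = 0.
  by rewrite /nrm n2_cmb // (_ : _ + _ = 0) ?sqrtr0 // /n2; ring.
have E6 : nrm (cmb (tX 1 (tY pi (tX (-2) (tY pi (tX 1 (tY (- (2 * pi)) u)))))) (-1) u) = 2 * nrm u.
  (* Writing -u - u as u - 3 u lets [n2_cmb] compute its norm. *)
  rewrite loop_holonomy (_ : cmb _ _ _ = cmb u (-3) u).
    rewrite /nrm n2_cmb // (_ : _ + _ = 2 ^+ 2 * n2 u); last by rewrite /n2; ring.
    by rewrite sqrtrM ?sqr_ge0 // sqrtr_sqr ger0_norm.
  by apply/funext => p; apply: complexP; rewrite ?Re_cmb ?Im_cmb ?ReN ?ImN; ring.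
have eX1 := estX 1 (oner_neq0 _); have eX2 : -2 != 0 :> R by rewrite oppr_eq0 pnatr_eq0.
have {}eX2 := estX _ eX2.
have eY1 := estY pi (lt0r_neq0 p0); have eY2 : - (2 * pi) != 0 :> R.
  by rewrite oppr_eq0 mulf_neq0 ?pnatr_eq0 // lt0r_neq0.
have {}eY2 := estY _ eY2.
rewrite normr1 in eX1; rewrite normrN ger0_norm // in eX2.
rewrite (gtr0_norm p0) in eY1; rewrite normrN normrM (gtr0_norm p0) ger0_norm // in eY2.
have key : nrm u <= 2 * nrm (covX loop_form u) + 8 * nrm (covY loop_form u).
  apply: (chain b1 b2 b3 b4 b5 b6 E0 E6 eX1 eX2 eY1 eY2).
  by rewrite ler_wpM2r // sqrtr_ge0.
have uE : n2 u = nrm u ^+ 2 by rewrite /nrm (sqr_sqrtr (n2_ge0 u)).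
have qE : qf loop_form u u = nrm (covX loop_form u) ^+ 2 + nrm (covY loop_form u) ^+ 2.
  by rewrite /nrm (sqr_sqrtr (n2_ge0 (covX loop_form u))) (sqr_sqrtr (n2_ge0 (covY loop_form u))).
rewrite uE qE ler_pdivrMl //.
have N0 : 0 <= nrm u := sqrtr_ge0 _.
move: (nrm u) (nrm (covX loop_form u)) (nrm (covY loop_form u)) key N0 => N a b key N0.
have : N ^+ 2 <= (2 * a + 8 * b) ^+ 2 by rewrite ler_sqr // nnegrE; exact: le_trans key.
move=> h; apply: (le_trans h).
rewrite (_ : 128 * _ = (2 * a + 8 * b) ^+ 2 + ((8 * b - 2 * a) ^+ 2 + 120 * a ^+ 2)); last ring.
by rewrite lerDl; apply: addr_ge0; [exact: sqr_ge0|apply: mulr_ge0 => //; exact: sqr_ge0].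
Qed.

End loop.

(** * A nonzero test function *)

Section bump.
Context {R : realType}.
Local Notation H := (heis R).
Local Notation mu := (@heis_measure R).

Lemma expr_le_expR (k : nat) (y : R) : 0 <= y -> y ^+ k <= k`!%:R * expR y.
Proof.
move=> y0; case: k => [|k]; first by rewrite expr0 mul1r (le_trans _ (expR_ge1Dx y)) // lerDl.
rewrite -ler_pdivrMl ?ltr0n ?fact_gt0 // mulrC.
by apply: (le_trans _ (expR_ge1Dxn k y0)); rewrite lerDr.
Qed.

(** The power y^k is there for the induction on P: multiplication by the variable turns k into k +
    1. *)
Lemma horner_le_expR (P : {poly R}) (k : nat) :
  exists2 C : R, 0 <= C & forall y, 0 <= y -> `|P.[y]| * y ^+ k <= C * expR y.
Proof.
elim/poly_ind: P k => [|P c IH] k.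
  by exists 0 => // y _; rewrite horner0 normr0 !mul0r.
have [C C0 hC] := IH k.+1; exists (C + `|c| * k`!%:R).
  by rewrite addr_ge0 // mulr_ge0 // ler0n.
move=> y y0; rewrite hornerMXaddC mulrDl -mulrA.
have h1 := hC y y0; have h2 := ler_wpM2l (normr_ge0 c) (expr_le_expR k y0).
apply: (le_trans _ (lerD h1 h2)).
apply: (@le_trans _ _ ((`|P.[y] * y| + `|c|) * y ^+ k)).
  by apply: ler_wpM2r; [exact: exprn_ge0|exact: ler_normD].
by rewrite mulrDl normrM (ger0_norm y0) exprS mulrA.
Qed.

(* The functions [flat_exp P] extend x |-> P(1/x) exp(-1/x) by 0 and are closed
   under differentiation. *)
Definition flat_exp (P : {poly R}) (x : R) : R :=
  if 0 < x then P.[x^-1] * expR (- x^-1) else 0.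

(** The previous bound with k = 2 at y = 1/x. Quadratic decay at 0 is what makes the derivative
    there exist and vanish. *)
Lemma flat_exp_le (P : {poly R}) : exists2 C : R, 0 <= C & forall x, `|flat_exp P x| <= C * x ^+ 2.
Proof.
have [C C0 hC] := horner_le_expR P 2; exists C => // x; rewrite /flat_exp.
case: ltP => [x0|_]; last by rewrite normr0 mulr_ge0 // sqr_ge0.
have := hC x^-1; rewrite invr_ge0 ltW // => /(_ isT).
rewrite normrM (ger0_norm (expR_ge0 _)) expRN exprVn => h.
rewrite ler_pdivrMr ?expR_gt0 // mulrAC -ler_pdivrMr ?exprn_gt0 //.
Qed.

(** For x > 0 the derivative of P(1/x) exp(-1/x) is x^-2 (P - P')(1/x) exp(-1/x), so that
    differentiation acts on polynomials as P |-> X^2 (P - P'). *)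
Lemma is_derive_flat_exp (P : {poly R}) (x : R) :
  is_derive x 1 (flat_exp P) (flat_exp ('X^2 * (P - P^`())) x).
Proof.
have [x0|x0|->] := ltgtP x 0.
- have z y : y < 0 -> forall Q, flat_exp Q y = 0 by move=> y0 Q; rewrite /flat_exp ltNge ltW.
  rewrite (z _ x0); apply: (@near_eq_is_derive R _ _ (fun=> 0) _ _ _ _ _ (is_derive_cst (0 : R) x (1 : R))).
  near=> y; rewrite z //.
  by near: y; exact: lt_nbhsl.
- have dV : is_derive x 1 (fun y : R => y^-1) (- x ^- 2).
    by have := is_deriveV (f := id) (lt0r_neq0 x0) (is_derive_id x (1 : R)); rewrite /GRing.scale /= mulr1.
  have dP := is_derive1_comp (is_derive_poly P x^-1) dV.
  have dN := is_deriveN dV.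
  have dE := is_derive1_comp (is_derive_expR _) dN.
  apply: (@near_eq_is_derive R _ _ (fun y : R => P.[y^-1] * expR (- y^-1)) _ _ _ _ _ _).
    near=> y; rewrite /flat_exp (_ : 0 < y) //.
    by rewrite -oppr_lt0; near: y; apply: Nlt_nbhsl; rewrite oppr_lt0.
  apply: (is_derive_eq (is_deriveMul dP dE)).
  rewrite /flat_exp x0 !hornerE /= opprK -exprVn.
  rewrite -[(- _) x]/(- x^-1).
  by move: P.[x^-1] P^`().[x^-1] => a b; ring.
- have [C C0 hC] := flat_exp_le P.
  have f0 Q : flat_exp Q 0 = 0 by rewrite /flat_exp ltxx.
  have E : (fun t : R => t^-1 *: ((flat_exp P \o shift 0) (t *: 1) - flat_exp P 0)) @ 0^' --> (0 : R).
    apply/cvgrPdist_le => eps e0.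
    have C1 : 0 < C + 1 by rewrite ltr_wpDl.
    have eC : 0 < eps / (C + 1) by rewrite divr_gt0.
    near=> t.
    rewrite sub0r normrN f0 subr0 /= addr0 [t *: 1]mulr1 normrM normfV.
    have t0 : t != 0 by near: t; exact: nbhs_dnbhs_neq.
    rewrite ler_pdivrMl ?normr_gt0 //; apply: (le_trans (hC t)).
    rewrite -(@real_normK _ t) ?num_real // expr2 mulrCA ler_wpM2l //.
    have te : `|t| <= eps / (C + 1) by near: t; exact: dnbhs0_le.
    move: te; rewrite ler_pdivlMr // => te; apply: le_trans te.
    by rewrite mulrC ler_wpM2l // lerDl.
  rewrite f0; apply: DeriveDef; [apply/cvg_ex; exists 0; exact: E|exact/cvg_lim].
Unshelve. all: end_near. Qed.

Lemma smooth_flat_exp (f : H -> R) : smooth f -> smooth (fun p => flat_exp 1 (f p)).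
Proof.
move=> sf k; pose h n := flat_exp (iter n (fun P => 'X^2 * (P - P^`())) 1).
by apply: (@Ck_comp R k h f 0%N) => // n x; exact: is_derive_flat_exp.
Qed.

Definition bump (x : R) : R := flat_exp 1 (1 - x) * flat_exp 1 (1 + x).

Lemma smooth_bump (f : H -> R) : smooth f -> smooth (fun p => bump (f p)).
Proof.
move=> sf; have s1 := smooth_cst (1 : R).
exact: smooth_mul (smooth_flat_exp (smooth_sub s1 sf)) (smooth_flat_exp (smooth_add s1 sf)).
Qed.

Lemma bump_out x : 1 < `|x| -> bump x = 0.
Proof.
rewrite /bump /flat_exp lter_normr => /orP[h|h].
  by rewrite [0 < 1 - x]ltNge (_ : 1 - x <= 0) ?mul0r //; lra.
by rewrite [0 < 1 + x]ltNge (_ : 1 + x <= 0) ?mulr0 //; lra.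
Qed.

Lemma bump_in x : `|x| <= 2^-1 -> expR (- 4) <= bump x.
Proof.
move=> /ler_normlP[h1 h2].
have E y : 2^-1 <= y -> expR (- 2) <= flat_exp 1 y.
  move=> hy; have y0 : 0 < y by lra.
  by rewrite /flat_exp y0 hornerC mul1r ler_expR lerN2 -[leRHS]invrK lef_pV2 ?posrE.
rewrite (_ : - 4 = - 2 + - 2); last ring.
by rewrite expRD; apply: ler_pM; rewrite ?expR_ge0 //; apply: E; lra.
Qed.

Definition bump3 (p : H) : R := bump p.1.1 * bump p.1.2 * bump p.2.

Lemma exists_test_function : exists w : H -> R[i], test_function w /\ 0 < n2 w.
Proof.
pose w (p : H) : R[i] := (bump3 p)%:C.
have tw : test_function w.
  apply/test_functionE; split; split; rewrite /w /=.
  - apply: smooth_mul; [apply: smooth_mul|]; apply: smooth_bump;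
      [exact: smooth_coord1|exact: smooth_coord2|exact: smooth_coord3].
  - exists 1 => p; rewrite ltNge => hp; rewrite /bump3.
    have [h|h1] := ltP 1 `|p.1.1|; first by rewrite bump_out // !mul0r.
    have [h|h2] := ltP 1 `|p.1.2|; first by rewrite (bump_out h) mulr0 mul0r.
    have [h|h3] := ltP 1 `|p.2|; first by rewrite (bump_out h) mulr0.
    by move: hp; rewrite (_ : `|p| <= 1) //; apply/heis_norm_le.
  - exact: smooth_cst.
  - by exists 0.
exists w; split=> //; have [_ _ iw] := tf_L2' tw.
set c := expR (- 4) : R; have c0 : 0 < c := expR_gt0 _.
(* On the cube |p| <= 1/2 each of the three factors of [bump3] is at least c = e^(-4), and |w|^2 is
   the square of their product. *)
have le p : boxf 2^-1 (c ^+ 6) p <= ipf w w p.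
  rewrite /boxf indicE; have [/heis_norm_le[h1 h2 h3]|hp] := leP `|p| 2^-1; last first.
    by rewrite memNset ?mulr0 ?ipf_ge0 //= leNgt hp.
  rewrite mem_set; last exact/heis_norm_le.
  rewrite mulr1 /ipf /w /= mulr0 addr0.
  have b1 : c ^+ 3 <= bump3 p.
    rewrite /bump3 !exprS expr0 mulr1 mulrA; apply: ler_pM.
    - by rewrite mulr_ge0 // ltW.
    - exact: ltW.
    - by apply: ler_pM; rewrite ?(ltW c0) //; exact: bump_in.
    - exact: bump_in.
  by rewrite (exprM c 3 2) expr2; apply: ler_pM => //; rewrite exprn_ge0 // ltW.
have : (\int[mu]_p boxf 2^-1 (c ^+ 6) p <= n2 w)%R.
  by apply: le_Rintegral => //; exact: boxf_integrable.
apply: lt_le_trans; rewrite RintegralZl //; last first.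
  have := boxf_integrable 2^-1 (1 : R); congr (_.-integrable _ (EFin \o _)).
  by apply/funext => p; rewrite /boxf mul1r.
rewrite mulr_gt0 ?exprn_gt0 // /Rintegral integral_indic ?setIT //; last exact: measurable_box.
apply: fine_gt0; rewrite box_fin andbT; exact: box_gt0.
Qed.

End bump.

(** * The bottom for constant fields *)

Section constant_field.
Context {R : realType}.

Lemma is_bottom_gauge (A A' : one_form R) B m : smooth_form A -> smooth_form A' ->
  is_extd A B -> is_extd A' B -> is_bottom A m -> is_bottom A' m.
Proof.
move=> sA sA' eA eA' /is_bottom_transport-/(_ _ 1 ltr01); rewrite mul1r invr1.
by apply; [exact: (gauge_transport sA sA' eA eA')|exact: (gauge_transport sA' sA eA' eA)].
Qed.

(** The lower bound is known for [loop_form] and the scaling law for [std_form]; both are potentials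
    of dx /\ omega, so gauge invariance joins the two. *)
Lemma is_bottom_std_gt0 (m : R) : is_bottom (std_form 1 0) m -> 0 < m.
Proof.
move=> /(is_bottom_gauge (smooth_std_form 1 0) smooth_loop_form (extd_std_form 1 0) extd_loop_form).
by move=> /(is_bottom_le loop_bound); apply: lt_le_trans; rewrite invr_gt0.
Qed.

(* The dilations preserve the zero field, so its bottom m satisfies m = 4 m. *)
Lemma is_bottom_std0 : is_bottom (std_form 0 0) (0 : R).
Proof.
have [m hm] := is_bottom_exists (std_form 0 0) (@exists_test_function R).
have c1 : (1 : R) ^+ 2 + 0 ^+ 2 = 1 by rewrite expr1n expr0n addr0.
have T (r : R) : 0 < r -> transport (std_form 0 0) (std_form 0 0) (r ^+ 2).
  move=> r0; have := std_form_transport 0 0 r0 c1.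
  by rewrite !mul0r oppr0 !mul0r addr0 mulr0.
have T2 : transport (std_form (0 : R) 0) (std_form 0 0) (2 ^+ 2)^-1.
  by rewrite -exprVn; apply: T; rewrite invr_gt0.
have r4 : 0 < (2 : R) ^+ 2 by rewrite exprn_gt0.
have hm4 := is_bottom_transport r4 (T _ (ltr0n _ 2)) T2 hm.
have h1 := is_bottom_le hm4.1 hm; have h2 := is_bottom_ge hm.
have m0 : m = 0 by apply/eqP; rewrite eq_le h2 andbT; lra.
by rewrite m0 in hm.
Qed.

Lemma is_bottom_std (m b1 b2 : R) : is_bottom (std_form 1 0) m ->
  is_bottom (std_form b1 b2) (m * (Num.sqrt (b1 ^+ 2 + b2 ^+ 2)) `^ (2 / 3)).
Proof.
move=> hm; have b0 : 0 <= b1 ^+ 2 + b2 ^+ 2 by rewrite addr_ge0 ?sqr_ge0.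
set N := Num.sqrt _; have N2 : N ^+ 2 = b1 ^+ 2 + b2 ^+ 2 by rewrite sqr_sqrtr.
(* The zero field is not a dilate of dx /\ omega and is treated apart; there 0^(2/3) = 0. *)
have [N0|N0] := eqVneq N 0.
  move: N2; rewrite N0 expr0n => /esym/eqP.
  rewrite paddr_eq0 ?sqr_ge0 // !sqrf_eq0 => /andP[/eqP-> /eqP->].
  rewrite powR0 ?mulr0; first exact: is_bottom_std0.
  by rewrite mulf_neq0 ?invr_neq0 ?pnatr_eq0.
have Np : 0 < N by rewrite lt0r N0 sqrtr_ge0.
pose r := N `^ 3^-1; have r0 : 0 < r := powR_gt0 _ Np.
have r3 : r ^+ 3 = N.
  by rewrite -powR_mulrn ?ltW // -powRrM mulVf ?pnatr_eq0 // powRr1 ?ltW.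
have r2 : r ^+ 2 = N `^ (2 / 3) by rewrite -powR_mulrn ?ltW // -powRrM mulrC.
(* [std_form_transport] takes the field (1, 0) to r^3 (c, - s), which has to equal (b1, b2); hence
   the sign of s. *)
pose c := b1 / N; pose s := - (b2 / N).
have cs : c ^+ 2 + s ^+ 2 = 1.
  by rewrite /c /s sqrrN !expr_div_n -mulrDl -N2 divff // sqrf_eq0.
have cs' : c ^+ 2 + (- s) ^+ 2 = 1 by rewrite sqrrN.
have T1 := std_form_transport 1 0 r0 cs.
have rV0 : 0 < r^-1 by rewrite invr_gt0.
(* The inverse dilation and rotation lead back to (1, 0) and provide the converse transport. *)
have T2 := std_form_transport b1 b2 rV0 cs'.
rewrite r3 (_ : N * _ = b1) in T1; last by rewrite /c; field.
rewrite (_ : N * _ = b2) in T1; last by rewrite /s; field.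
rewrite !exprVn r3 (_ : N^-1 * _ = 1) in T2; last first.
  rewrite /c /s opprK (_ : N^-1 * _ = (b1 ^+ 2 + b2 ^+ 2) / N ^+ 2); last by field.
  by rewrite -N2 divff // sqrf_eq0.
rewrite (_ : N^-1 * _ = 0) in T2; last by rewrite /c /s; field.
by rewrite mulrC -r2; apply: is_bottom_transport hm => //; rewrite exprn_gt0.
Qed.

End constant_field.

Theorem theorem2p1 (R : realType) :
  exists2 c : R, 0 < c &
    forall (b1 b2 : R) (A : one_form R),
      smooth_form A -> is_extd A (const_field b1 b2) ->
      ereal_inf [set t%:E | t in
        [set t : R | spectrum (magnetic_laplacian A) t%:C]] =
      (c * (Num.sqrt (b1 ^+ 2 + b2 ^+ 2)) `^ (2 / 3))%:E.
Proof.
have [m hm] := is_bottom_exists (std_form 1 0) (@exists_test_function R).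
exists m; first exact: is_bottom_std_gt0.
move=> b1 b2 A sA eA; have hb := is_bottom_std b1 b2 hm.
have [h1 h2] := is_bottom_gauge (smooth_std_form b1 b2) sA (extd_std_form b1 b2) eA hb.
exact: (inf_spectrum sA h1 h2).
Qed.
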